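(* Let $(n_1(k))_{k}$ and $(n_2(k))_{k}$ be two sequences of positive integers; all limits and asymptotic comparisons are as $k\to\infty$, and the index $k$ is kept implicit (in particular $\alpha_n$ depends on $k$ through $n=(n_1,n_2)$). Assume that $n_1\to+\infty$ and $n_2\to+\infty$ with $n_1=O(\sqrt{n_2})$ and $\log(n_2)=o(n_1)$. (i) If $\alpha_n>0$ is the unique solution of $\Theta(\alpha_n)=\dfrac{n_1}{\sqrt{n_2}}$, then $$p_{\mathbb{N}^2}(n_1,n_2)\sim\frac{1}{2\pi}\,\frac{\Phi(\alpha_n)}{n_2}\,\frac{e^{-\frac12\Psi(\alpha_n)}}{\sqrt{\Delta(\alpha_n)}}\exp\left\{\left(\alpha_n\Theta(\alpha_n)+2\sqrt{\Phi(\alpha_n)}\right)\sqrt{n_2}\right\}.$$ (ii) If $\alpha_n>0$ is the unique solution of $\overline{\Theta}(\alpha_n)=\dfrac{n_1}{\sqrt{n_2}}$, then $$p_{\mathbb{Z}_+^2\setminus\{0\}}(n_1,n_2)\sim\frac{1}{(2\pi)^{\frac32}}\left(\frac{\overline{\Phi}(\alpha_n)}{n_2}\right)^{\frac54}\frac{e^{\frac12\Psi(\alpha_n)}}{\sqrt{\overline{\Delta}(\alpha_n)}}\exp\left\{\left(\alpha_n\overline{\Theta}(\alpha_n)+2\sqrt{\overline{\Phi}(\alpha_n)}\right)\sqrt{n_2}\right\}.$$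
   Context: $\mathbb{Z}_+=\{0,1,2,\dots\}$ and $\mathbb{N}=\{1,2,3,\dots\}$. For $X\subset\mathbb{Z}_+^2\setminus\{0\}$ and $n\in\mathbb{Z}_+^2$, a partition of $n$ with parts in $X$ is a finite unordered family (multiset) of elements of $X$ with sum $n$, i.e. a function $\omega:X\to\mathbb{Z}_+$ with $\sum_{x\in X}\omega(x)\cdot x=n$; $p_X(n)$ is the number of such partitions. For $\alpha>0$ define $$\Phi(\alpha)=\sum_{r\ge1}\frac1{r^2}\frac{e^{-\alpha r}}{1-e^{-\alpha r}},\quad \Psi(\alpha)=\sum_{r\ge1}\frac1r\frac{e^{-\alpha r}}{1-e^{-\alpha r}},\quad \overline{\Phi}(\alpha)=\Phi(\alpha)+\frac{\pi^2}{6},$$ $$\Theta(\alpha)=-\frac{\Phi'(\alpha)}{\sqrt{\Phi(\alpha)}},\quad \overline{\Theta}(\alpha)=-\frac{\overline{\Phi}'(\alpha)}{\sqrt{\overline{\Phi}(\alpha)}},$$ $$\Delta(\alpha)=2\Phi(\alpha)\Phi''(\alpha)-\Phi'(\alpha)^2,\quad \overline{\Delta}(\alpha)=2\overline{\Phi}(\alpha)\overline{\Phi}''(\alpha)-\overline{\Phi}'(\alpha)^2.$$ $a_k\sim b_k$ means $a_k/b_k\to1$. *)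

(* Defs.v *)
From HB Require Import structures.
From mathcomp Require Import all_boot all_order all_algebra.
From mathcomp Require Import finmap.
From mathcomp Require Import all_classical all_reals all_analysis.
From mathcomp Require Import zify.
Import Order.TTheory GRing.Theory Num.Theory.
Import numFieldNormedType.Exports.

Set Implicit Arguments.
Unset Strict Implicit.
Unset Printing Implicit Defensive.

Local Open Scope classical_set_scope.
Local Open Scope ring_scope.

Section Partitions.

Definition Nsq : set (nat * nat) := [set x | (0 < x.1)%N /\ (0 < x.2)%N].

Definition Zsq_nz : set (nat * nat) := [set x | x != (0, 0)%N].

(* [w x] is the multiplicity of the part [x]; the sum is taken in the product
   monoid [nat * nat]. *)
Definition partitions (X : set (nat * nat)) (n : nat * nat) :
    set {fsfun nat * nat -> nat with 0%N} :=
  [set w | (forall x, x \in finsupp w -> X x) /\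
           \sum_(x <- finsupp w) x *+ w x = n].

(* [fset_set] is only meaningful on finite sets, see [finite_partitions]. *)
Definition npart (X : set (nat * nat)) (n : nat * nat) : nat :=
  #|` fset_set (partitions X n)|.

Lemma finite_partitions (X : set (nat * nat)) (n : nat * nat) :
  X `<=` Zsq_nz -> finite_set (partitions X n).
Proof.
move=> X0; pose I : finType := ('I_n.1.+1 * 'I_n.2.+1)%type.
pose J := 'I_(n.1 + n.2).+1.
pose s := allpairs pair (iota 0 n.1.+1) (iota 0 n.2.+1).
have sE x : (x \in s) = (x.1 <= n.1)%N && (x.2 <= n.2)%N.
  apply/allpairsP/andP => [[y []]|[x1 x2]].
    by rewrite !mem_iota !ltnS => ? ? ->.
  by exists x; rewrite !mem_iota !ltnS; split => //; exact: surjective_pairing.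
pose g (f : {ffun I -> J}) : {fsfun nat * nat -> nat with 0%N} :=
  [fsfun x in [fset y in s]%fset =>
     (f (inord x.1, inord x.2) : nat)].
suff sub : partitions X n `<=` g @` [set: {ffun I -> J}].
  by apply: sub_finite_set sub _; apply: finite_image; exact: finite_finset.
move=> w [wX wn].
have bnd x : x \in finsupp w ->
    [/\ (x.1 <= n.1)%N, (x.2 <= n.2)%N & (w x <= n.1 + n.2)%N].
  move=> xw; have /X0/= := wX _ xw.
  have wx0 : (0 < w x)%N by rewrite lt0n -mem_finsupp.
  move: wn; rewrite (big_fsetD1 x xw)/=.
  move: (\sum_(_ <- _) _) => t <-.
  have e1 (y : nat * nat) m : (y *+ m).1 = (y.1 * m)%N.
    by elim: m => [|m IH]; rewrite ?muln0// mulrS/= IH mulnS.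
  have e2 (y : nat * nat) m : (y *+ m).2 = (y.2 * m)%N.
    by elim: m => [|m IH]; rewrite ?muln0// mulrS/= IH mulnS.
  have -> : (x *+ w x + t).1 = (x.1 * w x + t.1)%N by rewrite -e1.
  have -> : (x *+ w x + t).2 = (x.2 * w x + t.2)%N by rewrite -e2.
  case: x {xw e1 e2} wx0 => [x1 x2] /=; move: (w _) => m m0 x0.
  have : (0 < x1 + x2)%N by move: x0; case: x1 x2 => [|?] [|?].
  by move=> x12; split; nia.
exists [ffun i : I => inord (w ((i.1 : nat), (i.2 : nat)))] => //.
apply/fsfunP => x; rewrite fsfunE.
case: ifPn => [|xI].
  rewrite in_fset (_ : in_mem x _ = (x \in s))// sE => /andP[x1 x2].
  have w1 : (inord x.1 : 'I_n.1.+1) = x.1 :> nat by rewrite inordK.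
  have w2 : (inord x.2 : 'I_n.2.+1) = x.2 :> nat by rewrite inordK.
  rewrite ffunE/= w1 w2 -surjective_pairing inordK// ltnS.
  have [/bnd[]//|] := boolP (x \in finsupp w).
  by rewrite mem_finsupp negbK => /eqP ->.
have [xw|] := boolP (x \in finsupp w).
  have [x1 x2 _] := bnd _ xw; case/negP: xI.
  by rewrite in_fset (_ : in_mem x _ = (x \in s))// sE x1.
by rewrite mem_finsupp negbK => /eqP ->.
Qed.

End Partitions.

Section Functions.
Variable R : realType.
Implicit Types (a : R) (f : R -> R).

(* Only meaningful for [a > 0], where these series converge. *)
Definition Phi a : R :=
  limn (fun N => \sum_(1 <= r < N)
    (r%:R ^+ 2)^-1 * (expR (- a * r%:R) / (1 - expR (- a * r%:R)))).

Definition Psi a : R :=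
  limn (fun N => \sum_(1 <= r < N)
    r%:R^-1 * (expR (- a * r%:R) / (1 - expR (- a * r%:R)))).

Definition Phibar a : R := Phi a + pi ^+ 2 / 6.

Definition theta_of f a : R := - (f^`())%classic a / Num.sqrt (f a).

Definition delta_of f a : R := 2 * f a * (f^`(2))%classic a -
  (f^`())%classic a ^+ 2.

Definition Theta := theta_of Phi.
Definition Thetabar := theta_of Phibar.
Definition Delta := delta_of Phi.
Definition Deltabar := delta_of Phibar.

Definition asymp_equiv (u v : nat -> R) : Prop :=
  u k / v k @[k --> \oo] --> (1 : R).

End Functions.

(* Main.v *)
Require Import Defs.
From HB Require Import structures.
From mathcomp Require Import all_boot all_order all_algebra.
From mathcomp Require Import finmap.
From mathcomp Require Import all_classical all_reals all_analysis.
From mathcomp Require Import measurable_realfun.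
From mathcomp Require Import zify ring lra.
Import Order.TTheory GRing.Theory Num.Theory.
Import numFieldNormedType.Exports.

Set Implicit Arguments.
Unset Strict Implicit.
Unset Printing Implicit Defensive.

Local Open Scope classical_set_scope.
Local Open Scope ring_scope.

(* With weights rho_x = exp (- (al a + be b)) on the parts x = (a, b), the number
   of partitions is, up to the factor exp (al n1 + be n2), a Fourier coefficient of
   the finite product of the (1 - rho_x e^{i th_x})^-1, th_x = a s + b t.  The
   parameter al is the one of the statement and be = sqrt (Phi al / n2) (Phibar in
   the second part); then n1 = - Phi' al / be and n2 = Phi al / be ^ 2 are, up to
   negligible errors, the means of the associated random partition.  After scaling by
   the standard deviations sqrt (Phi'' al / be) and sqrt (2 Phi al / be ^ 3), the
   integrand converges to a nondegenerate Gaussian and dominated convergence applies: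
   a part contributes at least rho (1 - cos th) / 4 to the decay of the modulus, and
   the sum of the 1 - cos (s + t b) for b <= 2 / be is bounded below on the whole
   square |s|, |t| <= pi.  Since n1 dominates log n2, the decay on the complement of
   the Gaussian range beats the volume of the domain.
   The exponential factor and the variances are double sums over the parts; expanding
   in powers of rho and summing over b first reduces them to the series
   sum_r r^-k A_i (al r), plus errors controlled by A_0 x = 1 / x - 1 / 2 + O (x),
   where A_0 x = (e^x - 1)^-1.  The parts (0, b) of the second case contribute
   sum_b - ln (1 - e^(- be b)) = pi ^ 2 / (6 be) + ln (be / (2 pi)) / 2 + o (1),
   which follows from the trapezoidal rule together with Basel's sum and Stirling's
   constant. *)

(** The ratio [n1 / sqrt n2] is only bounded above, so [al] stays above some [a0] but may tend to
    infinity, and then [Phi], [P1], [P2] all decay like e^(-al). Hence every estimate is uniform on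
    al >= a0 and measured against e^(-al). The effective size is e^(-al) / be, at least a constant
    times n1: it bounds both variances below, so errors are governed by n1^(-1/2) and the tail by
    exp (- c n1). The covariance need not converge, so the limit theorem compares with a Gaussian
    that varies with k; a uniform gap between its correlation and 1 replaces convergence. Everything
    is real: (1 - rho e^{i th})^-1 enters through log-modulus and argument, and the Fourier
    coefficient is identified by a recursion on the list of parts, not by expanding the product. The
    infinite sets of parts are cut at a bound M depending on k, chosen once all moments are within
    fixed tolerances of their infinite sums. Both cases of the theorem run together: [ax] switches
    the axes on and adds pi^2 / 6 to [Phi]. *)

Section Convergence.
Variable R : realType.
Implicit Types (u v w : nat -> R).

Lemma eq_cvgn u v (l : R) : u =1 v -> u @ \oo --> l -> v @ \oo --> l.
Proof. by move=> /funext ->. Qed.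

Lemma cvgnD u v (x y : R) : u @ \oo --> x -> v @ \oo --> y ->
  (fun k => u k + v k) @ \oo --> x + y.
Proof. exact: cvgD. Qed.

Lemma cvgnM u v (x y : R) : u @ \oo --> x -> v @ \oo --> y ->
  (fun k => u k * v k) @ \oo --> x * y.
Proof. exact: cvgM. Qed.

Lemma cvgnZ (c : R) u (x : R) : u @ \oo --> x -> (fun k => c * u k) @ \oo --> c * x.
Proof. exact: cvgMr. Qed.

Lemma near_cvg0_le u v : (\forall k \near \oo, `|u k| <= v k) ->
  v @ \oo --> 0 -> u @ \oo --> 0.
Proof.
move=> uv v0; apply: norm_cvg0.
apply: (@squeeze_cvgr _ _ _ _ (fun=> 0) _ _ _ _ _ v0); last exact: cvg_cst.
by apply: filterS uv => k uk; rewrite normr_ge0.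
Qed.

Lemma cvg0_le u v : (forall k, `|u k| <= v k) -> v @ \oo --> 0 -> u @ \oo --> 0.
Proof. by move=> uv; apply: near_cvg0_le; exact: nearW. Qed.

Lemma cvg_dist0 u (l : R) : (fun k => u k - l) @ \oo --> 0 -> u @ \oo --> l.
Proof.
move=> h; have -> : u = (fun k => (u k - l) + l).
  by apply/funext => k; rewrite subrK.
by rewrite -[X in _ --> X]add0r; apply: cvgD => //; exact: cvg_cst.
Qed.

Lemma cvg0_mul_bounded u v (K : R) : (forall k, `|v k| <= K) -> u @ \oo --> 0 ->
  (fun k => u k * v k) @ \oo --> 0.
Proof.
move=> vK u0; apply: (@cvg0_le _ (fun k => `|u k| * K)).
  by move=> k; rewrite normrM ler_wpM2l.
by rewrite -(mul0r K) -{1}(normr0 R); apply: cvgMl; exact: cvg_norm.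
Qed.

End Convergence.

(** * Consequences of the mean value theorem *)

Section MeanValue.
Variable R : realType.

Lemma MVT_closed (f f' : R -> R) (x y : R) : x <= y ->
  (forall z, x <= z <= y -> is_derive z 1 f (f' z)) ->
  exists2 c, x <= c <= y & f y - f x = f' c * (y - x).
Proof.
move=> xy df; have [||c cxy E] := @MVT_segment _ f f' x y xy.
- by move=> z; rewrite in_itv/= => /andP[/ltW xz /ltW zy]; apply: df; rewrite xz.
- apply: derivable_within_continuous => z; rewrite in_itv/= => zxy.
  exact: (@ex_derive _ _ _ _ _ _ _ (df z zxy)).
- by exists c => //; move: cxy; rewrite in_itv.
Qed.

Lemma derive_ge0_le (f f' : R -> R) (x y : R) : x <= y ->
  (forall z, x <= z <= y -> is_derive z 1 f (f' z)) ->
  (forall z, x <= z <= y -> 0 <= f' z) -> f x <= f y.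
Proof.
move=> xy df f'0; have [c cxy E] := MVT_closed xy df.
by rewrite -subr_ge0 E mulr_ge0 ?subr_ge0// f'0.
Qed.

Lemma is_derive_ln_comp (g : R -> R) (x b : R) : is_derive x 1 g b -> 0 < g x ->
  is_derive x 1 (fun y => ln (g y)) ((g x)^-1 * b).
Proof. by move=> dg gx0; apply: is_derive1_comp; exact: is_derive1_ln. Qed.

Lemma is_derive_exprn (n : nat) (x : R) :
  is_derive x 1 (fun z : R => z ^+ n) (n%:R * x ^+ n.-1).
Proof.
by apply: DeriveDef; [exact: exprn_derivable|rewrite exp_derive /GRing.scale/= mulr1].
Qed.

End MeanValue.

(** * Counting partitions *)

Section CountingPartitions.
Implicit Types (X : set (nat * nat)) (n x : nat * nat)
  (w : {fsfun nat * nat -> nat with 0%N}).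

Lemma pair_mulrn x m : x *+ m = (x.1 * m, x.2 * m)%N.
Proof.
elim: m => [|m IH]; first by rewrite mulr0n !muln0.
by rewrite mulrS IH !mulnS.
Qed.

Lemma sum_finsupp_sub w (S : {fset nat * nat}) : (finsupp w `<=` S)%fset ->
  \sum_(y <- S) y *+ w y = \sum_(y <- finsupp w) y *+ w y.
Proof.
move=> wS; apply/esym/big_fset_incl => // y _.
by rewrite mem_finsupp negbK => /eqP ->; rewrite mulr0n.
Qed.

Definition incr_part x w := [fsfun w with x |-> (w x).+1].
Definition decr_part x w := [fsfun w with x |-> (w x).-1].

Lemma incr_partE x w y :
  incr_part x w y = if y == x then (w x).+1 else w y.
Proof. by rewrite fsfun_withE. Qed.

Lemma sum_incr_part x w :
  \sum_(y <- finsupp (incr_part x w)) y *+ incr_part x w y =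
  x + \sum_(y <- finsupp w) y *+ w y.
Proof.
pose S := (x |` finsupp w)%fset.
rewrite -(@sum_finsupp_sub _ S); last first.
  apply/fsubsetP => y; rewrite mem_finsupp incr_partE !inE.
  by case: (y == x) => //=; rewrite mem_finsupp.
rewrite -(@sum_finsupp_sub w S); last exact: fsubsetUr.
have xS : x \in S by rewrite !inE eqxx.
rewrite !(big_fsetD1 x xS)/= incr_partE eqxx mulrS -addrA; congr (_ + (_ + _)).
apply: eq_big_seq => y; rewrite !inE => /andP[/negbTE yx _].
by rewrite incr_partE yx.
Qed.

(** Either [x] does not occur, or one copy of it can be removed; this is 1 / (1 - z^x) = 1 + z^x /
    (1 - z^x) read on partitions. The second set keeps [x] among the allowed parts, since further
    copies may remain. *)
Lemma partitionsU1 X n x : ~ X x ->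
  partitions (x |` X) n = partitions X n `|`
    [set w | exists2 m, n = x + m & (incr_part x @` partitions (x |` X) m) w].
Proof.
move=> nXx; apply/seteqP; split => w /=.
  move=> [wX wn]; have [xw|xw] := boolP (x \in finsupp w); last first.
    left; split => // y yw; have /= [yx|//] := wX _ yw.
    by move: xw; rewrite -yx yw.
  right; have w0 : (0 < w x)%N by rewrite lt0n -mem_finsupp.
  have wE : incr_part x (decr_part x w) = w.
    apply/fsfunP => y; rewrite incr_partE !fsfun_withE eqxx.
    by have [->|//] := eqVneq y x; rewrite prednK.
  exists (\sum_(y <- finsupp (decr_part x w)) y *+ decr_part x w y).
    by rewrite -sum_incr_part wE.
  exists (decr_part x w) => //; split=> // y; rewrite mem_finsupp fsfun_withE.
  by have [->|_] := eqVneq y x; [left|rewrite -mem_finsupp; exact: wX].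
move=> [[wX wn]|[m nE [v [vX vm] <-]]]; split => //.
- by move=> y /wX; right.
- move=> y; rewrite mem_finsupp incr_partE.
  by have [->|_] := eqVneq y x; [left|rewrite -mem_finsupp; exact: vX].
- by rewrite sum_incr_part vm.
Qed.

Lemma incr_part_inj x : injective (incr_part x).
Proof.
move=> v w /fsfunP vw; apply/fsfunP => y; have := vw y.
by rewrite !incr_partE; have [->|//] := eqVneq y x => -[].
Qed.

(** Natural subtraction is truncated, so the guard is what prevents a part exceeding [n] from
    counting the partitions of a clipped vector. *)
Lemma npartU1 X n x : x |` X `<=` Zsq_nz -> ~ X x ->
  npart (x |` X) n = (npart X n +
   if ((x.1 <= n.1) && (x.2 <= n.2))%N then
     npart (x |` X) (n.1 - x.1, n.2 - x.2)%N else 0)%N.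
Proof.
move=> xX nXx.
have XZ : X `<=` Zsq_nz by move=> y Xy; apply: xX; right.
rewrite /npart partitionsU1//; case: ifPn => [/andP[l1 l2]|lt]; last first.
  rewrite (_ : [set w | _] = set0) ?setU0 ?addn0//.
  rewrite -subset0 => w /= [m nE _]; move/negP: lt; apply.
  by rewrite nE /= !leq_addr.
set m := (_ - _, _)%N; have nE : n = x + m.
  rewrite [LHS]surjective_pairing; rewrite /m.
  by congr (_, _); rewrite /= -[RHS]/(_ + _)%N subnKC.
have -> : [set w | exists2 m, n = x + m & (incr_part x @` partitions (x |` X) m) w]
    = incr_part x @` partitions (x |` X) m.
  apply/seteqP; split => w /=; last by exists m.
  move=> [m' nE' H]; suff -> : m = m' by [].
  rewrite /m nE' [RHS]surjective_pairing.
  by congr (_, _); [exact: (addKn x.1 m'.1)|exact: (addKn x.2 m'.2)].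
have f1 := finite_partitions n XZ.
have f2 := finite_image (incr_part x) (finite_partitions m xX).
rewrite fset_setU// cardfsU (_ : (_ `&` _)%fset = fset0) ?cardfs0 ?subn0.
  congr (_ + _)%N; rewrite fset_set_image; last exact: finite_partitions.
  by rewrite card_imfset//; exact: incr_part_inj.
rewrite -fset_setI// (_ : _ `&` _ = set0) ?fset_set0//.
rewrite -subset0 => w /= [[wX _]] [v _ vw]; apply: nXx; apply: wX.
by rewrite -vw mem_finsupp incr_partE eqxx.
Qed.

Lemma npart0 n : npart set0 n = (n == (0, 0)%N).
Proof.
rewrite /npart; have [->|n0] := eqVneq.
  rewrite (_ : partitions _ _ = [set [fsfun]]).
    by rewrite fset_set1 cardfs1.
  apply/seteqP; split => w /=; last first.
    by move=> ->; split; rewrite ?finsupp0// big_nil.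
  move=> [w0 _]; apply/fsfunP => x; rewrite fsfunE.
  by have [/w0//|] := boolP (x \in finsupp w); rewrite mem_finsupp negbK => /eqP.
rewrite (_ : partitions _ _ = set0) ?fset_set0 ?cardfs0//.
rewrite -subset0 => w /= [w0 wn]; move/eqP: n0; apply; rewrite -wn big1_seq//.
by move=> y /andP[_ /w0].
Qed.

(** A part that occurs is bounded by [n] in each coordinate, so only the members of [X] in that
    rectangle matter. This lets finite lists stand for the two infinite sets of parts. *)
Lemma npart_le X Y n : Y `<=` X ->
  (forall x, X x -> (x.1 <= n.1)%N -> (x.2 <= n.2)%N -> Y x) ->
  npart X n = npart Y n.
Proof.
move=> YX XY; rewrite /npart; congr (#|` fset_set _|).
apply/seteqP; split => w /= [wX wn]; split => // x xw; last exact/YX/wX.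
have w0 : (0 < w x)%N by rewrite lt0n -mem_finsupp.
move: wn; rewrite (big_fsetD1 x xw)/=; move: (\sum_(_ <- _) _) => t nE.
apply: XY; first exact: wX.
  by rewrite -nE pair_mulrn; change (x.1 <= x.1 * w x + t.1)%N; nia.
by rewrite -nE pair_mulrn; change (x.2 <= x.2 * w x + t.2)%N; nia.
Qed.

End CountingPartitions.

(** * The Fourier integral *)

Section GeometricFactor.
Variable R : realType.
Implicit Types (rho th phi : R).

(** This is |1 - rho e^{i th}|^2. *)
Definition dist2 rho th : R := (1 - rho * cos th) ^+ 2 + (rho * sin th) ^+ 2.

(* [(1 - rho e^{i th})^-1 = expR (lmod rho th) * e^{i (arg rho th)}] *)
Definition lmod rho th : R := - ln (dist2 rho th) / 2.
Definition arg rho th : R := atan (rho * sin th / (1 - rho * cos th)).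

Lemma subr_cos_gt0 rho th : 0 <= rho < 1 -> 0 < 1 - rho * cos th.
Proof.
move=> /andP[r0 r1]; have := cos_le1 th; nra.
Qed.

Lemma dist2_gt0 rho th : 0 <= rho < 1 -> 0 < dist2 rho th.
Proof.
move=> /(subr_cos_gt0 th) h; by rewrite /dist2 ltr_pwDl// ?exprn_gt0// sqr_ge0.
Qed.

Lemma expR_lmod rho th : 0 <= rho < 1 ->
  expR (lmod rho th) = (Num.sqrt (dist2 rho th))^-1.
Proof.
move=> r01; have d0 := dist2_gt0 th r01.
rewrite /lmod mulNr expRN -powR12_sqrt ?(ltW d0)//; congr (_^-1).
by rewrite /powR gt_eqF// mulrC.
Qed.

Lemma expR_lmod_cos rho th : 0 <= rho < 1 ->
  expR (lmod rho th) * cos (arg rho th) = (1 - rho * cos th) / dist2 rho th.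
Proof.
move=> r01; have d0 := dist2_gt0 th r01; have c0 := subr_cos_gt0 th r01.
rewrite expR_lmod// cos_atan.
have -> : 1 + (rho * sin th / (1 - rho * cos th)) ^+ 2 =
    dist2 rho th / (1 - rho * cos th) ^+ 2.
  by rewrite /dist2; field; rewrite gt_eqF.
rewrite sqrtrM ?ltW// sqrtrV ?sqr_ge0// sqrtr_sqr gtr0_norm// invfM invrK.
by rewrite mulrA mulrC -invfM -expr2 sqr_sqrtr// ltW.
Qed.

Lemma expR_lmod_sin rho th : 0 <= rho < 1 ->
  expR (lmod rho th) * sin (arg rho th) = rho * sin th / dist2 rho th.
Proof.
move=> r01; have d0 := dist2_gt0 th r01; have c0 := subr_cos_gt0 th r01.
have cs0 : cos (arg rho th) != 0.
  by rewrite gt_eqF// cos_gt0_pihalf// atan_gtNpi2 atan_ltpi2.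
have -> : sin (arg rho th) = tan (arg rho th) * cos (arg rho th).
  by rewrite /tan -mulrA mulVf// mulr1.
rewrite mulrCA expR_lmod_cos// /arg atanK.
by field; rewrite !gt_eqF.
Qed.

(** Real part of e^{i phi} z = e^{i phi} + rho e^{i (phi + th)} z with z = (1 - rho e^{i th})^-1:
    the analytic counterpart of removing one copy of a part. *)
Lemma geometric_factorE rho th phi : 0 <= rho < 1 ->
  expR (lmod rho th) * cos (arg rho th + phi) =
  cos phi + rho * (expR (lmod rho th) * cos (arg rho th + (phi + th))).
Proof.
move=> r01; have d0 := dist2_gt0 th r01.
have E psi : expR (lmod rho th) * cos (arg rho th + psi) =
    ((1 - rho * cos th) * cos psi - rho * sin th * sin psi) / dist2 rho th.
  by rewrite cosD mulrBr !mulrA expR_lmod_cos// expR_lmod_sin//; ring.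
rewrite !E cosD sinD.
by rewrite /dist2; field; rewrite /dist2 in d0; rewrite gt_eqF.
Qed.

End GeometricFactor.
Lemma derivable_continuous (R : realType) (f : R -> R) :
  (forall x, derivable f x 1) -> continuous f.
Proof. by move=> df x; apply/differentiable_continuous/derivable1_diffP. Qed.

(** * Weighted partition numbers as integrals over a full period box *)

Section BoxIntegral.
Variable R : realType.
Local Notation mu := (@lebesgue_measure R).
Local Notation mu2 := (mu \x mu)%E.
Implicit Types (f g : measurableTypeR R * measurableTypeR R -> R) (a b : R).

Definition box a b : set (measurableTypeR R * measurableTypeR R) :=
  `[- a, a] `*` `[- b, b].

Definition ibox a b f : R := \int[mu2]_(p in box a b) f p.

Lemma measurable_box a b : measurable (box a b).
Proof. by apply: measurableX; exact: measurable_itv. Qed.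

Lemma box_measure a b : 0 <= a -> 0 <= b ->
  mu2 (box a b) = (4 * a * b)%:E.
Proof.
move=> a0 b0.
have mI (c : R) : 0 <= c -> mu `[- c, c]%classic = (2 * c)%:E.
  move=> c0; rewrite lebesgue_measure_itv/= lte_fin; case: ltP => [_|c0'].
    by rewrite -EFinB; congr (_%:E); ring.
  have -> : c = 0 by lra.
  by rewrite mulr0.
have -> : mu2 (box a b) = (mu `[(- a)%R, a]%classic * mu `[(- b)%R, b]%classic)%E.
  by apply: product_measure1E; exact: measurable_itv.
by rewrite !mI// -EFinM; congr (_%:E); ring.
Qed.

Definition bounded_measurable f :=
  measurable_fun setT f /\ exists K : R, forall p, `|f p| <= K.

Lemma bm_integrable a b f : 0 <= a -> 0 <= b -> bounded_measurable f ->
  mu2.-integrable (box a b) (EFin \o f).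
Proof.
move=> a0 b0 [mf [K fK]]; apply: measurable_bounded_integrable.
- exact: measurable_box.
- by rewrite [X in (X < _)%E](box_measure a0 b0) ltry.
- exact: measurable_funTS.
- exists K; split; first exact: num_real.
  by move=> M KM p _; exact: le_trans (fK p) (ltW KM).
Qed.

Lemma iboxDZ a b f g c : 0 <= a -> 0 <= b -> bounded_measurable f ->
  bounded_measurable g ->
  ibox a b (fun p => f p + c * g p) = ibox a b f + c * ibox a b g.
Proof.
move=> a0 b0 bf bg; rewrite /ibox RintegralD; first last.
- apply: (@bm_integrable a b (fun p => c * g p)) => //.
  case: bg => mg [K gK]; split; first exact: measurable_funM.
  by exists (`|c| * K) => p; rewrite normrM ler_wpM2l.
- exact: bm_integrable.
- exact: measurable_box.
by rewrite RintegralZl//; [exact: measurable_box|exact: bm_integrable].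
Qed.

Lemma ibox_le a b f K : 0 <= a -> 0 <= b -> bounded_measurable f ->
  (forall p, box a b p -> `|f p| <= K) -> `|ibox a b f| <= K * (4 * a * b).
Proof.
move=> a0 b0 bf fK.
apply: (le_trans (le_normr_Rintegral (measurable_box a b) (bm_integrable a0 b0 bf))).
have -> : K * (4 * a * b) = \int[mu2]_(p in box a b) K.
  rewrite Rintegral_cst; last exact: measurable_box.
  by rewrite [X in fine X](box_measure a0 b0).
apply: le_Rintegral; [exact: measurable_box| | |exact: fK].
- apply: (@bm_integrable a b (fun p => `|f p|)) => //.
  case: bf => mf [M fM]; split; first exact: measurableT_comp.
  by exists M => p; rewrite normr_id.
- apply: (@bm_integrable a b (fun p => K)) => //; split => //.
  by exists `|K| => p.
Qed.

Lemma eq_ibox a b f g : (forall p, box a b p -> f p = g p) -> ibox a b f = ibox a b g.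
Proof. by move=> fg; apply: eq_Rintegral => p; rewrite inE; exact: fg. Qed.

Lemma sin_int_pi (n : int) : sin (n%:~R * pi) = 0 :> R.
Proof.
have H (m : nat) : sin (m%:R * pi) = 0 :> R.
  elim: m => [|m IH]; first by rewrite mul0r sin0.
  by rewrite -natr1 mulrDl mul1r sinDpi IH oppr0.
case: n => n; first exact: H.
by rewrite NegzE mulrNz mulNr sinN H oppr0.
Qed.

(** The interval covers exactly |n| periods, so the antiderivative [F] agrees at its two ends. *)
Lemma integral_cos_period c (n : int) (ta : R) : 0 < ta -> n != 0 ->
  (\int[mu]_(y in `[(- (pi * ta))%R, (pi * ta)%R]) (cos (c + n%:~R * y / ta))%:E = 0)%E.
Proof.
move=> ta0 n0; have n0' : n%:~R != 0 :> R by rewrite intr_eq0.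
pose F (y : R) := (ta / n%:~R) * sin (c + n%:~R * y / ta).
have pta : 0 < pi * ta by rewrite mulr_gt0// pi_gt0.
have dF (y : R) : is_derive y 1 F (cos (c + n%:~R * y / ta)).
  rewrite /F; apply: is_derive_eq.
  by rewrite /GRing.scale/=; field; rewrite n0' gt_eqF.
have cF : continuous F.
  by apply: derivable_continuous => y; exact: (@ex_derive _ _ _ _ _ _ _ (dF y)).
have cf : continuous (fun y : R => cos (c + n%:~R * y / ta)).
  by apply: derivable_continuous => y; apply: ex_derive.
rewrite (@continuous_FTC2 _ _ F).
- rewrite -EFinB; congr (_%:E); rewrite /F -mulrBr.
  have -> : c + n%:~R * (pi * ta) / ta = c + n%:~R * pi.
    by field; rewrite gt_eqF.
  have -> : c + n%:~R * - (pi * ta) / ta = c - n%:~R * pi.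
    by field; rewrite gt_eqF.
  by rewrite sinD sinB sin_int_pi; ring.
- by rewrite -subr_gt0; lra.
- exact: continuous_subspaceT.
- split => [y _| |].
  + exact: (@ex_derive _ _ _ _ _ _ _ (dF y)).
  + exact/cvg_at_right_filter/cF.
  + exact/cvg_at_left_filter/cF.
- by move=> y _; rewrite derive1E; exact: (@derive_val _ _ _ _ _ _ _ (dF y)).
Qed.

(** Fubini with the second variable innermost; [ibox_eq0_outer] is the other order. Which one serves
    depends on which of the two frequencies is nonzero. *)
Lemma ibox_eq0_inner a b f : 0 <= a -> 0 <= b -> bounded_measurable f ->
  (forall x, (\int[mu]_(y in `[(- b)%R, b]) (f (x, y))%:E = 0)%E) ->
  ibox a b f = 0.
Proof.
move=> a0 b0 bf f0; rewrite /ibox /Rintegral integral_mkcond -integral12_prod_meas1.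
  rewrite integral0_eq// => x _; rewrite /fubini_F.
  have [xa|xa] := boolP (x \in `[- a, a]).
    rewrite -(f0 x) [RHS]integral_mkcond; apply: eq_integral => y _.
    rewrite /patch; congr (if _ then _ else _).
    by rewrite in_setX/= !mem_setE xa.
  rewrite integral0_eq// => y _; rewrite /patch ifF//.
  by rewrite in_setX/= !mem_setE (negbTE xa).
rewrite -integrable_mkcond; first exact: bm_integrable.
exact: measurable_box.
Qed.

Lemma ibox_eq0_outer a b f : 0 <= a -> 0 <= b -> bounded_measurable f ->
  (forall y, (\int[mu]_(x in `[(- a)%R, a]) (f (x, y))%:E = 0)%E) ->
  ibox a b f = 0.
Proof.
move=> a0 b0 bf f0; rewrite /ibox /Rintegral integral_mkcond -integral21_prod_meas1.
  rewrite integral0_eq// => y _; rewrite /fubini_G.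
  have [yb|yb] := boolP (y \in `[- b, b]).
    rewrite -(f0 y) [RHS]integral_mkcond; apply: eq_integral => x _.
    rewrite /patch; congr (if _ then _ else _).
    by rewrite in_setX/= !mem_setE yb andbT.
  rewrite integral0_eq// => x _; rewrite /patch ifF//.
  by rewrite in_setX/= !mem_setE (negbTE yb) andbF.
rewrite -integrable_mkcond; first exact: bm_integrable.
exact: measurable_box.
Qed.

Variables (sg ta : R).
Hypotheses (sg0 : 0 < sg) (ta0 : 0 < ta).

Definition wave (u v : R) (p : measurableTypeR R * measurableTypeR R) : R :=
  u * p.1 / sg + v * p.2 / ta.

Lemma measurable_wave u v : measurable_fun setT (wave u v).
Proof.
apply: measurable_funD; apply: measurable_funM => //; apply: measurable_funM => //.
Qed.

Lemma bm_cos (f : measurableTypeR R * measurableTypeR R -> R) :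
  measurable_fun setT f -> bounded_measurable (fun p => cos (f p)).
Proof.
move=> mf; split; last by exists 1 => p; exact: cos_max.
apply: measurableT_comp mf.
by apply: continuous_measurable_fun; exact: continuous_cos.
Qed.

Lemma ibox_cos (m n : int) :
  ibox (pi * sg) (pi * ta) (fun p => cos (wave m%:~R n%:~R p)) =
  if (m == 0) && (n == 0) then 4 * pi ^+ 2 * sg * ta else 0.
Proof.
have ps : 0 <= pi * sg by rewrite mulr_ge0 ?pi_ge0// ltW.
have pt : 0 <= pi * ta by rewrite mulr_ge0 ?pi_ge0// ltW.
have bc := bm_cos (measurable_wave m%:~R n%:~R).
have [n0|n0] := eqVneq n 0; last first.
  rewrite andbF; apply: ibox_eq0_inner => // x.
  exact: (integral_cos_period (m%:~R * x / sg) ta0 n0).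
have [m0|m0] := eqVneq m 0; last first.
  apply: ibox_eq0_outer => // y; rewrite -(integral_cos_period 0 sg0 m0).
  apply: eq_integral => x _; congr (cos _)%:E.
  by rewrite /wave n0/=; ring.
rewrite (@eq_ibox _ _ _ (fun=> 1)); last first.
  by move=> p _; rewrite m0 n0 /wave !mul0r addr0 cos0.
rewrite /ibox Rintegral_cst ?mul1r; last exact: measurable_box.
by rewrite [X in fine X](box_measure ps pt)/=; ring.
Qed.

Variables (al be : R).
Hypotheses (al0 : 0 <= al) (be0 : 0 <= be).
Implicit Types (x : nat * nat) (xs : seq (nat * nat)).

(** Real arguments are allowed because the recursion on the coefficients reaches negative
    exponents. *)
Definition wt (u v : R) : R := expR (- (al * u + be * v)).
Definition wtp x : R := wt x.1%:R x.2%:R.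
Definition phase x := wave x.1%:R x.2%:R.
(* The logarithm of the modulus, and the argument, of the product over [xs] of the
   [(1 - wtp x e^{i phase x p})^-1]. *)
Definition LM xs p : R := \sum_(x <- xs) lmod (wtp x) (phase x p).
Definition AR xs p : R := \sum_(x <- xs) arg (wtp x) (phase x p).

Hypothesis wt_lt1 : forall x, Zsq_nz x -> wtp x < 1.

Lemma wt_gt0 u v : 0 < wt u v.
Proof. exact: expR_gt0. Qed.

Lemma wtp01 x : Zsq_nz x -> 0 <= wtp x < 1.
Proof. by move=> /wt_lt1 ->; rewrite ltW// wt_gt0. Qed.

Lemma wtB u v u' v' : wt (u - u') (v - v') * wt u' v' = wt u v.
Proof. by rewrite /wt -expRD; congr expR; ring. Qed.

Lemma measurable_dist2 x : measurable_fun setT (fun p => dist2 (wtp x) (phase x p)).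
Proof.
have mw := measurable_wave x.1%:R x.2%:R.
have mc : measurable_fun setT (fun p => cos (phase x p)).
  apply: measurableT_comp mw.
  by apply: continuous_measurable_fun; exact: continuous_cos.
have ms : measurable_fun setT (fun p => sin (phase x p)).
  apply: measurableT_comp mw.
  by apply: continuous_measurable_fun; exact: continuous_sin.
apply: measurable_funD; apply: measurable_funX; last exact: measurable_funM.
by apply: measurable_funB => //; exact: measurable_funM.
Qed.

Lemma measurable_lmod x : measurable_fun setT (fun p => lmod (wtp x) (phase x p)).
Proof.
apply: measurable_funM => //; apply: measurableT_comp => //.
by apply: measurableT_comp (measurable_dist2 x); exact: measurable_ln.
Qed.

Lemma measurable_arg x : Zsq_nz x ->
  measurable_fun setT (fun p => arg (wtp x) (phase x p)).
Proof.
move=> x0; have mw := measurable_wave x.1%:R x.2%:R.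
have c0 p : 1 - wtp x * cos (phase x p) != 0.
  by rewrite gt_eqF// subr_cos_gt0// wtp01.
have -> : (fun p => arg (wtp x) (phase x p)) =
  (fun t => arg (wtp x) t) \o phase x by [].
apply: measurableT_comp mw; apply: continuous_measurable_fun.
apply: derivable_continuous => t; rewrite /arg.
have h : 1 - wtp x * cos t != 0 by rewrite gt_eqF// subr_cos_gt0// wtp01.
by apply: ex_derive.
Qed.

Lemma measurable_LM xs : measurable_fun setT (LM xs).
Proof. by apply: measurable_sum => x; exact: measurable_lmod. Qed.

Lemma measurable_AR xs : (forall x, x \in xs -> Zsq_nz x) ->
  measurable_fun setT (AR xs).
Proof.
elim: xs => [|x xs IH] H.
  rewrite (_ : AR _ = fun=> 0)//; apply/funext => p; exact: big_nil.
have -> : AR (x :: xs) = fun p => arg (wtp x) (phase x p) + AR xs p.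
  by apply/funext => p; rewrite /AR big_cons.
apply: measurable_funD; first exact: measurable_arg (H _ (mem_head _ _)).
by apply: IH => y yxs; apply: H; rewrite in_cons yxs orbT.
Qed.

(** Each factor has its largest modulus at phase 0, where it equals 1 / (1 - rho). *)
Lemma LM_ub xs : (forall x, x \in xs -> Zsq_nz x) ->
  exists K, forall p, LM xs p <= K.
Proof.
elim: xs => [|x xs IH] H; first by exists 0 => p; rewrite /LM big_nil.
have [|K HK] := IH; first by move=> y yxs; apply: H; rewrite in_cons yxs orbT.
have x01 := wtp01 (H x (mem_head _ _)).
have x1 : 0 < 1 - wtp x by case/andP: x01; rewrite subr_gt0.
exists (- ln ((1 - wtp x) ^+ 2) / 2 + K) => p; rewrite /LM big_cons.
have d0 := dist2_gt0 (phase x p) x01.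
have c0 := subr_cos_gt0 (phase x p) x01.
apply: lerD; last exact: HK.
rewrite /lmod !mulNr lerN2 ler_pM2r ?invr_gt0// ler_ln ?posrE ?exprn_gt0//.
rewrite /dist2 -[leLHS]addr0 lerD ?sqr_ge0//.
rewrite lerXn2r ?nnegrE ?(ltW x1) ?(ltW c0)//.
by rewrite lerB// ler_piMr ?cos_le1//; case/andP: x01.
Qed.

(** Real part of the product over [xs] times e^{- i wave m n p}; its integral over the period box
    isolates the coefficient of index (m, n). *)
Definition gen xs (m n : R) p : R := expR (LM xs p) * cos (AR xs p - wave m n p).

Lemma bm_gen xs m n : (forall x, x \in xs -> Zsq_nz x) ->
  bounded_measurable (gen xs m n).
Proof.
move=> H; have mA := measurable_AR H; have [K HK] := LM_ub H.
have [mc _] : bounded_measurable (fun p => cos (AR xs p - wave m n p)).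
  by apply: bm_cos; apply: measurable_funB => //; exact: measurable_wave.
split.
  apply: measurable_funM mc; apply: measurableT_comp (measurable_LM xs).
  exact: measurable_expR.
exists (expR K) => p; rewrite normrM ger0_norm ?expR_ge0//.
by rewrite -[leRHS]mulr1 ler_pM// ?cos_max// ler_expR.
Qed.

Lemma gen_cons x xs m n p : (forall y, y \in x :: xs -> Zsq_nz y) ->
  gen (x :: xs) m n p = gen xs m n p + wtp x *
    gen (x :: xs) (m - x.1%:R) (n - x.2%:R) p.
Proof.
move=> H; have x01 := wtp01 (H x (mem_head _ _)).
rewrite /gen /LM /AR !big_cons -/(LM xs p) -/(AR xs p) expRD.
rewrite mulrAC -(addrA (arg _ _)) geometric_factorE// mulrDl mulrC; congr (_ + _).
rewrite -!mulrA; congr (_ * (_ * _)); rewrite mulrC; congr (_ * cos _).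
by rewrite /phase /wave; ring.
Qed.

(** Extension by zero to negative integers, under which the recursion of [npartU1] loses its
    guard. *)
Definition npartZ (X : set (nat * nat)) (m n : int) : nat :=
  if (0 <= m) && (0 <= n) then npart X (`|m|, `|n|)%N else 0%N.

Lemma npartZ_U1 (X : set (nat * nat)) (x : nat * nat) m n :
  x |` X `<=` Zsq_nz -> ~ X x ->
  npartZ (x |` X) m n = (npartZ X m n + npartZ (x |` X) (m - x.1%:Z) (n - x.2%:Z))%N.
Proof.
move=> xX nXx; rewrite /npartZ; case: (boolP (_ && _)) => [/andP[m0 n0]|mn0].
  rewrite npartU1//=; congr (_ + _)%N; rewrite !subr_ge0.
  case: m m0 => // m _; case: n n0 => // n _; rewrite !lez_nat !absz_nat.
  case: ifP => // /andP[xm xn].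
  by rewrite !distnEl.
rewrite ifF//; apply/negbTE; apply: contra mn0 => /andP[h1 h2].
apply/andP; split; lia.
Qed.

Lemma le_geometric_eq0 (h K rho : R) (N : nat) : 0 <= rho < 1 ->
  (forall j, (N <= j)%N -> `|h| <= rho ^+ j * K) -> h = 0.
Proof.
move=> /andP[r0 r1] H; apply/normr0_eq0/eqP; rewrite eq_le normr_ge0 andbT.
have c : rho ^+ j * K @[j --> \oo] --> 0 * K.
  by apply: cvgMl; apply: cvg_expr; rewrite ger0_norm.
rewrite mul0r in c; rewrite -(cvg_lim _ c)//.
apply: limr_ge; first by apply/cvg_ex; exists 0.
by exists N => // j /= /H.
Qed.

(** Induction on the parts. Adding [x] gives both sides the same recursion in (m, n), so their
    difference [h] satisfies h(u, v) = wtp x * h(u - x.1, v - x.2). Far enough along this shift the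
    count is 0 and only the bounded integral is left, while the accumulated power of [wtp x] tends
    to 0; hence [h] vanishes and no series has to be integrated term by term. *)
Lemma coefficient_integral xs (m n : int) : uniq xs ->
  (forall x, x \in xs -> Zsq_nz x) ->
  ibox (pi * sg) (pi * ta) (gen xs m%:~R n%:~R) =
  4 * pi ^+ 2 * sg * ta * ((npartZ [set` xs] m n)%:R * wt m%:~R n%:~R).
Proof.
have ps : 0 <= pi * sg by rewrite mulr_ge0 ?pi_ge0// ltW.
have pt : 0 <= pi * ta by rewrite mulr_ge0 ?pi_ge0// ltW.
elim: xs m n => [|x xs IH] m n /=.
  move=> _ _; rewrite (@eq_ibox _ _ _ (fun p => cos (wave m%:~R n%:~R p))); last first.
    by move=> p _; rewrite /gen /LM /AR !big_nil expR0 mul1r sub0r cosN.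
  rewrite ibox_cos /npartZ (_ : [set` [::]] = set0); last first.
    by apply/seteqP; split => y.
  rewrite npart0; case: m n => [[|m]|m] [[|n]|n]; rewrite /= ?mul0r ?mulr0//.
  by rewrite /wt !mulr0 addr0 oppr0 expR0 !mulr1.
move=> /andP[xxs uxs] H.
have H' y : y \in xs -> Zsq_nz y by move=> yxs; apply: H; rewrite in_cons yxs orbT.
have x0 := H x (mem_head _ _).
have XE : [set` x :: xs] = x |` [set` xs].
  apply/seteqP; split => y /=; rewrite in_cons => /predU1P//.
have XZ : x |` [set` xs] `<=` Zsq_nz by rewrite -XE => y /H.
have nXx : ~ [set` xs] x by move=> /=; apply/negP.
set D := 4 * pi ^+ 2 * sg * ta.
pose f (u v : int) := ibox (pi * sg) (pi * ta) (gen (x :: xs) u%:~R v%:~R).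
pose h u v := f u v - D * ((npartZ [set` x :: xs] u v)%:R * wt u%:~R v%:~R).
(* The source term of both recursions is the case [xs] at the same index, so the induction
   hypothesis cancels it. *)
have hS u v : h u v = wtp x * h (u - x.1%:Z) (v - x.2%:Z).
  have fE : f u v = D * ((npartZ [set` xs] u v)%:R * wt u%:~R v%:~R) +
      wtp x * f (u - x.1%:Z) (v - x.2%:Z).
    rewrite /f -(IH u v uxs H') -iboxDZ//; [|exact: bm_gen..].
    by apply: eq_ibox => p _; rewrite gen_cons// !intrB.
  rewrite /h fE XE npartZ_U1// natrD.
  have -> : wt u%:~R v%:~R = wt (u - x.1%:Z)%:~R (v - x.2%:Z)%:~R * wtp x.
    by rewrite /wtp !intrB wtB.
  by ring.
have hj (j : nat) u v : h u v = wtp x ^+ j * h (u - (j * x.1)%:Z) (v - (j * x.2)%:Z).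
  elim: j => [|j IHj]; first by rewrite expr0 mul1r !mul0n !subr0.
  rewrite IHj hS exprSr -mulrA.
  by rewrite -!addrA -!opprD -!PoszD !mulSn ![(j * _ + _)%N]addnC.
have [K' HK'] := LM_ub H.
have fb u v : `|f u v| <= expR K' * (4 * (pi * sg) * (pi * ta)).
  apply: ibox_le => //; first exact: bm_gen.
  move=> p _; rewrite /gen normrM ger0_norm ?expR_ge0//.
  by rewrite -[leRHS]mulr1 ler_pM// ?cos_max// ler_expR.
suff : h m n = 0 by move/eqP; rewrite subr_eq0 => /eqP.
(* Since [x] is nonzero, after more than |m| + |n| shifts at least one of the two indices is
   negative and [npartZ] is 0. *)
apply: (@le_geometric_eq0 _ (expR K' * (4 * (pi * sg) * (pi * ta))) (wtp x)
  (`|m| + `|n|).+1); first exact: wtp01.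
move=> j jmn; rewrite (hj j) normrM ger0_norm; last first.
  by rewrite exprn_ge0// ltW// wt_gt0.
apply: ler_wpM2l; first by rewrite exprn_ge0// ltW// wt_gt0.
rewrite /h /npartZ ifF ?mul0r ?mulr0 ?subr0; first exact: fb.
apply/negbTE/negP => /andP[h1 h2]; move: x0; rewrite /Zsq_nz/=.
case: (x) h1 h2 => a b /= h1 h2.
have ja : (0 < a -> j <= j * a)%N by exact: leq_pmulr.
have jb : (0 < b -> j <= j * b)%N by exact: leq_pmulr.
move: ja jb h1 h2; move: (j * a)%N (j * b)%N => A B.
case: a b => [|a] [|b] ja jb h1 h2 //= _.
- by have := jb isT; lia.
- by have := ja isT; lia.
- by have := ja isT; lia.
Qed.

End BoxIntegral.

(** * A local limit theorem for oscillating integrals *)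

Section Gaussian.
Variable R : realType.
Local Notation mu := (@lebesgue_measure R).
Local Notation mu2 := (mu \x mu)%E.

Lemma integral_gaussian1 (A m : R) : 0 < A ->
  (\int[mu]_x (expR (- (A * (x - m) ^+ 2 / 2)))%:E = (Num.sqrt (2 * pi / A))%:E)%E.
Proof.
move=> A0; pose s := Num.sqrt A^-1.
have s0 : s != 0 by rewrite gt_eqF// sqrtr_gt0 invr_gt0.
have s2 : s ^+ 2 = A^-1 by rewrite sqr_sqrtr// invr_ge0 ltW.
have p0 := normal_peak_gt0 s0.
transitivity (\int[mu]_x ((normal_peak s)^-1%:E * (normal_pdf m s x)%:E))%E.
  apply: eq_integral => x _; rewrite -EFinM normal_pdfE// mulKf ?gt_eqF//.
  rewrite /normal_fun s2; congr (expR _)%:E; rewrite -mulr_natr.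
  by field; rewrite gt_eqF.
rewrite integralZl//; last exact: integrable_normal_pdf.
rewrite integral_normal_pdf mule1 /normal_peak invrK s2; congr (Num.sqrt _)%:E.
by rewrite -mulr_natr; ring.
Qed.

Definition quad (A B C : R) (p : measurableTypeR R * measurableTypeR R) : R :=
  A * p.1 ^+ 2 + 2 * B * p.1 * p.2 + C * p.2 ^+ 2.

Lemma measurable_quad A B C : measurable_fun setT (quad A B C).
Proof.
apply: measurable_funD; last first.
  by apply: measurable_funM => //; apply: measurable_funX.
apply: measurable_funD; first by apply: measurable_funM => //; apply: measurable_funX.
by apply: measurable_funM => //; apply: measurable_funM.
Qed.

(** Completing the square in the first variable leaves a one-dimensional Gaussian with coefficient C
    - B^2 / A in the second. *)
Lemma integral_gaussian2 (A B C : R) : 0 < A -> 0 < A * C - B ^+ 2 ->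
  (\int[mu2]_p (expR (- (quad A B C p / 2)))%:E =
   (2 * pi / Num.sqrt (A * C - B ^+ 2))%:E)%E.
Proof.
move=> A0 D0.
have mE : measurable_fun setT (fun p => (expR (- (quad A B C p / 2)))%:E).
  apply/measurable_EFinP; apply: measurableT_comp; first exact: measurable_expR.
  by apply: measurableT_comp => //; apply: measurable_funM => //; exact: measurable_quad.
rewrite fubini_tonelli2//.
rewrite (eq_integral (fun y : measurableTypeR R => ((Num.sqrt (2 * pi / A))%:E *
     (expR (- ((C - B ^+ 2 / A) * (y - 0) ^+ 2 / 2)))%:E)%E)); last first.
  move=> y _; rewrite /fubini_G -(integral_gaussian1 (- (B * y / A)) A0).
  rewrite -ge0_integralZr//; last first.
    apply/measurable_EFinP; apply: measurableT_comp; first exact: measurable_expR.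
    apply: measurableT_comp => //; apply: measurable_funM => //.
    by apply: measurable_funM => //; apply: measurable_funX; apply: measurable_funB.
  apply: eq_integral => x _; rewrite -EFinM -expRD; congr (expR _)%:E.
  by rewrite /quad/=; field; rewrite gt_eqF.
have E : C - B ^+ 2 / A = (A * C - B ^+ 2) / A by field; rewrite gt_eqF.
have E0 : 0 < C - B ^+ 2 / A by rewrite E divr_gt0.
rewrite ge0_integralZl//; last first.
  apply/measurable_EFinP; apply: measurableT_comp; first exact: measurable_expR.
  apply: measurableT_comp => //; apply: measurable_funM => //.
  by apply: measurable_funM => //; apply: measurable_funX; apply: measurable_funB.
rewrite integral_gaussian1// -EFinM; congr (_%:E).
have p2 : 0 <= 2 * pi :> R by rewrite mulr_ge0 ?pi_ge0.
rewrite -sqrtrM; last by rewrite divr_ge0 ?(ltW A0).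
have -> : 2 * pi / A * (2 * pi / (C - B ^+ 2 / A)) =
   (2 * pi) ^+ 2 * (A * C - B ^+ 2)^-1.
  by field; rewrite !gt_eqF// mulrC.
by rewrite sqrtrM ?sqr_ge0// sqrtr_sqr ger0_norm// sqrtrV// ltW.
Qed.

Lemma integrable_gaussian2 (A B C : R) : 0 < A -> 0 < A * C - B ^+ 2 ->
  mu2.-integrable setT (fun p => (expR (- (quad A B C p / 2)))%:E).
Proof.
move=> A0 D0; apply/integrableP; split.
  apply/measurable_EFinP; apply: measurableT_comp; first exact: measurable_expR.
  by apply: measurableT_comp => //; apply: measurable_funM => //; exact: measurable_quad.
rewrite (eq_integral (fun p => (expR (- (quad A B C p / 2)))%:E)); last first.
  by move=> p _; rewrite gee0_abs// lee_fin expR_ge0.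
by rewrite integral_gaussian2// ltry.
Qed.

End Gaussian.

(** * Dominated convergence towards a Gaussian that varies with the index *)

Section LocalLimit.
Variable R : realType.
Local Notation mu := (@lebesgue_measure R).
Local Notation mu2 := (mu \x mu)%E.
Local Notation T := (measurableTypeR R * measurableTypeR R)%type.

Lemma quad_cc (c : R) (p : T) : quad c 0 c p = c * (p.1 ^+ 2 + p.2 ^+ 2).
Proof. by rewrite /quad; ring. Qed.

(** Test points (1, 0) and (- B, A); at the latter the form equals A (A C - B^2). *)
Lemma quad_form_gt0 (A B C c : R) : 0 < c ->
  (forall p, quad c 0 c p <= quad A B C p) -> 0 < A /\ 0 < A * C - B ^+ 2.
Proof.
move=> c0 H; have A0 : 0 < A.
  by apply: lt_le_trans c0 _; have := H (1, 0); rewrite /quad/=; lra.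
split=> //; have := H (- B, A); rewrite /quad/= => h.
have h' : c * (A ^+ 2) <= A * (A * C - B ^+ 2).
  have : 0 <= c * B ^+ 2 by rewrite mulr_ge0 ?sqr_ge0// ltW.
  by move: h; lra.
rewrite -(pmulr_rgt0 _ A0); apply: lt_le_trans h'.
by rewrite mulr_gt0// exprn_gt0.
Qed.

Variables (a b L A B C : nat -> R) (E Ph : nat -> T -> R) (c : R).
Hypotheses (c0 : 0 < c) (a0 : forall k, 0 <= a k) (b0 : forall k, 0 <= b k)
  (L0 : forall k, 0 <= L k).
Hypotheses (a_oo : a @ \oo --> +oo) (b_oo : b @ \oo --> +oo).
Hypotheses (mE : forall k, measurable_fun setT (E k))
  (mPh : forall k, measurable_fun setT (Ph k)).
Hypothesis E_lb : forall k p, box (a k) (b k) p ->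
  c * Num.min (L k) (p.1 ^+ 2 + p.2 ^+ 2) <= E k p.
Hypothesis quad_lb : forall k p, quad c 0 c p <= quad (A k) (B k) (C k) p.
Hypothesis E_cvg : forall p, E k p - quad (A k) (B k) (C k) p / 2 @[k --> \oo] --> 0.
Hypothesis Ph_cvg : forall p, Ph k p @[k --> \oo] --> 0.
Hypothesis tail : expR (- (c * L k)) * (4 * a k * b k) @[k --> \oo] --> 0.

Let F k p := expR (- E k p) * cos (Ph k p).
Let f k : T -> R := (F k) \_ (box (a k) (b k)).
Let g k p := expR (- (quad (A k) (B k) (C k) p / 2)).
Let G p := 2 * expR (- (quad c 0 c p / 2)).
(** [f k] has no fixed integrable majorant: [E_lb] only gives exp (- c L) far out in a growing box.
    Cutting the difference with the Gaussian at [G] makes dominated convergence available, and what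
    is cut off is paid for by [tail]. *)
Let h k p : R := Num.min `|f k p - g k p| (G p).

Let mF k : measurable_fun setT (F k).
Proof.
apply: measurable_funM.
  by apply: measurableT_comp; [exact: measurable_expR|exact: measurableT_comp].
apply: measurableT_comp => //.
by apply: continuous_measurable_fun; exact: continuous_cos.
Qed.

Let mf k : measurable_fun setT (f k).
Proof.
apply/(measurable_restrictT _ (measurable_box _ _)); exact: measurable_funTS.
Qed.

Let mg (A' B' C' : R) : measurable_fun setT (fun p : T => expR (- (quad A' B' C' p / 2))).
Proof.
apply: measurableT_comp; first exact: measurable_expR.
by apply: measurableT_comp => //; apply: measurable_funM => //; exact: measurable_quad.
Qed.

Let mfg k : measurable_fun setT (fun p => `|f k p - g k p|).
Proof. by apply: measurableT_comp => //; apply: measurable_funB => //; exact: mg. Qed.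

Let mG : measurable_fun setT G.
Proof. by apply: measurable_funM => //; exact: mg. Qed.

Let mh k : measurable_fun setT (h k).
Proof. exact: measurable_minr. Qed.

Let F_le k p : box (a k) (b k) p ->
  `|F k p| <= expR (- (c * Num.min (L k) (p.1 ^+ 2 + p.2 ^+ 2))).
Proof.
move=> kp; rewrite normrM ger0_norm ?expR_ge0// -[leRHS]mulr1 ler_pM ?expR_ge0//.
  by rewrite ler_expR lerN2 E_lb.
exact: cos_max.
Qed.

Let min_ge0 k (p : T) : 0 <= c * Num.min (L k) (p.1 ^+ 2 + p.2 ^+ 2).
Proof. by rewrite mulr_ge0 ?(ltW c0)// le_min L0/= addr_ge0 ?sqr_ge0. Qed.

(** Where the minimum in [E_lb] is the quadratic term, [f] and [g] are each at most half of [G];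
    elsewhere on the box [f] is at most exp (- c L), whence the indicator term. *)
Let fg_le k p : `|f k p - g k p| <=
  h k p + expR (- (c * L k)) * \1_(box (a k) (b k)) p.
Proof.
have gG : g k p <= expR (- (quad c 0 c p / 2)).
  by rewrite ler_expR lerN2 ler_pM2r ?invr_gt0//; exact: quad_lb.
have e1 : expR (- (c * (p.1 ^+ 2 + p.2 ^+ 2))) <= expR (- (quad c 0 c p / 2)).
  rewrite ler_expR lerN2 quad_cc ler_piMr//; last lra.
  by rewrite mulr_ge0 ?(ltW c0)// addr_ge0 ?sqr_ge0.
have t0 : 0 <= expR (- (c * L k)) * \1_(box (a k) (b k)) p.
  by rewrite mulr_ge0 ?expR_ge0.
rewrite /h minEle; case: ifP => [_|/negbT]; first by rewrite lerDl.
rewrite -ltNge => _.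
apply: le_trans (ler_normB _ _) _; rewrite (ger0_norm (expR_ge0 _)).
suff : `|f k p| <= expR (- (quad c 0 c p / 2)) +
    expR (- (c * L k)) * \1_(box (a k) (b k)) p.
  by move=> h1; apply: le_trans (lerD h1 gG) _; rewrite /G addrAC mulr_natl mulr2n.
rewrite /f /patch; case: ifP => [kp|kp]; last first.
  by rewrite normr0 addr_ge0 ?expR_ge0.
rewrite indicE kp mulr1.
have := F_le (set_mem kp); rewrite minEle; case: ifP => [_|_] FF.
  by apply: le_trans FF _; rewrite lerDr expR_ge0.
by apply: le_trans FF (le_trans e1 _); rewrite lerDl expR_ge0.
Qed.

Let near_box (p : T) : \forall k \near \oo, p \in box (a k) (b k).
Proof.
have /cvgryPge/(_ `|p.1|) := a_oo; have /cvgryPge/(_ `|p.2|) := b_oo.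
apply: filterS2 => k h2 h1; rewrite inE.
by split => /=; rewrite in_itv/= -ler_norml.
Qed.

Let fg_cvg p : `|f k p - g k p| @[k --> \oo] --> 0.
Proof.
pose u k := quad (A k) (B k) (C k) p / 2.
have c1 : expR (- (E k p - u k)) * cos (Ph k p) - 1 @[k --> \oo] --> 0.
  have -> : 0 = expR (- 0) * cos 0 - 1 :> R by rewrite oppr0 expR0 cos0 mulr1 subrr.
  apply: cvgB; last exact: cvg_cst.
  apply: cvgM.
    by apply: continuous_cvg; [exact: continuous_expR|apply: cvgN; exact: E_cvg].
  by apply: continuous_cvg; [exact: continuous_cos|exact: Ph_cvg].
have c2 : `|expR (- (E k p - u k)) * cos (Ph k p) - 1| @[k --> \oo] --> 0.
  by rewrite -(normr0 R); apply: cvg_norm.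
apply: (@squeeze_cvgr _ _ _ _ (fun=> 0) _ _ _ _ _ c2); last exact: cvg_cst.
near=> k; rewrite normr_ge0/=.
have kp : p \in box (a k) (b k) by near: k; exact: near_box.
rewrite /f /patch kp /F /g -/(u k).
have -> : expR (- E k p) = expR (- u k) * expR (- (E k p - u k)).
  by rewrite -expRD; congr expR; ring.
rewrite -mulrA -{2}(mulr1 (expR (- u k))) -mulrBr normrM ger0_norm ?expR_ge0//.
rewrite ler_piMl// -expR0 ler_expR oppr_le0 divr_ge0//.
apply: le_trans (quad_lb k p); rewrite quad_cc mulr_ge0 ?(ltW c0)//.
by rewrite addr_ge0 ?sqr_ge0.
Unshelve. all: by end_near. Qed.

Let G_int : mu2.-integrable setT (EFin \o G).
Proof.
have : mu2.-integrable setT (fun p => (expR (- (quad c 0 c p / 2)))%:E).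
  by apply: integrable_gaussian2; rewrite ?expr0n ?subr0 ?mulr_gt0.
by move=> /(integrableZl measurableT 2).
Qed.

Let G_ge0 p : 0 <= G p.
Proof. by rewrite mulr_ge0 ?expR_ge0. Qed.

Let h_ge0 k p : 0 <= h k p.
Proof. by rewrite le_min normr_ge0 G_ge0. Qed.

Let h_int k : mu2.-integrable setT (EFin \o h k).
Proof.
apply: le_integrable G_int => //; first exact/measurable_EFinP.
by move=> p _; rewrite lee_fin !ger0_norm// ge_min lexx orbT.
Qed.

Let h_cvg : \int[mu2]_p h k p @[k --> \oo] --> 0.
Proof.
have ptw p : (h k p)%:E @[k --> \oo] --> (0 : \bar R).
  apply/fine_cvgP; split; first exact: nearW.
  apply: (@cvg0_le _ _ (fun k => `|f k p - g k p|)); last exact: fg_cvg.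
  by move=> k /=; rewrite ger0_norm ?h_ge0// ge_min lexx.
have m1 k : measurable_fun setT (fun p => (h k p)%:E).
  by apply/measurable_EFinP; exact: mh.
have c1 : {ae mu2, forall p, [set: T] p -> (h k p)%:E @[k --> \oo] --> (cst 0 p : \bar R)}.
  by apply: aeW => p _; exact: ptw.
have d1 : {ae mu2, forall p k, [set: T] p -> (`|(h k p)%:E| <= (EFin \o G) p)%E}.
  by apply: aeW => p k _; rewrite lee_fin ger0_norm// ge_min lexx orbT.
have [_ _] := dominated_convergence measurableT m1 (measurable_cst _) c1 G_int d1.
rewrite integral0 => /fine_cvgP[_].
exact.
Qed.

(** The difference with the Gaussian integral of the same index is split by [fg_le]: dominated
    convergence disposes of [h], and the indicator integrates to the area of the box times exp (- c
    L), which is [tail]. *)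
Lemma local_limit_integral :
  ibox (a k) (b k) (fun p => expR (- E k p) * cos (Ph k p)) -
    2 * pi / Num.sqrt (A k * C k - B k ^+ 2) @[k --> \oo] --> 0.
Proof.
have f_int k : mu2.-integrable setT (EFin \o f k).
  have : mu2.-integrable (box (a k) (b k)) (EFin \o F k).
    apply: measurable_bounded_integrable; first exact: measurable_box.
    - by rewrite [X in (X < _)%E](box_measure (a0 k) (b0 k)) ltry.
    - exact: measurable_funTS.
    exists 1; split; first exact: num_real.
    move=> M M1 p kp; apply: le_trans (F_le kp) (le_trans _ (ltW M1)).
    by rewrite -expR0 ler_expR oppr_le0; exact: min_ge0.
  rewrite integrable_mkcond; last exact: measurable_box.
  by rewrite -restrict_EFin.
have pos k : 0 < A k /\ 0 < A k * C k - B k ^+ 2.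
  exact: quad_form_gt0 c0 (quad_lb k).
have g_int k : mu2.-integrable setT (EFin \o g k).
  by have [] := pos k; exact: integrable_gaussian2.
have one_int k : mu2.-integrable setT (EFin \o (\1_(box (a k) (b k)) : T -> R)).
  have : mu2.-integrable (box (a k) (b k)) (EFin \o (fun=> 1 : R)).
    apply: measurable_bounded_integrable; first exact: measurable_box.
    - by rewrite [X in (X < _)%E](box_measure (a0 k) (b0 k)) ltry.
    - exact: measurable_cst.
    by exists 1; split; [exact: num_real|move=> M M1 p kp; rewrite normr1 ltW].
  rewrite integrable_mkcond; last exact: measurable_box.
  by congr (mu2.-integrable _ _); apply/funext => p; rewrite /patch/= indicE; case: ifP.
have ind_int k : mu2.-integrable setT
    (EFin \o (fun p => expR (- (c * L k)) * \1_(box (a k) (b k)) p)).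
  by move: (one_int k) => /(integrableZl measurableT (expR (- (c * L k)))).
have fg_int k : mu2.-integrable setT (EFin \o (fun p => f k p - g k p)).
  by have := integrableB measurableT (f_int k) (g_int k).
have H k : `|ibox (a k) (b k) (F k) - 2 * pi / Num.sqrt (A k * C k - B k ^+ 2)| <=
    \int[mu2]_p h k p + expR (- (c * L k)) * (4 * a k * b k).
  have -> : 2 * pi / Num.sqrt (A k * C k - B k ^+ 2) = \int[mu2]_p g k p.
    by have [Apos detpos] := pos k; rewrite /Rintegral integral_gaussian2.
  rewrite /ibox Rintegral_mkcond -/(f k) -(RintegralB measurableT (f_int k) (g_int k)).
  apply: le_trans (le_normr_Rintegral measurableT (fg_int k)) _.
  have -> : expR (- (c * L k)) * (4 * a k * b k) =
     \int[mu2]_p (expR (- (c * L k)) * \1_(box (a k) (b k)) p).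
    rewrite RintegralZl//.
    congr (_ * _); rewrite /Rintegral integral_indic//; last exact: measurable_box.
    by rewrite setIT [X in fine X](box_measure (a0 k) (b0 k)).
  rewrite -RintegralD//; apply: le_Rintegral => //.
  - exact: integrable_norm (fg_int k).
  - by have := integrableD measurableT (h_int k) (ind_int k).
apply: (cvg0_le H); rewrite -[X in _ --> X](addr0 0).
by apply: cvgD; [exact: h_cvg|exact: tail].
Qed.

End LocalLimit.

(** * Series *)

Section Series.
Variable R : realType.
Implicit Types (u v g l : nat -> R) (s t c x : R).

Definition sums u s := series u @ \oo --> s.

Lemma sumsP u s : sums u s -> limn (series u) = s.
Proof. by move=> us; apply: cvg_lim. Qed.

Lemma sums_unique u s t : sums u s -> sums u t -> s = t.
Proof. by move=> /sumsP <- /sumsP. Qed.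

Lemma eq_sums u v s : u =1 v -> sums u s -> sums v s.
Proof. by move=> /funext ->. Qed.

Lemma sums_cvg u : cvgn (series u) -> sums u (limn (series u)).
Proof. by []. Qed.

Lemma seriesE u n : series u n = \sum_(0 <= i < n) u i.
Proof. by []. Qed.

Lemma sumsD u v s t : sums u s -> sums v t -> sums (fun i => u i + v i) (s + t).
Proof.
move=> us vt; rewrite /sums (_ : series _ = fun n => series u n + series v n).
  exact: cvgD.
by apply/funext => n; rewrite !seriesE big_split.
Qed.

Lemma sumsZ c u s : sums u s -> sums (fun i => c * u i) (c * s).
Proof.
move=> us; rewrite /sums (_ : series _ = fun n => c * series u n).
  exact: cvgMr.
by apply/funext => n; rewrite !seriesE mulr_sumr.
Qed.

Arguments sumsZ c {u s} _.

Lemma sumsB u v s t : sums u s -> sums v t -> sums (fun i => u i - v i) (s - t).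
Proof.
move=> us vt; have := sumsD us (sumsZ (-1) vt); rewrite mulN1r.
by apply: eq_sums => i; rewrite mulN1r.
Qed.

Lemma sums_sum (I : Type) (r : seq I) (u : I -> nat -> R) (s : I -> R) :
  (forall i, sums (u i) (s i)) ->
  sums (fun n => \sum_(i <- r) u i n) (\sum_(i <- r) s i).
Proof.
move=> us; elim: r => [|i r IH].
  rewrite big_nil; apply: (@eq_sums (fun=> 0)) => [n|]; first by rewrite big_nil.
  rewrite /sums (_ : series _ = fun=> 0); first exact: cvg_cst.
  by apply/funext => n; rewrite seriesE big1.
rewrite big_cons; have := sumsD (us i) IH.
by apply: eq_sums => n; rewrite big_cons.
Qed.

Lemma le_sums u v s t : sums u s -> sums v t -> (forall i, u i <= v i) -> s <= t.
Proof.
move=> us vt uv; apply: (ler_cvg_to us vt); apply: nearW => n.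
by rewrite !seriesE; apply: ler_sum.
Qed.

Lemma sums_cst0 : sums (fun=> 0) 0.
Proof.
rewrite /sums (_ : series _ = fun=> 0); first exact: cvg_cst.
by apply/funext => n; rewrite seriesE big1.
Qed.

Lemma sums_ge0 u s : sums u s -> (forall i, 0 <= u i) -> 0 <= s.
Proof. by move=> us; apply: le_sums sums_cst0 us. Qed.

Lemma le_partial_sums u s n : sums u s -> (forall i, 0 <= u i) ->
  \sum_(0 <= i < n) u i <= s.
Proof.
move=> us u0; rewrite -seriesE -(sumsP us); apply: nondecreasing_cvgn_le.
  by apply/nondecreasing_seqP => m; rewrite !seriesE big_nat_recr//= lerDl.
by apply/cvg_ex; exists s.
Qed.

Lemma sums_bounded u (K : R) : (forall i, 0 <= u i) ->
  (forall n, \sum_(0 <= i < n) u i <= K) -> exists2 s, sums u s & s <= K.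
Proof.
move=> u0 uK; have cu : cvgn (series u).
  apply: nondecreasing_is_cvgn.
    by apply/nondecreasing_seqP => m; rewrite !seriesE big_nat_recr//= lerDl.
  by exists K => _ [n _ <-]; exact: uK.
exists (limn (series u)); first exact: sums_cvg.
by apply: limr_le => //; apply: nearW => n; exact: uK.
Qed.

Lemma sums_dominated u g t : (forall i, `|u i| <= g i) -> sums g t ->
  exists2 s, sums u s & `|s| <= t.
Proof.
move=> ug gt.
have g0 i : 0 <= g i by exact: le_trans (ug i).
have [n0 sn _] : exists2 s, sums (fun i => `|u i|) s & s <= t.
  apply: sums_bounded => // n; apply: le_trans (le_partial_sums n gt g0).
  exact: ler_sum.
have cu : cvgn (series u).
  by apply: (@normed_cvg _ R^o); apply/cvg_ex; exists n0.
exists (limn (series u)); first exact: sums_cvg.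
rewrite ler_norml; apply/andP; split.
  rewrite -mulN1r; apply: (le_sums (sumsZ (-1) gt) cu) => i.
  by rewrite mulN1r lerNl (le_trans _ (ug i))// -normrN ler_norm.
by apply: (le_sums cu gt) => i; rewrite (le_trans (ler_norm _)).
Qed.

Lemma sums_telescope v : v @ \oo --> 0 -> sums (fun i => v i - v i.+1) (v 0%N).
Proof.
move=> v0; rewrite /sums; have -> : series (fun i => v i - v i.+1) = fun n => v 0%N - v n.
  apply/funext => n; rewrite seriesE -[RHS]opprB -telescope_sumr// -sumrN.
  by apply: eq_bigr => i _; rewrite opprB.
by rewrite -[X in _ --> X]subr0; apply: cvgB => //; exact: cvg_cst.
Qed.

Lemma sums_tail u s g t n : (forall i, `|u i| <= g i) -> sums u s -> sums g t ->
  `|s - series u n| <= t - series g n.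
Proof.
move=> ug us gt.
have c1 : (fun m => `|series u m - series u n|) @ \oo --> `|s - series u n|.
  by apply: cvg_norm; apply: cvgB => //; exact: cvg_cst.
have c2 : (fun m => series g m - series g n) @ \oo --> t - series g n.
  by apply: cvgB => //; exact: cvg_cst.
apply: (ler_cvg_to c1 c2); exists n => // m /= nm.
rewrite !sub_series_geq//.
by apply: le_trans (ler_norm_sum _ _ _) _; apply: ler_sum.
Qed.

(** Dominated convergence for series: past some n both tails are below those of [g], and the first n
    terms converge one by one. The main tool below for exchanging limits and sums. *)
Lemma tannery (f : nat -> nat -> R) g l (S : nat -> R) s t :
  (forall k i, `|f k i| <= g i) -> sums g t ->
  (forall i, (fun k => f k i) @ \oo --> l i) ->
  (forall k, sums (f k) (S k)) -> sums l s -> S @ \oo --> s.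
Proof.
move=> fg gt fl fS ls.
have lg i : `|l i| <= g i.
  by apply: (ler_cvg_to (cvg_norm (fl i)) (cvg_cst (g i))); exact: nearW.
apply/cvgrPdist_le => e e0.
have [n _ Hn] : \forall n \near \oo, `|t - series g n| <= e / 3.
  by move/cvgrPdist_le : gt; apply; rewrite divr_gt0.
have {}Hn := Hn n (leqnn n).
have cn : (fun k => series (f k) n) @ \oo --> series l n.
  rewrite /series/=; elim: n {Hn} => [|n IH].
    rewrite big_nil (_ : (fun k => _) = fun=> 0); first exact: cvg_cst.
    by apply/funext => k; rewrite big_nil.
  rewrite big_nat_recr//= (_ : (fun k => _) =
     fun k => \sum_(0 <= i < n) f k i + f k n); first exact: cvgD.
  by apply/funext => k; rewrite big_nat_recr.
have : \forall k \near \oo, `|series l n - series (f k) n| <= e / 3.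
  by move/cvgrPdist_le : cn; apply; rewrite divr_gt0.
apply: filterS => k Hk.
have h1 := sums_tail n (fg k) (fS k) gt.
have h2 := sums_tail n lg ls gt.
have h3 := le_trans h1 (le_trans (ler_norm _) Hn).
have h4 := le_trans h2 (le_trans (ler_norm _) Hn).
have -> : s - S k = (s - series l n) + (series l n - series (f k) n) - (S k - series (f k) n).
  by ring.
apply: le_trans (ler_normB _ _) _; apply: le_trans (lerD (ler_normD _ _) (lexx _)) _.
lra.
Qed.

(** By the mean value theorem the difference quotients of [f i] are bounded by [g i], so [tannery]
    applies along every sequence of increments tending to 0. *)
Lemma termwise_derive (f f' : nat -> R -> R) (F : R -> R) g t c x s :
  c < x -> (forall i y, c < y -> is_derive y 1 (f i) (f' i y)) ->
  (forall i y, c < y -> `|f' i y| <= g i) -> sums g t ->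
  (forall y, c < y -> sums (fun i => f i y) (F y)) ->
  sums (fun i => f' i x) s -> is_derive x 1 F s.
Proof.
move=> cx df f'g gt fF f's.
have H : h^-1 *: (F (h + x) - F x) @[h --> 0^'] --> s.
  apply/cvgr_dnbhsP => u [u0 ucvg].
  (* The bounds hold only to the right of [c], so the first increments, which may step past it, are
     dropped by a shift of index. *)
  have [N _ HN] : \forall n \near \oo, c < u n + x.
    have : (fun n => u n + x) @ \oo --> 0 + x by apply: cvgD => //; exact: cvg_cst.
    by rewrite add0r => /cvgr_gt; apply.
  rewrite -(cvg_shiftn N)/=.
  have uN n : c < u (n + N)%N + x by apply: HN => /=; rewrite leq_addl.
  apply: (@tannery (fun n i => (u (n + N)%N)^-1 * (f i (u (n + N)%N + x) - f i x))
     g (fun i => f' i x) _ s t).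
  - move=> n i; set h := u _; have h0 : h != 0 := u0 _.
    have hx : c < h + x := uN n.
    have M (y z : R) : y <= z -> c < y ->
        `|f i z - f i y| <= g i * (z - y).
      move=> yz cy; have [|w /andP[yw _] ->] := @MVT_closed _ (f i) (f' i) y z yz.
        by move=> w /andP[yw _]; apply: df; exact: lt_le_trans yw.
      rewrite normrM (ger0_norm (_ : 0 <= z - y)) ?subr_ge0//.
      by rewrite ler_wpM2r ?subr_ge0// f'g//; exact: lt_le_trans yw.
    rewrite normrM normfV mulrC ler_pdivrMr ?normr_gt0//.
    have [hp|hn] := ltP 0 h.
      rewrite (gtr0_norm hp); have := M x (h + x).
      by rewrite lerDr (ltW hp) addrK => /(_ isT cx).
    have hn' : h < 0 by rewrite lt_neqAle h0.
    rewrite distrC (ltr0_norm hn'); have := M (h + x) x.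
    by rewrite gerDr (ltW hn') opprD addrCA subrr addr0 => /(_ isT hx).
  - exact: gt.
  - move=> i; have [dfx <-] := df i x cx.
    have E : (fun h : R => h^-1 *: ((f i \o shift x) (h *: 1) - f i x)) =
       (fun h => h^-1 * (f i (h + x) - f i x)).
      by apply/funext => h; rewrite /= [_%:A]mulr1.
    have cv : (fun h : R => h^-1 * (f i (h + x) - f i x)) @ 0^' --> 'D_1 (f i) x.
      by move: dfx; rewrite /derivable /derive E.
    move/cvgr_dnbhsP : cv => /(_ (fun n => u (n + N)%N)); apply; split => //.
    by rewrite (cvg_shiftn N).
  - move=> n; apply: sumsZ; apply: sumsB; apply: fF => //; exact: uN.
  - exact: f's.
have dF : derivable F x 1.
  by apply/cvg_ex; exists s; under eq_fun do rewrite [_%:A]mulr1.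
apply: DeriveDef => //; rewrite -derive1E; apply: cvg_lim => //.
Qed.

Lemma sums_inv_sqr : exists2 S, @sums (fun i => (i.+1%:R ^+ 2)^-1) S & 0 < S <= 2.
Proof.
have H n : \sum_(0 <= i < n.+1) (i.+1%:R ^+ 2)^-1 <= 2 - n.+1%:R^-1 :> R.
  elim: n => [|n IH]; first by rewrite big_nat1 expr1n invr1; lra.
  rewrite big_nat_recr//=; apply: le_trans (lerD IH (lexx _)) _.
  rewrite -(natr1 n.+1); set x := n.+1%:R : R; have x0 : 0 < x by rewrite ltr0n.
  have -> : 2 - (x + 1)^-1 = 2 - x^-1 + (x * (x + 1))^-1 by field; lra.
  rewrite lerD2l lef_pV2 ?posrE ?exprn_gt0 ?mulr_gt0//; nra.
have u0 (i : nat) : 0 <= (i.+1%:R ^+ 2)^-1 :> R by rewrite invr_ge0 exprn_ge0.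
have [S sS S2] : exists2 S, @sums (fun i => (i.+1%:R ^+ 2)^-1) S & S <= 2.
  apply: sums_bounded => // n; apply: (@le_trans _ _ (2 - n.+1%:R^-1)).
    apply: le_trans (H n); rewrite big_nat_recr//= lerDl; exact: u0.
  by rewrite gerBl.
exists S => //; rewrite S2 andbT; have := le_partial_sums 1 sS u0.
by rewrite big_nat1 expr1n invr1; apply: lt_le_trans.
Qed.

End Series.
Arguments sumsZ {R} c {u s} _.

(** * The functions [Phi] and [Theta] *)

Section BoseFunctions.
Variable R : realType.
Implicit Types (x y c : R).

Lemma exprn_le_expR (m : nat) c : 0 < c ->
  exists2 K : R, 0 < K & forall x, 0 <= x -> x ^+ m <= K * expR (c * x).
Proof.
move=> c0; case: m => [|m].
  exists 1 => // x x0; rewrite expr0 mul1r -expR0 ler_expR; apply: mulr_ge0 => //; exact: ltW.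
have f0 : 0 < m.+1`!%:R :> R by rewrite ltr0n fact_gt0.
exists (m.+1`!%:R / c ^+ m.+1); first by rewrite divr_gt0// exprn_gt0.
move=> x x0; have cx0 : 0 <= c * x by rewrite mulr_ge0// ltW.
have := expR_ge1Dxn m cx0; rewrite exprMn => h.
rewrite mulrAC ler_pdivlMr ?exprn_gt0// -ler_pdivrMl//.
apply: le_trans h; rewrite mulrC [x ^+ _ * _]mulrC.
by rewrite -[leLHS]add0r lerD2r.
Qed.

(** [bose0 x] is (e^x - 1)^-1, [bose1] is minus its derivative, [bose2] its second derivative and
    [bose_log] its antiderivative up to sign. As series they are the sums over i >= 1 of e^(- x i)
    times 1, i, i^2 and 1 / i. *)
Definition bose0 x := expR (- x) / (1 - expR (- x)).
Definition bose1 x := expR (- x) / (1 - expR (- x)) ^+ 2.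
Definition bose2 x := expR (- x) * (1 + expR (- x)) / (1 - expR (- x)) ^+ 3.
Definition bose_log x := - ln (1 - expR (- x)).

Lemma expRN_lt1 x : 0 < x -> expR (- x) < 1.
Proof. by rewrite expR_lt1 oppr_lt0. Qed.

Lemma subr_expRN_gt0 x : 0 < x -> 0 < 1 - expR (- x).
Proof. by move=> x0; rewrite subr_gt0 expRN_lt1. Qed.

Lemma expRNM_nat x n : expR (- x * n%:R) = expR (- x) ^+ n.
Proof. by rewrite expRM_natr. Qed.

Lemma exprn_expRN_cvg0 m x : 0 < x ->
  (fun i => i%:R ^+ m * expR (- x) ^+ i) @ \oo --> (0 : R).
Proof.
move=> x0; have x20 : 0 < x / 2 by rewrite divr_gt0.
have [K K0 HK] := exprn_le_expR m x20.
apply: (@cvg0_le _ _ (fun i => K * expR (- (x / 2)) ^+ i)).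
  move=> i; rewrite ger0_norm; last by rewrite mulr_ge0 ?exprn_ge0 ?expR_ge0.
  apply: le_trans (ler_wpM2r _ (HK i%:R _)) _; rewrite ?exprn_ge0 ?expR_ge0//.
  rewrite -(mulrA K) -(expRM_natr i (- x)) -expRD -(expRM_natr i (- (x / 2))).
  by rewrite ler_wpM2l ?(ltW K0)// ler_expR; lra.
rewrite -(mulr0 K); apply: cvgMr; apply: cvg_expr.
by rewrite ger0_norm ?expR_ge0// expRN_lt1.
Qed.

Lemma sums_bose0 x : 0 < x -> sums (fun i => expR (- x * i.+1%:R)) (bose0 x).
Proof.
move=> x0; have q1 := subr_expRN_gt0 x0; set q := expR (- x).
have := @sums_telescope R (fun i => q ^+ i.+1 / (1 - q)).
rewrite expr1 -/(bose0 x) => H; apply: eq_sums (H _).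
  by move=> i; rewrite expRNM_nat -/q !exprS; field; rewrite gt_eqF.
have : (fun i => (q / (1 - q)) * (i%:R ^+ 0 * q ^+ i)) @ \oo --> (q / (1 - q)) * 0.
  by apply: cvgMr; exact: exprn_expRN_cvg0.
rewrite mulr0; apply: cvg_trans; apply: near_eq_cvg; apply: nearW => i.
by rewrite expr0 mul1r exprS mulrAC.
Qed.

Lemma sums_bose1 x : 0 < x ->
  sums (fun i => i.+1%:R * expR (- x * i.+1%:R)) (bose1 x).
Proof.
move=> x0; have q1 := subr_expRN_gt0 x0; set q := expR (- x).
(* The sequence given is the closed form of the tail, the sum of (j + 1) q^(j + 1) over j >= i; the
   second moment below is handled in the same way. *)
have := @sums_telescope R (fun i => q ^+ i.+1 * (i%:R / (1 - q) + 1 / (1 - q) ^+ 2)).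
rewrite expr1 mul0r add0r mulrA mulr1 -/(bose1 x) => H; apply: eq_sums (H _).
  move=> i; rewrite expRNM_nat -/q -(natr1 i) !exprS.
  by field; rewrite gt_eqF.
have : (fun i => (q / (1 - q)) * (i%:R ^+ 1 * q ^+ i) +
     (q / (1 - q) ^+ 2) * (i%:R ^+ 0 * q ^+ i)) @ \oo -->
     (q / (1 - q)) * 0 + (q / (1 - q) ^+ 2) * 0.
  by apply: cvgD; apply: cvgMr; exact: exprn_expRN_cvg0.
rewrite !mulr0 addr0; apply: cvg_trans; apply: near_eq_cvg; apply: nearW => i.
by rewrite expr0 !expr1 (exprS q); ring.
Qed.

Lemma sums_bose2 x : 0 < x ->
  sums (fun i => i.+1%:R ^+ 2 * expR (- x * i.+1%:R)) (bose2 x).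
Proof.
move=> x0; have q1 := subr_expRN_gt0 x0; set q := expR (- x).
pose v i := q ^+ i.+1 * (i%:R ^+ 2 / (1 - q) + 2 * i%:R / (1 - q) ^+ 2
   + (1 + q) / (1 - q) ^+ 3).
have := @sums_telescope R v.
have -> : v 0%N = bose2 x by rewrite /v /bose2 -/q expr1; field; rewrite gt_eqF.
move=> H; apply: eq_sums (H _).
  move=> i; rewrite expRNM_nat /v -/q -(natr1 i) !exprS.
  by field; rewrite gt_eqF.
have : (fun i => (q / (1 - q)) * (i%:R ^+ 2 * q ^+ i) +
     (2 * q / (1 - q) ^+ 2) * (i%:R ^+ 1 * q ^+ i) +
     (q * (1 + q) / (1 - q) ^+ 3) * (i%:R ^+ 0 * q ^+ i)) @ \oo -->
     (q / (1 - q)) * 0 + (2 * q / (1 - q) ^+ 2) * 0 + (q * (1 + q) / (1 - q) ^+ 3) * 0.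
  by apply: cvgD; [apply: cvgD|]; apply: cvgMr; exact: exprn_expRN_cvg0.
rewrite !mulr0 !addr0; apply: cvg_trans; apply: near_eq_cvg; apply: nearW => i.
by rewrite /v expr0 !expr1 (exprS q); ring.
Qed.

Lemma is_derive_bose0 x : 0 < x -> is_derive x 1 bose0 (- bose1 x).
Proof.
move=> x0; have q1 := lt0r_neq0 (subr_expRN_gt0 x0).
rewrite /bose0; apply: is_derive_eq; rewrite /bose1 /GRing.scale/=.
by field.
Qed.

Lemma is_derive_bose1 x : 0 < x -> is_derive x 1 bose1 (- bose2 x).
Proof.
move=> x0; have q1 := lt0r_neq0 (subr_expRN_gt0 x0).
have q2 : (1 - expR (- x)) ^+ 2 != 0 by rewrite expf_neq0.
rewrite /bose1; apply: is_derive_eq; rewrite /bose2 /GRing.scale/=.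
by field.
Qed.

Lemma is_derive_bose_log x : 0 < x -> is_derive x 1 bose_log (- bose0 x).
Proof.
move=> x0; have q1 := subr_expRN_gt0 x0.
have d : is_derive x 1 (fun y : R => 1 - expR (- y)) (expR (- x)).
  by apply: is_derive_eq; rewrite /GRing.scale/=; ring.
have dl := is_derive_ln_comp d q1.
by rewrite /bose_log; apply: is_derive_eq; rewrite /bose0 mulrC.
Qed.

(** As a function of y = e^(-x), the remainder vanishes at 0 and has derivative y^n / (1 - y). *)
Lemma bose_logE_ge0 x n : 0 < x ->
  0 <= bose_log x - \sum_(0 <= i < n) i.+1%:R^-1 * expR (- x * i.+1%:R)
    <= expR (- x) ^+ n / (1 - expR (- x)).
Proof.
move=> x0; set q := expR (- x); have q0 : 0 < q := expR_gt0 _.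
have q1 : 0 < 1 - q := subr_expRN_gt0 x0.
pose h y := - ln (1 - y) - \sum_(0 <= i < n) i.+1%:R^-1 * y ^+ i.+1.
have dh y : 0 <= y <= q -> is_derive y 1 h (y ^+ n / (1 - y)).
  move=> /andP[y0 yq]; have y1 : 0 < 1 - y by apply: lt_le_trans q1 _; lra.
  have d : is_derive y 1 (fun y : R => 1 - y) (- 1).
    by apply: is_derive_eq; rewrite /GRing.scale/=; ring.
  have dl := is_derive_ln_comp d y1.
  have ds : is_derive y 1 (fun y => \sum_(0 <= i < n) i.+1%:R^-1 * y ^+ i.+1)
      (\sum_(0 <= i < n) y ^+ i).
    elim: n {h} => [|n IH].
      rewrite big_nil (_ : (fun y => _) = cst 0); first exact: is_derive_cst.
      by apply/funext => z; rewrite big_nil.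
    rewrite big_nat_recr//= (_ : (fun y => _) =
      fun y => \sum_(0 <= i < n) i.+1%:R^-1 * y ^+ i.+1 + n.+1%:R^-1 * y ^+ n.+1); last first.
      by apply/funext => z; rewrite big_nat_recr.
    apply: is_deriveD => //.
    have := is_deriveZ n.+1%:R^-1 (is_derive_exprn n.+1 y).
    by rewrite /GRing.scale/= mulKf// pnatr_eq0.
  rewrite /h; apply: is_derive_eq.
  have -> : \sum_(0 <= i < n) y ^+ i = (1 - y ^+ n) / (1 - y).
    by rewrite -[1 - y ^+ n]opprB subrX1 -mulNr opprB mulrAC divff ?mul1r ?gt_eqF// big_mkord.
  by field; rewrite gt_eqF.
have h0 : h 0 = 0.
  by rewrite /h subr0 ln1 big1 ?subr0 ?oppr0// => i _; rewrite expr0n mulr0.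
have [c /andP[c0 cq]] := MVT_closed (ltW q0) dh.
rewrite h0 subr0 => E.
have -> : bose_log x - \sum_(0 <= i < n) i.+1%:R^-1 * expR (- x * i.+1%:R) = h q.
  by rewrite /bose_log /h; congr (_ - _); apply: eq_bigr => i _; rewrite expRNM_nat.
have c1 : 0 < 1 - c by lra.
rewrite E subr0 mulr_ge0 ?divr_ge0 ?exprn_ge0 ?(ltW q0) ?(ltW c1)//=.
have q1' : q <= 1 by lra.
apply: le_trans (_ : c ^+ n / (1 - c) * 1 <= _).
  by rewrite ler_wpM2l// divr_ge0 ?exprn_ge0// ltW.
rewrite mulr1 ler_pM ?exprn_ge0 ?invr_ge0 ?(ltW c1)//.
  by rewrite lerXn2r ?nnegrE// (le_trans c0).
by rewrite lef_pV2 ?posrE//; lra.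
Qed.

Lemma sums_bose_log x : 0 < x ->
  sums (fun i => i.+1%:R^-1 * expR (- x * i.+1%:R)) (bose_log x).
Proof.
move=> x0; apply: cvg_dist0.
apply: (@cvg0_le _ _ (fun n => (1 - expR (- x))^-1 * expR (- x) ^+ n)).
  move=> n; have /andP[h1 h2] := bose_logE_ge0 n x0.
  by rewrite distrC ger0_norm// mulrC.
rewrite -(mulr0 (1 - expR (- x))^-1); apply: cvgMr; apply: cvg_expr.
by rewrite ger0_norm ?expR_ge0// expRN_lt1.
Qed.

End BoseFunctions.

(** * Sizes of the Bose functions and their expansions at 0 *)

Section BoseEstimates.
Variable R : realType.
Implicit Types (x y c : R).

Lemma subr_expRN_le x : 1 - expR (- x) <= x.
Proof. by have := expR_ge1Dx (- x); lra. Qed.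

Lemma le_mul_subr_expRN x : 0 < x -> x <= (1 + x) * (1 - expR (- x)).
Proof.
move=> x0; have h : (1 + x) * expR (- x) <= 1.
  by rewrite expRN ler_pdivrMr ?expR_gt0// mul1r expR_ge1Dx.
by rewrite mulrBr mulr1; lra.
Qed.

Lemma bose0_bounds x : 0 < x -> 0 <= x^-1 - bose0 x <= 1.
Proof.
move=> x0; have q1 := subr_expRN_gt0 x0.
have h1 := subr_expRN_le x; have h2 := le_mul_subr_expRN x0.
have -> : x^-1 - bose0 x = ((1 + x) * (1 - expR (- x)) - x) / (x * (1 - expR (- x))).
  by rewrite /bose0; field; rewrite !gt_eqF.
apply/andP; split; first by rewrite divr_ge0 ?subr_ge0// mulr_ge0// ltW.
by rewrite ler_pdivrMr ?mulr_gt0// mul1r; move: h1 h2; lra.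
Qed.

Lemma bose0_le_inv x : 0 < x -> bose0 x <= x^-1.
Proof. by move=> /bose0_bounds/andP[]; rewrite subr_ge0. Qed.

Lemma bose_gt0 x : 0 < x -> [/\ 0 < bose0 x, 0 < bose1 x & 0 < bose2 x].
Proof.
move=> x0; have q1 := subr_expRN_gt0 x0; have q0 := expR_gt0 (- x).
split; apply: divr_gt0; rewrite ?exprn_gt0//.
by apply: mulr_gt0 => //; apply: addr_gt0.
Qed.

Lemma bose_le x : 0 < x -> [/\ expR (- x) <= bose0 x, bose0 x <= bose1 x & bose1 x <= bose2 x].
Proof.
move=> x0; have q1 := subr_expRN_gt0 x0; have q0 := expR_gt0 (- x).
have [b0 b1 b2] := bose_gt0 x0.
split.
- by rewrite ler_pdivlMr// ler_piMr ?(ltW q0)//; lra.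
- have -> : bose0 x = bose1 x * (1 - expR (- x)).
    by rewrite /bose0 /bose1; field; rewrite gt_eqF.
  by rewrite ler_piMr ?(ltW b1)//; lra.
- have -> : bose2 x = bose1 x * ((1 + expR (- x)) / (1 - expR (- x))).
    by rewrite /bose2 /bose1; field; rewrite gt_eqF.
  by rewrite ler_peMr ?(ltW b1)// ler_pdivlMr//; lra.
Qed.

(** The two sides differ by the factor 1 + e^(-x). This log-convexity, summed over the series, makes
    the covariance form of [P_quad_ge0] nonnegative. *)
Lemma bose1_sqr_le x : 0 < x -> bose1 x ^+ 2 <= bose0 x * bose2 x.
Proof.
move=> x0; have q1 := subr_expRN_gt0 x0; have q0 := expR_gt0 (- x).
have -> : bose0 x * bose2 x = bose1 x ^+ 2 * (1 + expR (- x)).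
  by rewrite /bose0 /bose1 /bose2; field; rewrite gt_eqF.
by rewrite ler_peMr ?sqr_ge0//; lra.
Qed.

Lemma bose2_le_exp c : 0 < c ->
  exists2 K : R, 0 < K & forall x, c <= x -> bose2 x <= K * expR (- x).
Proof.
move=> c0; have q1 := subr_expRN_gt0 c0.
exists (2 / (1 - expR (- c)) ^+ 3); first by rewrite divr_gt0// exprn_gt0.
move=> x cx; have x0 : 0 < x := lt_le_trans c0 cx.
have qx := subr_expRN_gt0 x0; have e0 := expR_gt0 (- x).
rewrite mulrC /bose2 -mulrA ler_wpM2l ?expR_ge0//.
rewrite ler_pM ?invr_ge0 ?exprn_ge0 ?(ltW qx) ?addr_ge0 ?(ltW e0)//; first lra.
rewrite lef_pV2 ?posrE ?exprn_gt0// lerXn2r ?nnegrE ?(ltW q1) ?(ltW qx)//.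
by rewrite lerB// ler_expR lerN2.
Qed.

(** The numerator [N] vanishes at 0 together with its first two derivatives, so it is at most e x^3
    on [0, 1]; beyond 1 the cruder [bose0_bounds] is enough. The term 1 / 2 is the source of [Psi]
    in the theorem. *)
Lemma bose0_expand x : 0 < x -> `|bose0 x - x^-1 + 2^-1| <= expR 1 * x.
Proof.
move=> x0; have E1 : 1 <= expR 1 :> R by rewrite -expR0 ler_expR.
have [x1|x1] := leP x 1; last first.
  have /andP[h1 h2] := bose0_bounds x0.
  apply: (@le_trans _ _ (1 * 1)); last by rewrite ler_pM// ltW.
  by rewrite ler_norml; lra.
have eb (z : R) : 0 <= z <= x -> expR z <= expR 1.
  by move=> /andP[_ zx]; rewrite ler_expR (le_trans zx).
pose N1 (z : R) := expR z * (z - 1) + 1.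
pose N (z : R) := expR z * (z - 2) + z + 2.
have d1 (z : R) : is_derive z 1 N1 (z * expR z).
  by rewrite /N1; apply: is_derive_eq; rewrite /GRing.scale/=; ring.
have d0 (z : R) : is_derive z 1 N (N1 z).
  by rewrite /N; apply: is_derive_eq; rewrite /N1 /GRing.scale/=; ring.
have N1z : N1 0 = 0 by rewrite /N1 expR0; ring.
have Nz : N 0 = 0 by rewrite /N expR0; ring.
have N1_ge0 (z : R) : 0 <= z -> 0 <= N1 z.
  move=> z0; rewrite -N1z; apply: (@derive_ge0_le _ N1 (fun z => z * expR z)) => //.
  by move=> w /andP[w0 _]; rewrite mulr_ge0 ?expR_ge0.
have N_ge0 : 0 <= N x.
  rewrite -Nz; apply: (@derive_ge0_le _ N N1) => //; first exact: ltW.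
  by move=> w /andP[w0 _]; exact: N1_ge0.
have N1_le (z : R) : 0 <= z <= x -> N1 z <= expR 1 * z ^+ 2.
  move=> /andP[z0 zx]; pose g w := expR 1 * w ^+ 2 - N1 w.
  have g0 : g 0 = 0 by rewrite /g N1z; ring.
  rewrite -subr_ge0 -/(g z) -g0.
  apply: (@derive_ge0_le _ g (fun w => expR 1 * (2 * w) - w * expR w)) => //.
    move=> w _; have dw := is_derive_exprn 2 w.
    by rewrite /g; apply: is_derive_eq; rewrite /GRing.scale/=; ring.
  move=> w /andP[w0 wz].
  have := eb w; rewrite w0 (le_trans wz)// => /(_ isT) h.
  have : w * expR w <= w * expR 1 by rewrite ler_wpM2l.
  have : 0 <= w * expR 1 by rewrite mulr_ge0 ?expR_ge0.
  by lra.
have N_le : N x <= expR 1 * x ^+ 3.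
  pose g w := expR 1 * w ^+ 3 - N w.
  have g0 : g 0 = 0 by rewrite /g Nz; ring.
  rewrite -subr_ge0 -/(g x) -g0.
  apply: (@derive_ge0_le _ g (fun w => expR 1 * (3 * w ^+ 2) - N1 w)) => //; first exact: ltW.
    move=> w _; have dw := is_derive_exprn 3 w; have dn := d0 w.
    by rewrite /g; apply: is_derive_eq; rewrite /GRing.scale/=; ring.
  move=> w wx; have := N1_le w wx.
  have : 0 <= expR 1 * w ^+ 2 by rewrite mulr_ge0 ?expR_ge0 ?sqr_ge0.
  by lra.
have ex : 0 < expR x - 1 by rewrite subr_gt0 expR_gt1.
have exx : x <= expR x - 1 by have := expR_ge1Dx x; lra.
have -> : bose0 x - x^-1 + 2^-1 = N x / (2 * x * (expR x - 1)).
  have e0 := expR_gt0 x.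
  have ne : 1 - (expR x)^-1 != 0.
    by rewrite -expRN gt_eqF// subr_expRN_gt0.
  rewrite /bose0 expRN /N; field; rewrite !gt_eqF//=.
rewrite ger0_norm; last by rewrite divr_ge0// !mulr_ge0// ltW.
rewrite ler_pdivrMr ?mulr_gt0//; apply: le_trans N_le _.
rewrite -[leRHS]mulrA ler_wpM2l ?expR_ge0//.
rewrite exprS ler_wpM2l ?(ltW x0)// expr2 -[leRHS]mulrA.
have : x * x <= x * (expR x - 1) by rewrite ler_wpM2l// ltW.
have : 0 <= x * x by rewrite -expr2 sqr_ge0.
by lra.
Qed.

Lemma bose1E x : 0 < x -> bose1 x = (expR x + expR (- x) - 2)^-1.
Proof.
move=> x0; have e0 := expR_gt0 x.
have ne : 1 - (expR x)^-1 != 0 by rewrite -expRN gt_eqF// subr_expRN_gt0.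
have ne2 : expR x - 1 != 0 by rewrite gt_eqF// subr_gt0 expR_gt1.
have E : expR x + expR (- x) - 2 = (expR x - 1) ^+ 2 / expR x.
  by rewrite expRN; field; rewrite gt_eqF.
by rewrite E /bose1 expRN; field; rewrite ?ne ?ne2 gt_eqF.
Qed.

(** After [bose1E] the claim is that e^x + e^(-x) - 2 - x^2 lies between 0 and 2 e x^4 on (0, 1],
    obtained by integrating four times from 0; for x >= 1 the value x^-2 <= 1 is enough. *)
Lemma bose1_bounds x : 0 < x -> 0 <= (x ^+ 2)^-1 - bose1 x <= 2 * expR 1.
Proof.
move=> x0; have E1 : 1 <= expR 1 :> R by rewrite -expR0 ler_expR.
pose f3 (z : R) := expR z - expR (- z).
pose f2 (z : R) := expR z + expR (- z) - 2.
pose f1 (z : R) := expR z - expR (- z) - 2 * z.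
pose f0 (z : R) := expR z + expR (- z) - 2 - z ^+ 2.
have d3 (z : R) : is_derive z 1 f3 (expR z + expR (- z)).
  by rewrite /f3; apply: is_derive_eq; rewrite /GRing.scale/=; ring.
have d2 (z : R) : is_derive z 1 f2 (f3 z).
  by rewrite /f2; apply: is_derive_eq; rewrite /f3 /GRing.scale/=; ring.
have d1 (z : R) : is_derive z 1 f1 (f2 z).
  by rewrite /f1; apply: is_derive_eq; rewrite /f2 /GRing.scale/=; ring.
have d0 (z : R) : is_derive z 1 f0 (f1 z).
  have dw := is_derive_exprn 2 z.
  by rewrite /f0; apply: is_derive_eq; rewrite /f1 /f3 /f2 /GRing.scale/= expr1; ring.
have f30 : f3 0 = 0 by rewrite /f3 oppr0 subrr.
have f20 : f2 0 = 0 by rewrite /f2 oppr0 expR0; ring.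
have f10 : f1 0 = 0 by rewrite /f1 oppr0 expR0; ring.
have f00 : f0 0 = 0 by rewrite /f0 oppr0 expR0; ring.
have f3_ge0 (z : R) : 0 <= z -> 0 <= f3 z.
  move=> z0; rewrite -f30; apply: (derive_ge0_le z0 (fun w _ => d3 w)) => w _.
  by rewrite addr_ge0 ?expR_ge0.
have f2_ge0 (z : R) : 0 <= z -> 0 <= f2 z.
  move=> z0; rewrite -f20; apply: (derive_ge0_le z0 (fun w _ => d2 w)) => w.
  by move=> /andP[w0 _]; exact: f3_ge0.
have f1_ge0 (z : R) : 0 <= z -> 0 <= f1 z.
  move=> z0; rewrite -f10; apply: (derive_ge0_le z0 (fun w _ => d1 w)) => w.
  by move=> /andP[w0 _]; exact: f2_ge0.
have f0_ge0 : 0 <= f0 x.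
  rewrite -f00; apply: (derive_ge0_le (ltW x0) (fun w _ => d0 w)) => w.
  by move=> /andP[w0 _]; exact: f1_ge0.
have x2 : 0 < x ^+ 2 by rewrite exprn_gt0.
have D0 : 0 < expR x + expR (- x) - 2 by move: f0_ge0; rewrite /f0; lra.
rewrite bose1E// subr_ge0 lef_pV2 ?posrE//; apply/andP; split.
  by move: f0_ge0; rewrite /f0; lra.
have [x1|x1] := leP 1 x.
  apply: (@le_trans _ _ 1); last by lra.
  have : (x ^+ 2)^-1 <= 1 by rewrite invf_le1// exprn_ege1.
  have : 0 <= (expR x + expR (- x) - 2)^-1 by rewrite invr_ge0 ltW.
  by lra.
have cle (k : nat) (g g' : R -> R) (K : R) : (forall z : R, is_derive z 1 g (g' z)) ->
    0 <= K -> g 0 = 0 -> (forall z, 0 <= z <= x -> g' z <= K * z ^+ k) ->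
    forall z, 0 <= z <= x -> g z <= K * z ^+ k.+1.
  move=> dg K0 g0 g'K z /andP[z0 zx].
  pose h w := K * w ^+ k.+1 - g w.
  have h0 : h 0 = 0 by rewrite /h g0 expr0n/=; ring.
  rewrite -subr_ge0 -/(h z) -h0.
  apply: (@derive_ge0_le _ h (fun w => K * (k.+1%:R * w ^+ k) - g' w)) => //.
    move=> w _; have dw := is_derive_exprn k.+1 w; have dgw := dg w.
    by rewrite /h; apply: is_derive_eq; rewrite /GRing.scale/=; ring.
  move=> w /andP[w0 wz]; have := g'K w; rewrite w0 (le_trans wz)// => /(_ isT) h1.
  have : K * w ^+ k <= K * (k.+1%:R * w ^+ k).
    by rewrite ler_wpM2l// ler_peMl ?exprn_ge0// ler1n.
  by lra.
have E2 : 0 <= 2 * expR 1 :> R by rewrite mulr_ge0// expR_ge0.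
have b3 := cle 0%N f3 _ (2 * expR 1) d3 E2 f30.
have b2 := cle 1%N f2 _ (2 * expR 1) d2 E2 f20.
have b1 := cle 2%N f1 _ (2 * expR 1) d1 E2 f10.
have b0 := cle 3%N f0 _ (2 * expR 1) d0 E2 f00.
have key : f0 x <= 2 * expR 1 * x ^+ 4.
  apply: (b0 (b1 (b2 (b3 _)))); last by rewrite lexx ltW.
  move=> z /andP[z0 zx]; rewrite expr0 mulr1.
  have : expR z <= expR 1 by rewrite ler_expR; lra.
  have : expR (- z) <= expR 1 by rewrite ler_expR; lra.
  by lra.
have -> : (x ^+ 2)^-1 - (expR x + expR (- x) - 2)^-1 =
    f0 x / (x ^+ 2 * (expR x + expR (- x) - 2)).
  by rewrite /f0; field; rewrite !gt_eqF.
rewrite ler_pdivrMr ?mulr_gt0//; apply: le_trans key _.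
rewrite ler_wpM2l// (_ : 4 = 2 + 2)%N// exprD ler_wpM2l ?(ltW x2)//.
by move: f0_ge0; rewrite /f0; lra.
Qed.

Lemma bose2_expand : exists2 K : R, 0 < K & forall x, 0 < x ->
  `|x ^+ 3 * bose2 x - 2| <= K * x /\ x ^+ 3 * bose2 x <= K.
Proof.
have [K K0 HK] := exprn_le_expR 3 (@ltr01 R).
have E0 := expR_gt0 (1 : R).
(* The quotient [y] below lies in [1, 1 + x]. The summand 14 comes from 2 (1 + x)^3 <= 2 + 14 x on x
   <= 1; the other one bounds x^3 [bose2 x] globally, a cube being absorbed by the exponential. *)
exists (14 + 2 * (K * expR 1)); first by rewrite ltr_wpDr ?mulr_ge0 ?expR_ge0 ?(ltW K0)//.
move=> x x0; have q1 := subr_expRN_gt0 x0; have e0 := expR_gt0 (- x).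
have e1 := expRN_lt1 x0.
set y := x / (1 - expR (- x)).
have y1 : 1 <= y by rewrite ler_pdivlMr// mul1r subr_expRN_le.
have y2 : y <= 1 + x by rewrite ler_pdivrMr// le_mul_subr_expRN.
have E : x ^+ 3 * bose2 x = expR (- x) * (1 + expR (- x)) * y ^+ 3.
  by rewrite /bose2 /y; field; rewrite gt_eqF.
have y3 : y ^+ 3 <= (1 + x) ^+ 3 by rewrite lerXn2r ?nnegrE; lra.
have y3' : 1 <= y ^+ 3 by rewrite exprn_ege1.
have ub : x ^+ 3 * bose2 x <= 2 * (K * expR 1).
  rewrite E -mulrA mulrCA; apply: ler_pM; [lra| |lra|].
    by rewrite mulr_ge0 ?exprn_ge0 ?expR_ge0//; lra.
  have := HK (1 + x); rewrite mul1r expRD => h.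
  have {}h : y ^+ 3 <= K * (expR 1 * expR x) by apply: le_trans y3 (h _); lra.
  rewrite expRN ler_pdivrMl ?expR_gt0//.
  by apply: le_trans h _; rewrite mulrA mulrC.
have nn : 0 <= x ^+ 3 * bose2 x.
  by have [_ _ b2] := bose_gt0 x0; rewrite mulr_ge0 ?exprn_ge0 ?ltW.
split; last by apply: le_trans ub _; lra.
have KE : 0 <= K * expR 1 by rewrite mulr_ge0 ?ltW.
have [x1|x1] := leP 1 x.
  have : (14 + 2 * (K * expR 1)) * 1 <= (14 + 2 * (K * expR 1)) * x.
    by rewrite ler_wpM2l//; lra.
  by rewrite ler_norml; lra.
have e2 : 1 - x <= expR (- x) by have := expR_ge1Dx (- x); lra.
have lo : 2 - 3 * x <= x ^+ 3 * bose2 x.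
  rewrite E; apply: (@le_trans _ _ (expR (- x) * (1 + expR (- x)))).
    nra.
  by rewrite ler_peMr// mulr_ge0//; lra.
have hi : x ^+ 3 * bose2 x <= 2 + 14 * x.
  rewrite E; apply: (@le_trans _ _ (2 * (1 + x) ^+ 3)).
    apply: (@le_trans _ _ (2 * y ^+ 3)); last by rewrite ler_wpM2l.
    by rewrite ler_wpM2r//; [lra|nra].
  nra.
have : 14 * x <= (14 + 2 * (K * expR 1)) * x.
  by rewrite ler_wpM2r ?(ltW x0)//; lra.
by rewrite ler_norml; lra.
Qed.

End BoseEstimates.

(** * Derivatives of Phi, their exponential size and the covariance form *)

Section PhiDerivatives.
Variable R : realType.
Implicit Types (a c e v x y : R).

Lemma mulrS_gt0 a i : 0 < a -> 0 < a * i.+1%:R.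
Proof. by move=> a0; rewrite mulr_gt0. Qed.

Lemma le_mulrS a i : 0 < a -> a <= a * i.+1%:R.
Proof. by move=> a0; rewrite ler_peMr ?(ltW a0)// ler1n. Qed.

(** From e^(- a (i + 1)) one factor e^(-a) is set aside; the rest is at most e^(- c i), half of
    whose rate absorbs the power of i + 1 and half of which is summed. The factor e^(-a) with a
    constant independent of [a] is what survives when [a] tends to infinity. *)
Lemma sums_bose2_dominated (l : nat) c : 0 < c -> exists2 K : R, 0 < K &
  forall a (u : nat -> R), c <= a ->
    (forall i, `|u i| <= i.+1%:R ^+ l * bose2 (a * i.+1%:R)) ->
  exists2 s, sums u s & `|s| <= K * expR (- a).
Proof.
move=> c0; have [K1 K10 H1] := bose2_le_exp c0.
have c2 : 0 < c / 2 by rewrite divr_gt0.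
have [K2 K20 H2] := exprn_le_expR l c2.
have [b0 _ _] := bose_gt0 c2.
exists (K1 * K2 * expR c * bose0 (c / 2)).
  by apply: mulr_gt0 => //; rewrite !mulr_gt0 ?expR_gt0.
move=> a u ca ub; have a0 := lt_le_trans c0 ca.
have sb := sumsZ (expR (- a) * K1 * K2 * expR c) (sums_bose0 c2).
have -> : K1 * K2 * expR c * bose0 (c / 2) * expR (- a) =
  expR (- a) * K1 * K2 * expR c * bose0 (c / 2) by ring.
apply: sums_dominated sb => i; apply: le_trans (ub i) _.
have h1 := H1 _ (le_trans ca (le_mulrS i a0)).
have h2 := H2 _ (ler0n R i.+1).
apply: le_trans (ler_wpM2l (exprn_ge0 _ (ler0n R i.+1)) h1) _.
apply: le_trans (ler_wpM2r _ h2) _; first by rewrite mulr_ge0 ?expR_ge0 ?ltW.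
have -> : K2 * expR (c / 2 * i.+1%:R) * (K1 * expR (- (a * i.+1%:R))) =
  K1 * K2 * (expR (c / 2 * i.+1%:R) * expR (- (a * i.+1%:R))) by ring.
have -> : expR (- a) * K1 * K2 * expR c * expR (- (c / 2) * i.+1%:R) =
  K1 * K2 * (expR (- a) * (expR c * expR (- (c / 2) * i.+1%:R))) by ring.
rewrite ler_wpM2l ?mulr_ge0 ?(ltW K10) ?(ltW K20)// -!expRD ler_expR.
have : c * i%:R <= a * i%:R by rewrite ler_wpM2r.
by rewrite -(natr1 i); lra.
Qed.

Definition Phi_term a i : R := (i.+1%:R ^+ 2)^-1 * bose0 (a * i.+1%:R).
Definition Psi_term a i : R := i.+1%:R^-1 * bose0 (a * i.+1%:R).
Definition P1_term a i : R := i.+1%:R^-1 * bose1 (a * i.+1%:R).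
Definition P2_term a i : R := bose2 (a * i.+1%:R).
(* [P1 = - Phi'] and [P2 = Phi''], see [derive1_PhiD] and [derive2_PhiD]. *)
Definition P1 a : R := limn (series (P1_term a)).
Definition P2 a : R := limn (series (P2_term a)).

Lemma natV_bounds i (l : nat) : 0 < ((i.+1%:R : R) ^+ l)^-1 <= 1.
Proof.
by rewrite invr_gt0 exprn_gt0//= invf_le1 ?exprn_gt0// exprn_ege1// ler1n.
Qed.

Lemma mul_natV_le i (l : nat) x y : 0 <= x <= y -> `|(i.+1%:R ^+ l)^-1 * x| <= y.
Proof.
have /andP[h1 h2] := natV_bounds i l.
move=> /andP[x0 xy]; rewrite ger0_norm ?mulr_ge0 ?(ltW h1)//.
by apply: le_trans xy; rewrite ler_piMl.
Qed.

Lemma bose_terms a i : 0 < a ->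
  [/\ `|Phi_term a i| <= bose2 (a * i.+1%:R), `|Psi_term a i| <= bose2 (a * i.+1%:R),
      `|P1_term a i| <= bose2 (a * i.+1%:R) & `|P2_term a i| <= bose2 (a * i.+1%:R)].
Proof.
move=> a0; have ai := mulrS_gt0 i a0.
have [b0 b1 b2] := bose_gt0 ai; have [_ l0 l1] := bose_le ai.
split.
- by apply: mul_natV_le; rewrite ltW//= (le_trans l0).
- by rewrite /Psi_term -[i.+1%:R in X in `|X|]expr1; apply: mul_natV_le; rewrite ltW//= (le_trans l0).
- by rewrite /P1_term -[i.+1%:R in X in `|X|]expr1; apply: mul_natV_le; rewrite ltW.
- by rewrite gtr0_norm.
Qed.

Lemma cvg_bose2_dominated a (u : nat -> R) : 0 < a ->
  (forall i, `|u i| <= bose2 (a * i.+1%:R)) -> cvgn (series u).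
Proof.
move=> a0 ub; have [K _ H] := sums_bose2_dominated 0 a0.
have [|s us _] := H a u (lexx _); last by apply/cvg_ex; exists s.
by move=> i; rewrite expr0 mul1r.
Qed.

Lemma limn_shift_sums (f : nat -> R) s : sums (fun i => f i.+1) s ->
  limn (fun N => \sum_(1 <= r < N) f r) = s.
Proof.
move=> fs; apply: cvg_lim => //; rewrite -cvg_shiftS.
rewrite (_ : (fun n => _) = series (fun i => f i.+1))//.
by apply/funext => n; rewrite seriesE big_add1.
Qed.

Lemma sums_Phi a : 0 < a -> sums (Phi_term a) (Phi a).
Proof.
move=> a0; have := @cvg_bose2_dominated a (Phi_term a) a0 (fun i => let: And4 h _ _ _ := bose_terms i a0 in h).
move=> /sums_cvg h; rewrite /Phi (limn_shift_sums (s := limn (series (Phi_term a))))//.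
by apply: eq_sums h => i; rewrite /Phi_term /bose0 mulNr.
Qed.

Lemma sums_Psi a : 0 < a -> sums (Psi_term a) (Psi a).
Proof.
move=> a0; have := @cvg_bose2_dominated a (Psi_term a) a0 (fun i => let: And4 _ h _ _ := bose_terms i a0 in h).
move=> /sums_cvg h; rewrite /Psi (limn_shift_sums (s := limn (series (Psi_term a))))//.
by apply: eq_sums h => i; rewrite /Psi_term /bose0 mulNr.
Qed.

Lemma sums_P1 a : 0 < a -> sums (P1_term a) (P1 a).
Proof.
move=> a0; apply/sums_cvg/(cvg_bose2_dominated a0) => i.
by have [] := bose_terms i a0.
Qed.

Lemma sums_P2 a : 0 < a -> sums (P2_term a) (P2 a).
Proof.
move=> a0; apply/sums_cvg/(cvg_bose2_dominated a0) => i.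
by have [] := bose_terms i a0.
Qed.

Lemma is_derive_scaled (f : R -> R) b c y : is_derive (y * c) 1 f b ->
  is_derive y 1 (fun z => f (z * c)) (b * c).
Proof.
move=> df; have d : is_derive y 1 (fun z : R => z * c) c.
  by apply: is_derive_eq; rewrite /GRing.scale/=; ring.
exact: (@is_derive1_comp _ f (fun z => z * c) y _ _ df d).
Qed.

Lemma bose2_half_bound a : 0 < a -> exists2 K : R, 0 < K &
  forall y (i : nat), a / 2 < y -> bose2 (y * i.+1%:R) <= K * expR (- (a / 2) * i.+1%:R).
Proof.
move=> a0; have a2 : 0 < a / 2 by rewrite divr_gt0.
have [K K0 HK] := bose2_le_exp a2.
exists K => // z j az; have z0 := lt_trans a2 az.
apply: le_trans (HK _ (le_trans (ltW az) (le_mulrS j z0))) _.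
by rewrite ler_wpM2l ?(ltW K0)// ler_expR mulNr lerN2 ler_wpM2r// ltW.
Qed.

Lemma is_derive_Phi a : 0 < a -> is_derive a 1 (@Phi R) (- P1 a).
Proof.
move=> a0; have a2 : 0 < a / 2 by rewrite divr_gt0.
have aa : a / 2 < a by lra.
have [K K0 HK] := bose2_half_bound a0.
apply: (@termwise_derive R (fun i y => Phi_term y i) (fun i y => - P1_term y i)
  (@Phi R) (fun i => K * expR (- (a / 2) * i.+1%:R)) _ (a / 2) a); first exact: aa.
- move=> i y ay; have y0 := lt_trans a2 ay.
  have d := is_derive_scaled (is_derive_bose0 (mulrS_gt0 i y0)).
  have dd := is_deriveZ (i.+1%:R ^+ 2)^-1 d; apply: (is_derive_eq dd).
  have n0 : i.+1%:R != 0 :> R by rewrite pnatr_eq0.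
  by rewrite /P1_term /GRing.scale/=; move: (i.+1%:R) n0 => n n0; field.
- move=> i y ay; have y0 := lt_trans a2 ay.
  by rewrite normrN; have [_ _ h _] := bose_terms i y0; exact: le_trans h (HK y i ay).
- exact: sumsZ (sums_bose0 a2).
- by move=> y ay; apply: sums_Phi; exact: lt_trans ay.
- by rewrite -mulN1r; apply: eq_sums (sumsZ (-1) (sums_P1 a0)) => i; rewrite mulN1r.
Qed.

Lemma is_derive_P1 a : 0 < a -> is_derive a 1 P1 (- P2 a).
Proof.
move=> a0; have a2 : 0 < a / 2 by rewrite divr_gt0.
have aa : a / 2 < a by lra.
have [K K0 HK] := bose2_half_bound a0.
apply: (@termwise_derive R (fun i y => P1_term y i) (fun i y => - P2_term y i)
  P1 (fun i => K * expR (- (a / 2) * i.+1%:R)) _ (a / 2) a); first exact: aa.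
- move=> i y ay; have y0 := lt_trans a2 ay.
  have d := is_derive_scaled (is_derive_bose1 (mulrS_gt0 i y0)).
  have dd := is_deriveZ i.+1%:R^-1 d; apply: (is_derive_eq dd).
  have n0 : i.+1%:R != 0 :> R by rewrite pnatr_eq0.
  by rewrite /P2_term /GRing.scale/=; move: (i.+1%:R) n0 => n n0; field.
- move=> i y ay; have y0 := lt_trans a2 ay.
  by rewrite normrN; have [_ _ _ h] := bose_terms i y0; exact: le_trans h (HK y i ay).
- exact: sumsZ (sums_bose0 a2).
- by move=> y ay; apply: sums_P1; exact: lt_trans ay.
- by rewrite -mulN1r; apply: eq_sums (sumsZ (-1) (sums_P2 a0)) => i; rewrite mulN1r.
Qed.

(** The additive constant treats [Phi] (e = 0) and [Phibar] (e = pi^2 / 6) at once. *)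
Lemma is_derive_PhiD e a : 0 < a -> is_derive a 1 (fun a => Phi a + e) (- P1 a).
Proof.
by move=> /is_derive_Phi d; apply: is_derive_eq; rewrite addr0.
Qed.

Lemma derive1_PhiD e a : 0 < a -> ((fun a => Phi a + e)^`())%classic a = - P1 a.
Proof. by move=> a0; rewrite derive1E; have [_ ->] := is_derive_PhiD e a0. Qed.

Lemma derive2_PhiD e a : 0 < a -> ((fun a => Phi a + e)^`(2))%classic a = P2 a.
Proof.
move=> a0; rewrite derive1nS derive1n1 derive1E.
have d : is_derive a 1 (fun a => - P1 a) (P2 a).
  have d1 := is_derive_P1 a0; apply: is_derive_eq; exact: opprK.
(* The first derivative is known to be [- P1] only on positive reals, so the second one is computed
   from equality near [a]. *)
rewrite -[RHS](@derive_val _ _ _ _ _ _ _ d); apply: near_eq_derive => //.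
by near=> b; rewrite derive1_PhiD//; near: b; exact: lt_nbhsr.
Unshelve. all: by end_near. Qed.

Lemma theta_of_PhiD e a : 0 < a ->
  theta_of (fun a => Phi a + e) a = P1 a / Num.sqrt (Phi a + e).
Proof. by move=> a0; rewrite /theta_of derive1_PhiD// opprK. Qed.

Lemma delta_of_PhiD e a : 0 < a ->
  delta_of (fun a => Phi a + e) a = 2 * (Phi a + e) * P2 a - P1 a ^+ 2.
Proof. by move=> a0; rewrite /delta_of derive1_PhiD// derive2_PhiD// sqrrN. Qed.

Lemma P_ge_exp a : 0 < a ->
  [/\ expR (- a) <= Phi a, expR (- a) <= P1 a & expR (- a) <= P2 a].
Proof.
move=> a0; have [l0 l1 l2] := bose_le a0.
have H (u : nat -> R) s : sums u s -> (forall i, 0 <= u i) -> u 0%N <= s.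
  by move=> us u0; have := le_partial_sums 1 us u0; rewrite big_nat1.
have b i := bose_gt0 (mulrS_gt0 i a0).
split.
- apply: le_trans (H _ _ (sums_Phi a0) _); first by rewrite /Phi_term expr1n invr1 mul1r mulr1.
  by move=> i; have [b0 _ _] := b i; rewrite mulr_ge0 ?invr_ge0 ?exprn_ge0 ?(ltW b0).
- apply: le_trans (H _ _ (sums_P1 a0) _).
    by rewrite /P1_term invr1 mul1r mulr1 (le_trans l0).
  by move=> i; have [_ b0 _] := b i; rewrite mulr_ge0 ?invr_ge0 ?(ltW b0).
- apply: le_trans (H _ _ (sums_P2 a0) _).
    by rewrite /P2_term mulr1 (le_trans l0)// (le_trans l1).
  by move=> i; have [_ _ b0] := b i; exact: ltW.
Qed.

Lemma P_gt0 a : 0 < a -> [/\ 0 < Phi a, 0 < P1 a & 0 < P2 a].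
Proof. by move=> /P_ge_exp[h1 h2 h3]; split; apply: lt_le_trans (expR_gt0 (- a)) _. Qed.

Lemma P_le_exp c : 0 < c -> exists2 K : R, 0 < K & forall a, c <= a ->
  [/\ Phi a <= K * expR (- a), Psi a <= K * expR (- a), P1 a <= K * expR (- a)
    & P2 a <= K * expR (- a)].
Proof.
move=> c0; have [K K0 H] := sums_bose2_dominated 0 c0; exists K => // a ca.
have a0 := lt_le_trans c0 ca.
have G (u : nat -> R) s : sums u s -> (forall i, `|u i| <= bose2 (a * i.+1%:R)) ->
    s <= K * expR (- a).
  move=> us ub; have [|t ut tK] := H a u ca; first by move=> i; rewrite expr0 mul1r.
  by rewrite (sums_unique us ut) (le_trans (ler_norm _)).
split; [apply: G (sums_Phi a0) _|apply: G (sums_Psi a0) _|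
  apply: G (sums_P1 a0) _|apply: G (sums_P2 a0) _] => i; by have [] := bose_terms i a0.
Qed.

(** The form is a series of forms, each nonnegative because [bose1_sqr_le] makes its discriminant
    nonpositive. *)
Lemma P_quad_ge0 a x y : 0 < a -> 0 <= P2 a * x ^+ 2 + 2 * P1 a * x * y + Phi a * y ^+ 2.
Proof.
move=> a0; have S1 := sumsD (sumsZ (x ^+ 2) (sums_P2 a0)) (sumsZ (2 * x * y) (sums_P1 a0)).
have S := sumsD S1 (sumsZ (y ^+ 2) (sums_Phi a0)).
have -> : P2 a * x ^+ 2 + 2 * P1 a * x * y + Phi a * y ^+ 2 =
  x ^+ 2 * P2 a + 2 * x * y * P1 a + y ^+ 2 * Phi a by ring.
apply: (sums_ge0 S) => i; have ai := mulrS_gt0 i a0.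
have [b0 b1 b2] := bose_gt0 ai; have B := bose1_sqr_le ai.
rewrite /P2_term /P1_term /Phi_term; set w := i.+1%:R^-1.
have -> : (i.+1%:R ^+ 2)^-1 = w ^+ 2 by rewrite exprVn.
(* Multiplying the term by [bose2] completes the square. *)
rewrite -(pmulr_rge0 _ b2).
have -> : bose2 (a * i.+1%:R) * (x ^+ 2 * bose2 (a * i.+1%:R) +
   2 * x * y * (w * bose1 (a * i.+1%:R)) + y ^+ 2 * (w ^+ 2 * bose0 (a * i.+1%:R))) =
   (x * bose2 (a * i.+1%:R) + (y * w) * bose1 (a * i.+1%:R)) ^+ 2 +
   (y * w) ^+ 2 * (bose0 (a * i.+1%:R) * bose2 (a * i.+1%:R) - bose1 (a * i.+1%:R) ^+ 2).
  by ring.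
by rewrite addr_ge0 ?sqr_ge0// mulr_ge0 ?sqr_ge0// subr_ge0.
Qed.

(** The doubled coefficient of y^2 gives the slack: [P_quad_ge0] at (x, y) bounds the form below by
    Phi y^2, half of [P_quad_ge0] at (x, 2 y) bounds it below by P2 x^2 / 2, and the two bounds are
    averaged. *)
Lemma P_quad_lb a x y : 0 < a -> expR (- a) / 4 * (x ^+ 2 + y ^+ 2) <=
  P2 a * x ^+ 2 + 2 * P1 a * x * y + 2 * Phi a * y ^+ 2.
Proof.
move=> a0; have [e0 _ e2] := P_ge_exp a0.
have h1 := P_quad_ge0 x y a0; have h2 := P_quad_ge0 x (2 * y) a0.
have h3 : expR (- a) * x ^+ 2 <= P2 a * x ^+ 2 by rewrite ler_wpM2r ?sqr_ge0.
have h4 : expR (- a) * y ^+ 2 <= Phi a * y ^+ 2 by rewrite ler_wpM2r ?sqr_ge0.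
have h5 : 0 <= expR (- a) * y ^+ 2 by rewrite mulr_ge0 ?sqr_ge0 ?expR_ge0.
have E : Phi a * (2 * y) ^+ 2 = 4 * (Phi a * y ^+ 2) by ring.
have E2 : 2 * P1 a * x * (2 * y) = 2 * (2 * P1 a * x * y) by ring.
rewrite E E2 in h2; move: h1 h2; rewrite -(mulrA 2 (Phi a)).
move: (2 * P1 a * x * y) (P2 a * x ^+ 2) (Phi a * y ^+ 2) h3 h4 h5 => A B C; lra.
Qed.

Lemma P1_sqr_le a : 0 < a -> P1 a ^+ 2 <= Phi a * P2 a.
Proof.
move=> a0; have [f0 _ _] := P_gt0 a0.
have := P_quad_ge0 (- Phi a) (P1 a) a0.
have -> : P2 a * (- Phi a) ^+ 2 + 2 * P1 a * - Phi a * P1 a + Phi a * P1 a ^+ 2 =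
  Phi a * (Phi a * P2 a - P1 a ^+ 2) by ring.
by rewrite pmulr_rge0// subr_ge0.
Qed.

Lemma delta_gt0 e a : 0 <= e -> 0 < a -> 0 < 2 * (Phi a + e) * P2 a - P1 a ^+ 2.
Proof.
move=> e0 a0; have [f0 _ g0] := P_gt0 a0; have h := P1_sqr_le a0.
have : 0 <= e * P2 a by rewrite mulr_ge0// ltW.
have : 0 < Phi a * P2 a by rewrite mulr_gt0.
by lra.
Qed.

End PhiDerivatives.

(** * Theta as a decreasing bijection of the positive reals *)

Section ThetaBijection.
Variable R : realType.
Implicit Types (a b c v : R).
Variable e : R.
Hypothesis e0 : 0 <= e.

Let T a := P1 a / Num.sqrt (Phi a + e).
(** The square of [T]: monotonicity is proved on it, without differentiating a square root. *)
Let T2 a := P1 a ^+ 2 / (Phi a + e).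

Let PhiD_gt0 a : 0 < a -> 0 < Phi a + e.
Proof. by move=> /P_gt0[h _ _]; rewrite ltr_pwDl. Qed.

Let T_gt0 a : 0 < a -> 0 < T a.
Proof.
by move=> a0; have [_ h _] := P_gt0 a0; rewrite divr_gt0// sqrtr_gt0 PhiD_gt0.
Qed.

Let T_sqr a : 0 < a -> T a ^+ 2 = T2 a.
Proof. by move=> a0; rewrite /T exprMn exprVn sqr_sqrtr// ltW// PhiD_gt0. Qed.

Let T2_derive a : 0 < a -> is_derive a 1 T2
  (- (P1 a * (2 * (Phi a + e) * P2 a - P1 a ^+ 2) / (Phi a + e) ^+ 2)).
Proof.
move=> a0; have f0 := lt0r_neq0 (PhiD_gt0 a0).
have d1 := is_derive_P1 a0; have d0 := is_derive_PhiD e a0.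
rewrite /T2; apply: is_derive_eq; rewrite /GRing.scale/= ?expr1.
by field.
Qed.

(** The derivative of [T2] has the sign opposite to that of the discriminant [delta_of], positive by
    [delta_gt0]. *)
Lemma theta_decr a b : 0 < a -> a < b -> T b < T a.
Proof.
move=> a0 ab; have b0 := lt_trans a0 ab.
have dT z : a <= z <= b -> is_derive z 1 T2
    (- (P1 z * (2 * (Phi z + e) * P2 z - P1 z ^+ 2) / (Phi z + e) ^+ 2)).
  by move=> /andP[az _]; apply: T2_derive; exact: lt_le_trans az.
have [c /andP[ac cb] E] := MVT_closed (ltW ab) dT.
have c0 : 0 < c := lt_le_trans a0 ac.
have [_ p1 _] := P_gt0 c0.
have : T2 b - T2 a < 0.
  rewrite E nmulr_rlt0 ?subr_gt0// oppr_lt0.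
  by rewrite divr_gt0 ?exprn_gt0 ?PhiD_gt0// mulr_gt0// delta_gt0.
rewrite subr_lt0 -!T_sqr// ltr_pXn2r ?nnegrE ?ltW ?T_gt0//.
Qed.

Lemma theta_inj a b : 0 < a -> 0 < b -> T a = T b -> a = b.
Proof.
move=> a0 b0 E; have [ab|ab|//] := ltgtP a b.
  by have := theta_decr a0 ab; rewrite E ltxx.
by have := theta_decr b0 ab; rewrite E ltxx.
Qed.

Lemma Phi_le_inv : exists2 S : R, 0 < S & forall a, 0 < a -> Phi a <= S / a.
Proof.
have [S sS /andP[S0 _]] := sums_inv_sqr R.
exists S => // a a0; rewrite mulrC; apply: (le_sums (sums_Phi a0) (sumsZ a^-1 sS)) => i.
have ai := mulrS_gt0 i a0; rewrite /Phi_term mulrC ler_wpM2r ?invr_ge0 ?exprn_ge0//.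
apply: le_trans (bose0_le_inv ai) _.
by rewrite lef_pV2 ?posrE// le_mulrS.
Qed.

(** For a <= 1 the first term of the series gives P1 >= e^-1 / a^2, while Phi + e <= (S + e) / a^2;
    the square root leaves one power of 1 / a. *)
Lemma theta_lb : exists2 C : R, 0 < C & forall a, 0 < a <= 1 -> C / a <= T a.
Proof.
have [S S0 HS] := Phi_le_inv.
have Se : 0 < S + e by rewrite ltr_pwDl.
exists (expR (- 1) / Num.sqrt (S + e)).
  by rewrite divr_gt0 ?expR_gt0// sqrtr_gt0.
move=> a /andP[a0 a1].
have p1 : expR (- 1) / a ^+ 2 <= P1 a.
  have := le_partial_sums 1 (sums_P1 a0) (fun i => _); rewrite big_nat1.
  rewrite /P1_term invr1 mul1r mulr1 => H.
  apply: le_trans (H _); last first.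
    move=> i; have [_ b1 _] := bose_gt0 (mulrS_gt0 i a0).
    by rewrite mulr_ge0 ?invr_ge0// ltW.
  have q := subr_expRN_gt0 a0; rewrite /bose1 ler_pM ?invr_ge0 ?exprn_ge0 ?expR_ge0 ?(ltW a0)//.
    by rewrite ler_expR lerN2.
  by rewrite lef_pV2 ?posrE ?exprn_gt0// lerXn2r ?nnegrE ?(ltW q) ?(ltW a0)// subr_expRN_le.
have fub : Phi a + e <= (S + e) / a ^+ 2.
  have h := HS a a0; rewrite mulrDl lerD//.
    apply: le_trans h _; rewrite ler_wpM2l ?(ltW S0)// lef_pV2 ?posrE ?exprn_gt0//.
    by rewrite expr2 ler_piMr// ltW.
  by rewrite ler_peMr// invf_ge1 ?exprn_gt0// exprn_ile1// ltW.
have sub : Num.sqrt (Phi a + e) <= Num.sqrt (S + e) / a.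
  apply: (@le_trans _ _ (Num.sqrt ((S + e) / a ^+ 2))).
    by rewrite ler_sqrt// divr_ge0 ?exprn_ge0 ?ltW.
  by rewrite sqrtrM ?(ltW Se)// sqrtrV ?exprn_ge0 ?(ltW a0)// sqrtr_sqr gtr0_norm.
have s0 : 0 < Num.sqrt (Phi a + e) by rewrite sqrtr_gt0 PhiD_gt0.
rewrite /T ler_pdivlMr//; apply: le_trans p1.
have sSe : 0 < Num.sqrt (S + e) by rewrite sqrtr_gt0.
apply: le_trans (ler_wpM2l _ sub) _.
  by rewrite !divr_ge0 ?expR_ge0 ?(ltW a0) ?(ltW sSe).
rewrite le_eqVlt; apply/orP; left; apply/eqP; field.
by rewrite !gt_eqF.
Qed.

(** Through this the assumption n1 = O(sqrt n2) keeps the saddle parameter away from 0. *)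
Lemma theta_bounded_below v : exists2 c : R, 0 < c & forall a, 0 < a -> T a <= v -> c <= a.
Proof.
have [C C0 HC] := theta_lb.
exists (Num.min 1 (C / (`|v| + 1))).
  by rewrite lt_min ltr01/= divr_gt0// ltr_wpDl.
move=> a a0 Tv; have [a1|a1] := leP a 1; last by rewrite ge_min (ltW a1).
have := le_trans (HC a _) Tv; rewrite a0 a1 => /(_ isT) h.
rewrite ge_min; apply/orP; right; rewrite ler_pdivrMr ?ltr_wpDl//.
move: h; rewrite ler_pdivrMr// => h; apply: le_trans h _.
by rewrite mulrC ler_wpM2l ?(ltW a0)// (le_trans (ler_norm v))// lerDl.
Qed.

(** Here P1 <= K e^(-b) and sqrt (Phi + e) >= e^(- b / 2), so the quotient is at most K e^(- b /
    2). *)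
Lemma theta_small v : 0 < v -> exists2 b : R, 0 < b & T b < v.
Proof.
move=> v0; have [K K0 HK] := P_le_exp (@ltr01 R).
pose b := Num.max 1 (2 * (K / v)).
have b1 : 1 <= b by rewrite le_max lexx.
have b0 : 0 < b by exact: lt_le_trans b1.
exists b => //; have [_ _ p1 _] := HK b b1; have [f0 _ _] := P_ge_exp b0.
have s1 : expR (- (b / 2)) <= Num.sqrt (Phi b + e).
  rewrite -[leLHS]gtr0_norm ?expR_gt0// -sqrtr_sqr; apply: ler_wsqrtr.
  rewrite expr2 -expRD; apply: le_trans (_ : Phi b <= _); last by rewrite lerDl.
  by apply: le_trans f0; rewrite ler_expR; lra.
rewrite /T ltr_pdivrMr; last by rewrite sqrtr_gt0 PhiD_gt0.
apply: le_lt_trans p1 _; apply: lt_le_trans (_ : v * expR (- (b / 2)) <= _); last first.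
  by rewrite ler_wpM2l// ltW.
have -> : expR (- b) = expR (- (b / 2)) * expR (- (b / 2)).
  by rewrite -expRD; congr expR; lra.
rewrite mulrA ltr_pM2r ?expR_gt0// expRN ltr_pdivrMr ?expR_gt0// mulrC -ltr_pdivrMr//.
have h1 : 2 * (K / v) <= b by rewrite le_max lexx orbT.
have := expR_gt1Dx (x := b / 2); rewrite gt_eqF ?divr_gt0// => /(_ isT).
by lra.
Qed.

Lemma theta_exists v : 0 < v -> exists2 a : R, 0 < a & T a = v.
Proof.
move=> v0; have [b b0 Tb] := theta_small v0; have [C C0 HC] := theta_lb.
pose a := Num.min b (Num.min 1 (C / v)).
have a0 : 0 < a by rewrite !lt_min b0 ltr01 divr_gt0.
have ab : a <= b by rewrite ge_min lexx.
have a1 : a <= 1 by rewrite ge_min ge_min lexx orbT.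
have aC : a <= C / v by rewrite !ge_min lexx !orbT.
have Ta : v <= T a.
  apply: le_trans (HC a _); last by rewrite a0.
  by rewrite ler_pdivlMr// mulrC -ler_pdivlMr.
have cT : {within `[a, b], continuous T}.
  apply: derivable_within_continuous => z; rewrite in_itv/= => /andP[az _].
  have z0 := lt_le_trans a0 az.
  have d1 := is_derive_P1 z0; have d0 := is_derive_PhiD e z0.
  apply: derivableM; first by case: d1.
  apply: derivableV; first by rewrite gt_eqF// sqrtr_gt0 PhiD_gt0.
  have ds : is_derive (Phi z + e) 1 (@Num.sqrt R) (2 * Num.sqrt (Phi z + e))^-1.
    by apply: is_derive1_sqrt; exact: PhiD_gt0.
  by have [] := @is_derive1_comp _ (@Num.sqrt R) (fun z => Phi z + e) z _ _ ds d0.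
have [|c] := @IVT _ T a b v ab cT.
  apply/andP; split; first by rewrite ge_min; apply/orP; right; exact: ltW.
  by rewrite le_max; apply/orP; left; exact: Ta.
rewrite in_itv/= => /andP[ac _] Tc; exists c => //; exact: lt_le_trans ac.
Qed.

Lemma theta_solution v : 0 < v ->
  exists! a : R, 0 < a /\ theta_of (fun a => Phi a + e) a = v.
Proof.
move=> /theta_exists[a a0 Ta]; exists a; split.
  by rewrite theta_of_PhiD.
move=> b [b0]; rewrite theta_of_PhiD// => Tb.
exact: theta_inj a0 b0 (etrans Ta (esym Tb)).
Qed.

End ThetaBijection.

(** * Basel's sum, Stirling's constant and the parts on the second axis *)

Section Basel.
Variable R : realType.
Implicit Types (x y : R).

Lemma sin_ge_mul_cos x : 0 <= x <= pi -> x * cos x <= sin x.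
Proof.
move=> /andP[x0 xpi]; pose f (y : R) := sin y - y * cos y.
have df (y : R) : is_derive y 1 f (y * sin y).
  by rewrite /f; apply: is_derive_eq; rewrite /GRing.scale/=; ring.
have f0 : f 0 = 0 by rewrite /f sin0; ring.
rewrite -subr_ge0 -/(f x) -f0; apply: (derive_ge0_le x0 (fun y _ => df y)) => y /andP[y0 yx].
by rewrite mulr_ge0// sin_ge0_pi// y0 (le_trans yx).
Qed.

Lemma sin_le x : 0 <= x -> sin x <= x.
Proof.
move=> x0; pose f (y : R) := y - sin y.
have df (y : R) : is_derive y 1 f (1 - cos y).
  by rewrite /f; apply: is_derive_eq.
have f0 : f 0 = 0 by rewrite /f sin0; ring.
rewrite -subr_ge0 -/(f x) -f0; apply: (derive_ge0_le x0 (fun y _ => df y)) => y _.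
by rewrite subr_ge0 cos_le1.
Qed.

(** With half angles, sin x = 2 sin (x / 2) cos (x / 2) >= x cos (x / 2)^2, and cos x >= 0 means
    that this squared cosine is at least 1 / 2. *)
Lemma sin_ge_half x : 0 <= x <= pi / 2 -> x / 2 <= sin x.
Proof.
move=> /andP[x0 xpi]; have p0 := pi_gt0 R.
have h : x / 2 * cos (x / 2) <= sin (x / 2) by apply: sin_ge_mul_cos; lra.
have c0 : 0 <= cos (x / 2) by apply: cos_ge0_pihalf; lra.
have cx : 0 <= cos x by apply: cos_ge0_pihalf; lra.
have E : sin x = 2 * (sin (x / 2) * cos (x / 2)).
  have {1}-> : x = x / 2 + x / 2 by lra.
  by rewrite sinD; ring.
have E2 : cos x = 2 * cos (x / 2) ^+ 2 - 1.
  have {1}-> : x = x / 2 + x / 2 by lra.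
  by rewrite cosD -!expr2 sin2cos2; ring.
have h2 : x / 2 * cos (x / 2) * cos (x / 2) <= sin (x / 2) * cos (x / 2).
  by rewrite ler_wpM2r.
rewrite E; apply: (@le_trans _ _ (x * cos (x / 2) ^+ 2)); last by rewrite expr2; lra.
have : 1 / 2 <= cos (x / 2) ^+ 2 by lra.
by nra.
Qed.

(* Iterating this duplication formula at [pi / 2] expresses 1 as a finite sum of
   inverse squared sines, whose termwise limit gives Basel's sum. *)
Lemma inv_sin2_double x : sin x != 0 ->
  (sin x ^+ 2)^-1 = 4^-1 * ((sin (x / 2) ^+ 2)^-1 + (sin ((x + pi) / 2) ^+ 2)^-1).
Proof.
have E : sin x = 2 * (sin (x / 2) * cos (x / 2)).
  have {1}-> : x = x / 2 + x / 2 by lra.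
  by rewrite sinD; ring.
have -> : (x + pi) / 2 = x / 2 + pi / 2 by lra.
rewrite sinDpihalf E !mulf_eq0 !negb_or => /and3P[_ s0 c0].
have -> : (sin (x / 2) ^+ 2)^-1 + (cos (x / 2) ^+ 2)^-1 =
   (cos (x / 2) ^+ 2 + sin (x / 2) ^+ 2) / (sin (x / 2) ^+ 2 * cos (x / 2) ^+ 2).
  by field; rewrite s0 c0.
by rewrite cos2Dsin2; field; rewrite s0 c0.
Qed.

Lemma sum_even_odd (V : nmodType) (F : nat -> V) n :
  \sum_(0 <= i < n.*2) F i = \sum_(0 <= i < n) (F i.*2 + F i.*2.+1).
Proof.
elim: n => [|n IH]; first by rewrite !big_nil.
by rewrite doubleS !big_nat_recr//= IH addrA.
Qed.

(** Both x / 2 and (x + pi) / 2 stay in (0, pi), so the duplication formula iterates; the first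
    produces the even indices k, the second the odd ones. *)
Lemma inv_sin2_sum n x : 0 < x < pi ->
  (sin x ^+ 2)^-1 = (4 ^+ n)^-1 *
    \sum_(0 <= k < (2 ^ n)%N) (sin ((x + k%:R * pi) / 2 ^+ n) ^+ 2)^-1.
Proof.
elim: n x => [|n IH] x /andP[x0 xpi].
  by rewrite big_nat1 mul0r addr0 !expr0 !invr1 mul1r mulr1.
rewrite inv_sin2_double; last by rewrite gt_eqF// sin_gt0_pi// x0.
rewrite (IH (x / 2)); last by apply/andP; split; lra.
rewrite (IH ((x + pi) / 2)); last by apply/andP; split; lra.
rewrite -mulrDr mulrA -invfM -exprS -big_split/= expnS mul2n sum_even_odd.
congr (_ * _); apply: eq_bigr => k _.
have p0 : 2 ^+ n != 0 :> R by rewrite expf_neq0.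
congr ((sin _ ^+ 2)^-1 + (sin _ ^+ 2)^-1).
  by rewrite -mul2n natrM exprS; field.
by rewrite -(natr1 k.*2) -mul2n natrM exprS; field.
Qed.

Lemma sum_rev_half (F : nat -> R) n : (forall k, (k < n.*2)%N -> F (n.*2 - k.+1)%N = F k) ->
  \sum_(0 <= i < n.*2) F i = 2 * \sum_(0 <= i < n) F i.
Proof.
move=> H; rewrite -addnn (@big_cat_nat _ _ _ n)/= ?leq_addr//.
rewrite mulr_natl mulr2n; congr (_ + _).
rewrite big_nat_rev/= -{1}(add0n n) big_addn addnK; apply: eq_big_nat => i /andP[_ ni].
rewrite -[RHS]H; last by rewrite -addnn ltn_addr.
by congr F; rewrite -addnn; lia.
Qed.

(** At pi / 2 the iterated identity has total 1 for every n. The symmetry of the sine about pi / 2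
    folds it onto angles [y n k] at most pi / 2, where sin y >= y / 2 gives a summable majorant;
    since sin y is equivalent to y for fixed k, [tannery] yields 1 as 8 / pi^2 times the odd sum. *)
Lemma sums_inv_odd_sqr : @sums R (fun k => ((2 * k%:R + 1) ^+ 2)^-1) (pi ^+ 2 / 8).
Proof.
have p0 := pi_gt0 R; have pn0 : pi != 0 :> R by rewrite gt_eqF.
pose y n k : R := (2 * k%:R + 1) * pi / 2 ^+ n.+2.
pose f n k : R := if (k < 2 ^ n)%N then 2 * (4 ^+ n.+1)^-1 * (sin (y n k) ^+ 2)^-1 else 0.
pose g k : R := 8 * 4 / pi ^+ 2 * ((2 * k%:R + 1) ^+ 2)^-1.
pose l k : R := 8 / pi ^+ 2 * ((2 * k%:R + 1) ^+ 2)^-1.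
have odd0 k : 0 < 2 * k%:R + 1 :> R by rewrite ltr_wpDl ?mulr_ge0.
have y0 n k : 0 < y n k.
  by apply: divr_gt0; [exact: mulr_gt0|exact: exprn_gt0].
have ypi n k : (k < 2 ^ n)%N -> y n k <= pi / 2.
  move=> kn; rewrite /y ler_pdivrMr ?exprn_gt0// exprS mulrA mulfVK//.
  rewrite exprS mulrC ler_wpM2l ?(ltW p0)//.
  have : (k.+1%:R : R) <= (2 ^ n)%:R by rewrite ler_nat.
  by rewrite natrX -(natr1 k); lra.
have E n k : (4 ^+ n.+1)^-1 * (y n k ^+ 2)^-1 = 4 / pi ^+ 2 * ((2 * k%:R + 1) ^+ 2)^-1.
  rewrite /y -invfM; have -> : 4 ^+ n.+1 = (2 ^+ n.+1) ^+ 2 :> R.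
    by rewrite -exprM mulnC exprM; congr (_ ^+ _); ring.
  rewrite (exprS 2 n.+1); set p := 2 ^+ n.+1.
  have pp : p != 0 by rewrite expf_neq0.
  have o0 : 2 * k%:R + 1 != 0 :> R by rewrite gt_eqF.
  move: (2 * k%:R + 1) o0 p pp (pi : R) pn0 => o o0 p pp q q0; field.
  by rewrite o0 pp q0.
have [S sS _] : exists2 S : R, sums (fun k => ((2 * k%:R + 1) ^+ 2)^-1) S & `|S| <= 2.
  have [S sS /andP[_ S2]] := sums_inv_sqr R.
  have [|t st tS] := @sums_dominated R (fun k => ((2 * k%:R + 1) ^+ 2)^-1) _ S _ sS.
    move=> i; rewrite ger0_norm ?invr_ge0 ?sqr_ge0//.
    rewrite lef_pV2 ?posrE ?exprn_gt0// lerXn2r ?nnegrE ?(ltW (odd0 i))//.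
    by rewrite -(natr1 i); have := ler0n R i; lra.
  by exists t => //; exact: le_trans tS S2.
have fl k : (fun n => f n k) @ \oo --> l k.
  have c1 : (fun n => 8 / pi ^+ 2 * ((2 * k%:R + 1) ^+ 2)^-1 * ((cos (y n k)) ^+ 2)^-1) @ \oo --> l k * (1 ^+ 2)^-1.
    apply: cvgMr; apply: cvgV; first by rewrite expr1n.
    have cy : (fun n => y n k) @ \oo --> (0 : R).
      have : (fun n => ((2 * k%:R + 1) * pi / 4) * (2^-1) ^+ n) @ \oo --> ((2 * k%:R + 1) * pi / 4) * (0 : R).
        by apply: cvgMr; apply: cvg_expr; rewrite ger0_norm; lra.
      rewrite mulr0 (_ : (fun n => _ * _) = (fun n => y n k))//.
      apply/funext => n; rewrite /y !exprS exprVn.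
      by field; rewrite expf_neq0.
    have cc : (fun n => cos (y n k)) @ \oo --> (1 : R).
      by rewrite -cos0; apply: continuous_cvg; [exact: continuous_cos|exact: cy].
    exact: (cvgM cc cc).
  rewrite expr1n invr1 mulr1 in c1.
  (* Squeeze from y cos y <= sin y <= y, valid once [y n k] is below pi / 2. *)
  apply: (@squeeze_cvgr _ _ _ _ (fun=> l k) _ _ _ _ _ c1); last exact: cvg_cst.
  have [n0 kn0] : exists n0, (k < 2 ^ n0)%N by exists k; exact: ltn_expl.
  exists n0.+1 => // n /= n0n.
  have kn : (k < 2 ^ n)%N by apply: leq_trans kn0 _; rewrite leq_exp2l// ltnW.
  have kn' : y n k < pi / 2.
    case: n n0n kn => // n n0n kn; have kn2 : (k < 2 ^ n)%N.
      by apply: leq_trans kn0 _; rewrite leq_exp2l.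
    have := ypi n k kn2; have -> : y n.+1 k = y n k / 2.
      by rewrite /y (exprS _ n.+2); field; rewrite expf_neq0.
    by have := y0 n k; lra.
  have c0 : 0 < cos (y n k) by apply: cos_gt0_pihalf; rewrite kn' andbT; have := y0 n k; lra.
  have s0 : 0 < sin (y n k) by apply: sin_gt0_pi; rewrite y0/=; lra.
  rewrite /f kn; have El : l k = 2 * ((4 ^+ n.+1)^-1 * (y n k ^+ 2)^-1) by rewrite E /l; ring.
  have -> : 8 / pi ^+ 2 * ((2 * k%:R + 1) ^+ 2)^-1 * (cos (y n k) ^+ 2)^-1 =
    2 * ((4 ^+ n.+1)^-1 * (y n k ^+ 2)^-1) * (cos (y n k) ^+ 2)^-1 by rewrite E; ring.
  rewrite El -!mulrA !ler_wpM2l ?invr_ge0 ?exprn_ge0//= -?invfM.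
    rewrite lef_pV2 ?posrE ?mulr_gt0 ?exprn_gt0// -exprMn lerXn2r ?nnegrE ?(ltW s0)//.
      by rewrite mulr_ge0 ?(ltW (y0 n k)) ?(ltW c0).
    by apply: sin_ge_mul_cos; rewrite (ltW (y0 n k))/=; lra.
  rewrite lef_pV2 ?posrE ?exprn_gt0// lerXn2r ?nnegrE ?(ltW s0) ?(ltW (y0 n k))//.
  by rewrite sin_le// ltW.
have fg n k : `|f n k| <= g k.
  rewrite /f; case: ifP => kn; last first.
    by rewrite normr0 /g !mulr_ge0 ?invr_ge0 ?exprn_ge0 ?(ltW p0) ?(ltW (odd0 k)).
  have yp := ypi n k kn; have yn0 := y0 n k.
  have s2 : y n k / 2 <= sin (y n k) by apply: sin_ge_half; rewrite ltW.
  have s0 : 0 < sin (y n k) by apply: lt_le_trans s2; lra.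
  rewrite ger0_norm; last by rewrite !mulr_ge0 ?invr_ge0 ?exprn_ge0 ?(ltW s0).
  have -> : g k = 2 * (4 ^+ n.+1)^-1 * ((y n k / 2) ^+ 2)^-1.
    have -> : 2 * (4 ^+ n.+1)^-1 * ((y n k / 2) ^+ 2)^-1 =
      8 * ((4 ^+ n.+1)^-1 * (y n k ^+ 2)^-1).
      by field; rewrite gt_eqF// expf_neq0.
    by rewrite E /g; ring.
  rewrite ler_wpM2l ?mulr_ge0 ?invr_ge0 ?exprn_ge0// lef_pV2 ?posrE ?exprn_gt0//; last lra.
  by rewrite lerXn2r ?nnegrE ?(ltW s0)//; lra.
have fS n : sums (f n) 1.
  have fin : 1 = \sum_(0 <= k < (2 ^ n)%N) f n k.
    have := @inv_sin2_sum n.+1 (pi / 2) _.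
    rewrite sin_pihalf expr1n invr1 => ->; last by apply/andP; split; lra.
    rewrite expnS mul2n (@sum_rev_half (fun k => (sin ((pi / 2 + k%:R * pi) / 2 ^+ n.+1) ^+ 2)^-1)).
      rewrite mulrCA mulrA mulr_sumr; apply: eq_big_nat => k /andP[_ kn].
      rewrite /f kn; congr (_ * (sin _ ^+ 2)^-1).
      by rewrite /y (exprS _ n.+1); field; rewrite expf_neq0.
    move=> k kn; congr (_^-1).
    have kn' : (k.+1 <= (2 ^ n).*2)%N by [].
    have -> : (pi / 2 + ((2 ^ n).*2 - k.+1)%:R * pi) / 2 ^+ n.+1 =
       - ((pi / 2 + k%:R * pi) / 2 ^+ n.+1) + pi :> R.
      rewrite natrB// -mul2n -expnS natrX -(natr1 k).
      by field; rewrite expf_neq0.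
    by rewrite sinDpi sinN opprK.
  rewrite fin; apply: cvg_near_cst; exists (2 ^ n)%N => // m /= nm.
  rewrite seriesE (@big_cat_nat _ _ _ (2 ^ n)%N)//= [X in _ + X](_ : _ = 0) ?addr0//.
  rewrite big_nat_cond big1//.
  by move=> i /andP[/andP[ni _] _]; rewrite /f ltnNge ni.
have [s sl _] : exists2 s, sums l s & `|s| <= 8 / pi ^+ 2 * S.
  by apply: sums_dominated (sumsZ (8 / pi ^+ 2) sS) => i; rewrite ger0_norm// /l
    !mulr_ge0 ?invr_ge0 ?exprn_ge0 ?(ltW p0) ?(ltW (odd0 i)).
have c1 := tannery fg (sumsZ (8 * 4 / pi ^+ 2) sS) fl fS sl.
have s1 : s = 1 by rewrite -(cvg_lim _ c1)// lim_cst.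
have := sumsZ (pi ^+ 2 / 8) sl; rewrite s1 mulr1; apply: eq_sums => k.
have o0 : 2 * k%:R + 1 != 0 :> R by rewrite gt_eqF.
by rewrite /l; move: (2 * k%:R + 1) o0 (pi : R) pn0 => o o0 q q0; field; rewrite o0 q0.
Qed.

(** Even-indexed terms contribute a quarter of the total, so S = pi^2 / 8 + S / 4. *)
Lemma basel : @sums R (fun i => (i.+1%:R ^+ 2)^-1) (pi ^+ 2 / 6).
Proof.
have [S sS _] := sums_inv_sqr R.
have so := sums_inv_odd_sqr.
have E n : series (fun i => (i.+1%:R ^+ 2)^-1 : R) n.*2 =
    series (fun k => ((2 * k%:R + 1) ^+ 2)^-1) n + 4^-1 * series (fun i => (i.+1%:R ^+ 2)^-1) n.
  rewrite !seriesE sum_even_odd mulr_sumr -big_split/=; apply: eq_bigr => i _.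
  congr (_ + _); first by rewrite -(natr1 i.*2) -mul2n natrM.
  by rewrite -doubleS -mul2n natrM exprMn invfM; congr (_ * _); rewrite -natrX.
have c1 : (fun n => series (fun i => (i.+1%:R ^+ 2)^-1 : R) n.*2) @ \oo --> S.
  apply: (@cvg_comp _ _ _ (fun n : nat => n.*2)); last exact: sS.
  move=> A [N _ HN]; exists N => // n /= Nn; apply: HN => /=.
  by rewrite -addnn (leq_trans Nn)// leq_addr.
have c2 : (fun n => series (fun i => (i.+1%:R ^+ 2)^-1 : R) n.*2) @ \oo --> pi ^+ 2 / 8 + 4^-1 * S.
  by under eq_fun do rewrite E; apply: cvgD; [exact: so|apply: cvgMr; exact: sS].
have SE : S = pi ^+ 2 / 8 + 4^-1 * S by apply: (cvg_unique _ c1 c2).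
by have -> : pi ^+ 2 / 6 = S by lra.
Qed.

End Basel.

(** * Stirling's constant from Wallis' integrals *)

Section Stirling.
Variable R : realType.
Implicit Types (x y : R).

(* Antiderivative of [cos ^ m] vanishing at 0: Wallis' integrals without integrals. *)
Fixpoint cos_prim (m : nat) x : R :=
  match m with
  | 0%N => x
  | 1%N => sin x
  | m'.+2 => (cos x ^+ m'.+1 * sin x + m'.+1%:R * cos_prim m' x) / m'.+2%:R
  end.

Lemma is_derive_cos_prim m x : is_derive x 1 (cos_prim m) (cos x ^+ m).
Proof.
elim/ltn_ind: m x => -[|[|m]] IH x; rewrite ?expr0 ?expr1.
- exact: is_derive_id.
- exact: is_derive_sin.
- have h := IH m _ x; have {}h := h (ltnW (ltnSn m.+1)).
  have d1 : is_derive x 1 (fun y => cos y ^+ m.+1) ((m.+1%:R * cos x ^+ m) * - sin x).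
    have := @is_derive1_comp R (fun z => z ^+ m.+1) cos x _ _ (is_derive_exprn m.+1 (cos x)) (is_derive_cos x).
    by [].
  have -> : cos_prim m.+2 = (fun y => (cos y ^+ m.+1 * sin y + m.+1%:R * cos_prim m y) * m.+2%:R^-1) by [].
  apply: is_derive_eq; rewrite /GRing.scale/= !exprS.
  have s2 : sin x * sin x = 1 - cos x * cos x by rewrite -!expr2 sin2cos2.
  have -> : sin x * (m.+1%:R * cos x ^+ m * - sin x) =
      - m.+1%:R * cos x ^+ m * (1 - cos x * cos x) by rewrite -s2; ring.
  have p1 : m.+1%:R + 1 != 0 :> R by rewrite natr1.
  by rewrite -(natr1 m.+1); field.
Qed.

Definition wallis m := cos_prim m (pi / 2).

Lemma cos_prim0 m : cos_prim m 0 = 0.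
Proof.
elim/ltn_ind: m => -[|[|m]] IH //=; first by rewrite sin0.
by rewrite sin0 IH ?ltnS ?leqnSn//; ring.
Qed.

Lemma wallis_decr m : wallis m.+1 <= wallis m.
Proof.
have p0 := pi_gt0 R.
have p2 : 0 <= pi / 2 :> R by lra.
pose f x := cos_prim m x - cos_prim m.+1 x.
have df x : is_derive x 1 f (cos x ^+ m - cos x ^+ m.+1).
  by apply: is_deriveB; exact: is_derive_cos_prim.
have := derive_ge0_le p2 (fun x _ => df x) _.
rewrite /f !cos_prim0 subr0 subr_ge0; apply => x xp.
have c0 : 0 <= cos x by apply: cos_ge0_pihalf; lra.
by rewrite subr_ge0 exprS ler_piMl ?exprn_ge0 ?cos_le1.
Qed.

Lemma wallisSS m : wallis m.+2 = m.+1%:R / m.+2%:R * wallis m.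
Proof. by rewrite /wallis/= cos_pihalf expr0n/= mul0r add0r mulrAC. Qed.

Lemma wallis_gt0 m : 0 < wallis m.
Proof.
elim/ltn_ind: m => -[|[|m]] IH.
- by rewrite /wallis/= divr_gt0 ?pi_gt0.
- by rewrite /wallis/= sin_pihalf.
- by rewrite wallisSS mulr_gt0 ?divr_gt0// IH.
Qed.

(** The product is independent of m by the two-step recursion. With monotonicity it pins [wallis m]
    down up to a factor tending to 1. *)
Lemma wallisM m : m.+1%:R * (wallis m * wallis m.+1) = pi / 2.
Proof.
elim: m => [|m IH]; first by rewrite /wallis/= sin_pihalf mulr1 mul1r.
by rewrite wallisSS -IH; field.
Qed.

Lemma wallis_bounds m : m%:R * wallis m ^+ 2 <= pi / 2 <= m.+1%:R * wallis m ^+ 2.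
Proof.
apply/andP; split.
  case: m => [|m]; first by rewrite mul0r divr_ge0 ?pi_ge0.
  rewrite -(wallisM m) expr2 ler_wpM2l// ler_wpM2r ?wallis_decr//.
  exact: ltW (wallis_gt0 _).
rewrite -(wallisM m) expr2 ler_wpM2l// ler_wpM2l ?wallis_decr//.
exact: ltW (wallis_gt0 _).
Qed.

(** The integral of ln over [i + 1, i + 2] minus its trapezoidal value. Partial sums are (n + 3 / 2)
    ln (n + 1) - n - ln (n + 1)!, so that Stirling's formula can be stated without factorials. *)
Definition stirling_term (i : nat) : R :=
  (i.+1%:R + 2^-1) * (ln i.+2%:R - ln i.+1%:R) - 1.

(** With N = m + 1, [wallis] at 2 N is (pi / 2) (2 N)! / (4^N N!^2); the two partial sums stand for
    the logarithms of (2 N)! and of N!. *)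
Lemma ln_wallis m : ln (wallis m.+1.*2) = ln (pi / 2) + 2^-1 * ln 2 - 2^-1 * ln m.+1%:R - 1
  - series stirling_term m.*2.+1 + 2 * series stirling_term m.
Proof.
have p2 : 0 < pi / 2 :> R by rewrite divr_gt0 ?pi_gt0.
have sS n : series stirling_term n.+1 = series stirling_term n + stirling_term n.
  by rewrite !seriesE big_nat_recr.
elim: m => [|m IH].
  have -> : wallis 1.*2 = 2^-1 * wallis 0 by rewrite (wallisSS 0) mul1r.
  rewrite [ln (_ * wallis _)]lnM ?posrE ?invr_gt0 ?wallis_gt0// lnV ?posrE//.
  rewrite !seriesE big_nil big_nat1 /stirling_term ln1 /wallis/=.
  by lra.
have d2 n : n.*2.+2%:R = 2 * n.+1%:R :> R by rewrite -doubleS -mul2n natrM.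
have ld2 n : ln (n.*2.+2%:R : R) = ln 2 + ln n.+1%:R by rewrite d2 lnM ?posrE.
have d3 : m.*2.+3%:R = 2 * m.+1%:R + 1 :> R by rewrite -natr1 d2.
have E : wallis m.+2.*2 = m.*2.+3%:R / m.*2.+4%:R * wallis m.+1.*2.
  by rewrite -wallisSS.
have p3 : 0 < m.*2.+3%:R / m.*2.+4%:R :> R by rewrite divr_gt0.
have d4 : m.*2.+4%:R = 2 * m.+2%:R :> R by rewrite -doubleS d2.
have ld4 : ln (m.*2.+4%:R : R) = ln 2 + ln m.+2%:R by rewrite d4 lnM ?posrE.
have w0 := wallis_gt0 m.+1.*2.
have -> : ln (wallis m.+2.*2) = ln m.*2.+3%:R - ln m.*2.+4%:R + ln (wallis m.+1.*2).
  by rewrite E lnM ?posrE// ln_div ?posrE.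
rewrite IH doubleS (sS m.*2.+2) (sS m.*2.+1) (sS m) /stirling_term ld4 ld2 d3 d2 -(natr1 m).
move: (series _ _) (series _ _) (ln _) (ln _) (ln _) (ln _) => u v w x y z.
lra.
Qed.

(** Interpolating with [h t] on [0, 1], the derivative is half of ln (x + t) - ln x - t / (x + t),
    which lies between 0 and x^-2. *)
Lemma ln_add1_bounds x : 0 < x -> 0 <= (x + 2^-1) * (ln (x + 1) - ln x) - 1 <= (2 * x ^+ 2)^-1.
Proof.
move=> x0; pose h t := (x + t / 2) * (ln (x + t) - ln x) - t.
have dh (t : R) : 0 <= t <= 1 -> is_derive t 1 h (2^-1 * (ln (x + t) - ln x - t / (x + t))).
  move=> /andP[t0 _]; have xt : 0 < x + t by lra.
  have dl : is_derive t 1 (fun z : R => ln (x + z)) ((x + t)^-1 * 1).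
    apply: (@is_derive_ln_comp _ (fun z => x + z)) => //.
    by apply: is_derive_eq; lra.
  rewrite /h; apply: is_derive_eq; rewrite /GRing.scale/=.
  by field; rewrite gt_eqF.
have bd (t : R) : 0 <= t <= 1 -> 0 <= ln (x + t) - ln x - t / (x + t) <= (x ^+ 2)^-1.
  move=> /andP[t0 t1]; have xt : 0 < x + t by lra.
  have E1 : ln (x + t) - ln x = ln (1 + t / x).
    by rewrite -ln_div ?posrE//; congr ln; field; rewrite gt_eqF.
  have E2 : ln (x + t) - ln x = - ln (1 + - (t / (x + t))).
    rewrite -[LHS]opprB -ln_div ?posrE//; congr (- ln _); field; rewrite gt_eqF//.
  have tx : t / (x + t) < 1 by rewrite ltr_pdivrMr// mul1r; lra.
  have tx0 : 0 <= t / x by rewrite divr_ge0// ltW.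
  have l1 := @le_ln1Dx R (t / x); have l2 := @le_ln1Dx R (- (t / (x + t))).
  apply/andP; split; first by rewrite E2; have := l2 ltac:(lra); lra.
  have : ln (x + t) - ln x <= t / x by rewrite E1 l1//; lra.
  suff : t / x - t / (x + t) <= (x ^+ 2)^-1 by lra.
  have -> : t / x - t / (x + t) = t ^+ 2 / (x * (x + t)).
    by field; rewrite !gt_eqF.
  rewrite ler_pdivrMr ?mulr_gt0// mulrC expr2 invfM mulrA.
  have -> : x * (x + t) / x / x = 1 + t / x by field; rewrite gt_eqF.
  by nra.
have [c c01 E] := @MVT_closed _ h _ 0 1 ler01 dh.
have -> : (x + 2^-1) * (ln (x + 1) - ln x) - 1 = h 1 - h 0.
  by rewrite /h addr0 subrr mulr0 mul1r subr0 subr0.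
rewrite E invfM; have := bd c c01; lra.
Qed.

(** The sum [s] exists by domination. Letting m tend to infinity in [ln_wallis], where
    [wallis_bounds] gives the left side, yields a linear equation for [s]. *)
Lemma sums_stirling : sums stirling_term (1 - 2^-1 * ln (2 * pi)).
Proof.
have bd i : 0 <= stirling_term i <= 2^-1 * (i.+1%:R ^+ 2)^-1.
  have := @ln_add1_bounds i.+1%:R; rewrite natr1 invfM; exact.
have [S sS _] := sums_inv_sqr R.
have [s ss _] : exists2 s, sums stirling_term s & `|s| <= 2^-1 * S.
  apply: sums_dominated (sumsZ 2^-1 sS) => i.
  by have /andP[h1 h2] := bd i; rewrite ger0_norm.
suff : ln (pi / 2) = 2 * ln (pi / 2) + 2 * ln 2 - 2 + 2 * s :> R.
  have p0 := pi_gt0 R; rewrite !lnM ?posrE ?invr_gt0// lnV ?posrE// => E.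
  have -> : 1 - 2^-1 * (ln 2 + ln pi) = s :> R by lra.
  exact: ss.
have c1 : (fun m => series stirling_term m.*2.+1) @ \oo --> s.
  apply: (@cvg_comp _ _ _ (fun n : nat => n.*2.+1)); last exact: ss.
  move=> A [N _ HN]; exists N => // n /= Nn; apply: HN => /=.
  by rewrite -addnn ltnW// ltnS (leq_trans Nn)// leq_addr.
have E m : 2 * ln (wallis m.+1.*2) + ln m.+1%:R + ln 2 =
   2 * ln (pi / 2) + 2 * ln 2 - 2 - 2 * series stirling_term m.*2.+1 + 4 * series stirling_term m.
  by rewrite ln_wallis; lra.
have cR : (fun m => 2 * ln (wallis m.+1.*2) + ln m.+1%:R + ln 2) @ \oo -->
    2 * ln (pi / 2) + 2 * ln 2 - 2 - 2 * s + 4 * s.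
  rewrite (funext E); apply: cvgD; last by apply: cvgMr; exact: ss.
  by apply: cvgB; [exact: cvg_cst|apply: cvgMr].
have cL : (fun m => 2 * ln (wallis m.+1.*2) + ln m.+1%:R + ln 2) @ \oo --> ln (pi / 2 : R).
  apply: cvg_dist0; apply: (@cvg0_le _ _ (fun m => m.+1%:R^-1)); last exact: cvg_harmonic.
  move=> m; have := wallis_bounds m.+1.*2; have w0 := wallis_gt0 m.+1.*2.
  set w := wallis _ in w0 *; have m0 : 0 < m.+1%:R :> R by [].
  rewrite -(natr1 m.+1.*2) -mul2n natrM => /andP[h1 h2].
  have E2 : 2 * ln w + ln m.+1%:R + ln 2 = ln (2 * m.+1%:R * w ^+ 2).
    have lw : ln (w ^+ 2) = 2 * ln w by rewrite lnXn// mulr_natl.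
    have -> : ln (2 * m.+1%:R * w ^+ 2) = ln (2 * m.+1%:R) + ln (w ^+ 2).
      by apply: lnM; rewrite posrE// exprn_gt0.
    by rewrite lw lnM ?posrE//; lra.
  have p2 : 0 < pi / 2 :> R by rewrite divr_gt0 ?pi_gt0.
  have i0 : 0 < (2 * m.+1%:R)^-1 :> R by rewrite invr_gt0 mulr_gt0.
  have A0 : 0 < 2 * m.+1%:R * w ^+ 2 by apply: mulr_gt0; [exact: mulr_gt0|exact: exprn_gt0].
  have EB : (2 * m.+1%:R + 1) * w ^+ 2 = (1 + (2 * m.+1%:R)^-1) * (2 * m.+1%:R * w ^+ 2).
    by field; rewrite gt_eqF.
  rewrite {}EB in h2; move: A0 E2 h1 h2; set A := 2 * m.+1%:R * w ^+ 2 => A0 E2 h1 h2.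
  have l1 : ln A <= ln (pi / 2) by rewrite ler_ln.
  have l2 : ln (pi / 2) <= ln (1 + (2 * m.+1%:R)^-1) + ln A.
    by rewrite -lnM ?posrE ?ler_ln ?posrE ?addr_gt0// mulr_gt0// addr_gt0.
  have l3 : ln (1 + (2 * m.+1%:R)^-1) <= (2 * m.+1%:R)^-1 :> R.
    by apply: le_ln1Dx; apply: lt_trans i0; rewrite ltrN10.
  have l4 : (2 * m.+1%:R)^-1 <= m.+1%:R^-1 :> R.
    by rewrite lef_pV2 ?posrE ?mulr_gt0// ler_peMl// ler1n.
  rewrite E2 distrC ger0_norm ?subr_ge0// lerBlDr (le_trans l2)// lerD2r.
  exact: le_trans l4.
have H : ln (pi / 2) = 2 * ln (pi / 2) + 2 * ln 2 - 2 - 2 * s + 4 * s.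
  exact: (cvg_unique _ cL cR).
by lra.
Qed.

End Stirling.

(** * The dilogarithm and its regular part at 0 *)

Section BoseSum.
Variable R : realType.
Implicit Types (x y : R).

(** The dilogarithm Li_2 at e^(-x), an antiderivative of [- bose_log]. *)
Definition dilog x : R := limn (series (fun i => (i.+1%:R ^+ 2)^-1 * expR (- x * i.+1%:R))).

Lemma dilog_term_le x i : 0 <= x ->
  `|(i.+1%:R ^+ 2)^-1 * expR (- x * i.+1%:R)| <= (i.+1%:R ^+ 2)^-1.
Proof.
move=> x0; have i0 : 0 <= (i.+1%:R ^+ 2)^-1 :> R by rewrite invr_ge0 exprn_ge0.
rewrite ger0_norm ?mulr_ge0 ?expR_ge0// ler_piMr//.
by rewrite -expR0 ler_expR mulNr oppr_le0 mulr_ge0.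
Qed.

Lemma sums_dilog x : 0 <= x ->
  sums (fun i => (i.+1%:R ^+ 2)^-1 * expR (- x * i.+1%:R)) (dilog x).
Proof.
move=> x0; have [s ss _] := sums_dominated (fun i => dilog_term_le i x0) (@basel R).
by apply: sums_cvg; apply/cvg_ex; exists s.
Qed.

Lemma dilog_cvg0 (u : nat -> R) : (forall k, 0 <= u k) -> u @ \oo --> 0 ->
  (fun k => dilog (u k)) @ \oo --> pi ^+ 2 / 6.
Proof.
move=> u0 cu; apply: (tannery (fun k i => dilog_term_le i (u0 k)) (@basel R) _
  (fun k => sums_dilog (u0 k)) (@basel R)) => i.
rewrite -[X in _ --> X]mulr1; apply: cvgMr; rewrite -[X in _ --> X]expR0.
apply: continuous_cvg; first exact: continuous_expR.
rewrite -(mul0r i.+1%:R) -(oppr0 R); apply: cvgMl; exact: cvgN.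
Qed.

Lemma is_derive_dilog x : 0 < x -> is_derive x 1 dilog (- bose_log x).
Proof.
move=> x0; have c0 : 0 < x / 2 by rewrite divr_gt0.
have cx : x / 2 < x by lra.
have H := @termwise_derive R (fun i y => (i.+1%:R ^+ 2)^-1 * expR (- y * i.+1%:R))
   (fun i y => - (i.+1%:R^-1 * expR (- y * i.+1%:R))) dilog
   (fun i => i.+1%:R^-1 * expR (- (x / 2) * i.+1%:R)) _ _ x _ cx.
apply: H.
- move=> i y _; apply: is_derive_eq; rewrite /GRing.scale/=.
  have i0 : i.+1%:R != 0 :> R by [].
  by move: (i.+1%:R : R) i0 => w w0; field.
- move=> i y cy; rewrite normrN ger0_norm ?mulr_ge0 ?invr_ge0 ?expR_ge0//.
  by rewrite ler_wpM2l ?invr_ge0// ler_expR ler_wpM2r// lerN2 ltW.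
- exact: sums_bose_log c0.
- by move=> y cy; apply: sums_dilog; apply: ltW; exact: lt_trans cy.
- have := sumsZ (-1) (sums_bose_log x0); rewrite mulN1r; apply: eq_sums => i.
  by rewrite mulN1r.
Qed.

Lemma bose_log_bounds x : 0 < x -> 0 <= bose_log x + ln x <= x.
Proof.
move=> x0; have q1 := subr_expRN_gt0 x0.
have h1 := subr_expRN_le x; have h2 := le_mul_subr_expRN x0.
rewrite /bose_log addrC subr_ge0 ler_ln ?posrE// h1/=.
have : ln x <= ln ((1 + x) * (1 - expR (- x))) by rewrite ler_ln ?posrE ?mulr_gt0//; lra.
rewrite lnM ?posrE//; last lra.
have := @le_ln1Dx R x; lra.
Qed.

(** The dilogarithm without its singular part x ln x - x: its derivative is minus
    [bose_log x + ln x], which tends to 0 with x. *)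
Definition dilog_reg x := dilog x + x - x * ln x.

Lemma dilog_reg_dist x y : 0 < x -> x <= y -> `|dilog_reg y - dilog_reg x| <= y * (y - x).
Proof.
move=> x0 xy; have dh (z : R) : x <= z <= y -> is_derive z 1 dilog_reg (- (bose_log z + ln z)).
  move=> /andP[xz _]; have z0 : 0 < z := lt_le_trans x0 xz.
  have d1 := is_derive_dilog z0; have d2 := is_derive1_ln z0.
  rewrite /dilog_reg; apply: is_derive_eq; rewrite /GRing.scale/=.
  by field; rewrite gt_eqF.
have [c /andP[xc cy] ->] := MVT_closed xy dh.
have /andP[b1 b2] := bose_log_bounds (lt_le_trans x0 xc).
rewrite normrM normrN !ger0_norm ?subr_ge0// ler_wpM2r ?subr_ge0//.
exact: le_trans cy.
Qed.

(** [dilog_reg_dist] needs a positive left end, so it is applied from e^(-k) to x and k is sent to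
    infinity. *)
Lemma dilog_expand x : 0 < x -> `|dilog_reg x - pi ^+ 2 / 6| <= x ^+ 2.
Proof.
move=> x0; pose u (k : nat) : R := expR (- 1) ^+ k.
have uE k : u k = expR (- k%:R) by rewrite /u -expRNM_nat mulN1r.
have u0 k : 0 < u k by rewrite uE expR_gt0.
have cu : u @ \oo --> 0.
  have := exprn_expRN_cvg0 0 (@ltr01 R); apply: cvg_trans; apply: near_eq_cvg.
  by apply: nearW => k; rewrite expr0 mul1r.
have cu' : (fun k => u k * ln (u k)) @ \oo --> 0.
  have := exprn_expRN_cvg0 1 (@ltr01 R) => /cvgN; rewrite oppr0.
  apply: cvg_trans; apply: near_eq_cvg.
  by apply: nearW => k; rewrite /= -[LHS]/(- (k%:R ^+ 1 * u k)) expr1 [X in ln X]uE expRK; ring.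
have cd : (fun k => dilog_reg (u k)) @ \oo --> pi ^+ 2 / 6.
  rewrite -[X in _ --> X]subr0; apply: cvgB => //.
  rewrite -[X in _ --> X]addr0; apply: cvgD => //.
  by apply: dilog_cvg0 => // k; exact: ltW.
have c1 : (fun k => `|dilog_reg x - dilog_reg (u k)|) @ \oo --> `|dilog_reg x - pi ^+ 2 / 6|.
  by apply: cvg_norm; apply: cvgB => //; exact: cvg_cst.
apply: (ler_cvg_to c1 (cvg_cst (x ^+ 2))).
have : \forall k \near \oo, u k < x by apply: (cvgr_lt 0 cu).
apply: filterS => k /ltW ux; apply: le_trans (dilog_reg_dist (u0 k) ux) _.
by rewrite expr2 ler_wpM2l ?(ltW x0)// gerBl ltW.
Qed.

(* The trapezoid error of [bose_log], which is convex, on [[x, x + h]]. *)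
Lemma trapezoid_bounds x (h : R) : 0 < x -> 0 <= h ->
  0 <= h * (bose_log x + bose_log (x + h)) / 2 - (dilog x - dilog (x + h))
    <= h ^+ 3 / (2 * x ^+ 2).
Proof.
move=> x0 h0.
pose f (t : R) := t * (bose_log x + bose_log (x + t)) / 2 - (dilog x - dilog (x + t)).
have df (t : R) : 0 <= t <= h -> is_derive t 1 f
    (2^-1 * (bose_log x - bose_log (x + t) - t * bose0 (x + t))).
  move=> /andP[t0 _]; have xt : 0 < x + t by lra.
  have da : is_derive t 1 (fun z : R => x + z) 1 by apply: is_derive_eq; lra.
  have d1 := @is_derive1_comp R (@bose_log R) (fun z => x + z) t _ _ (is_derive_bose_log xt) da.
  have d2 := @is_derive1_comp R dilog (fun z => x + z) t _ _ (is_derive_dilog xt) da.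
  rewrite /f; apply: is_derive_eq; rewrite /GRing.scale/=.
  by field.
have bd (t : R) : 0 <= t <= h ->
    0 <= bose_log x - bose_log (x + t) - t * bose0 (x + t) <= t ^+ 2 / x ^+ 2.
  move=> /andP[t0 _]; have xxt : x <= x + t by lra.
  have [c /andP[xc cx]] := @MVT_closed _ (@bose_log R) (fun z => - bose0 z) x (x + t) xxt
    (fun z zx => is_derive_bose_log (lt_le_trans x0 (proj1 (andP zx)))).
  rewrite (_ : x + t - x = t); last by ring.
  move=> E; have -> : bose_log x - bose_log (x + t) = t * bose0 c by lra.
  rewrite -mulrBr; have c0 : 0 < c := lt_le_trans x0 xc.
  have [d /andP[cd dx]] := @MVT_closed _ (@bose0 R) (fun z => - bose1 z) c (x + t) cx
    (fun z zx => is_derive_bose0 (lt_le_trans c0 (proj1 (andP zx)))).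
  move=> E2; have -> : bose0 c - bose0 (x + t) = bose1 d * (x + t - c) by lra.
  have d0 : 0 < d := lt_le_trans c0 cd.
  have [_ b1 _] := bose_gt0 d0.
  apply/andP; split.
    by apply: mulr_ge0 => //; apply: mulr_ge0; [exact: ltW|rewrite subr_ge0].
  have b2 : bose1 d <= (x ^+ 2)^-1.
    have /andP[b2 _] := bose1_bounds d0; move: b2; rewrite subr_ge0 => /le_trans; apply.
    by rewrite lef_pV2 ?posrE ?exprn_gt0// lerXn2r ?nnegrE ?(ltW x0) ?(ltW d0)// (le_trans xc).
  rewrite expr2 -mulrA ler_wpM2l// mulrC ler_pM ?subr_ge0 ?(ltW b1)//; lra.
have [c /andP[c0 ch]] := MVT_closed h0 df.
rewrite /f addr0 subrr mul0r mul0r !subr0 => ->.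
have /andP[b1 b2] := bd c ltac:(by rewrite c0).
rewrite !mulr_ge0//=; have x2 : 0 < x ^+ 2 by rewrite exprn_gt0.
have : c ^+ 2 / x ^+ 2 <= h ^+ 2 / x ^+ 2.
  by rewrite ler_wpM2r ?invr_ge0 ?(ltW x2)// lerXn2r.
move=> b3; have -> : h ^+ 3 / (2 * x ^+ 2) = 2^-1 * (h ^+ 2 / x ^+ 2) * h.
  by field; rewrite gt_eqF.
by rewrite ler_wpM2r// ler_wpM2l//; lra.
Qed.

End BoseSum.

(** * The Euler product carried by the parts of the second axis *)

Section EtaAsymptotics.
Variable R : realType.
Implicit Types (x y b : R).

Lemma bose_log_le x : 0 < x -> 0 <= bose_log x <= bose0 x.
Proof.
move=> x0; have i1 i : 0 <= (i.+1%:R^-1 : R) <= 1.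
  by rewrite invr_ge0 ler0n/= invf_le1// ler1n.
have s0 := sums_bose0 x0.
rewrite (sums_ge0 (sums_bose_log x0)) => [|i]; last by rewrite mulr_ge0 ?expR_ge0// (andP (i1 i)).1.
apply: (le_sums (sums_bose_log x0) s0) => i.
by rewrite ler_piMl ?expR_ge0// (andP (i1 i)).2.
Qed.

Lemma dilog_le x : 0 < x -> 0 <= dilog x <= bose_log x.
Proof.
move=> x0; have sd := sums_dilog (ltW x0).
rewrite (sums_ge0 sd) => [|i]; last by rewrite mulr_ge0 ?expR_ge0// invr_ge0 exprn_ge0.
apply: (le_sums sd (sums_bose_log x0)) => i.
rewrite ler_wpM2r ?expR_ge0// lef_pV2 ?posrE ?exprn_gt0//.
by rewrite expr2 ler_peMl// ler1n.
Qed.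

(** Minus the logarithm of the product of the 1 - e^(- b i) over i >= 1, that is, the log-weight of
    the parts (0, i). *)
Definition eta_log b : R := limn (series (fun i => bose_log (b * i.+1%:R))).

Lemma sums_eta_log b : 0 < b -> sums (fun i => bose_log (b * i.+1%:R)) (eta_log b).
Proof.
move=> b0; have [K _ HK] := sums_bose2_dominated 0 b0.
have [|s ss _] := HK b (fun i => bose_log (b * i.+1%:R)) (lexx b).
  move=> i; rewrite expr0 mul1r; have bi : 0 < b * i.+1%:R by rewrite mulr_gt0.
  have /andP[l0 l1] := bose_log_le bi; have [_ h1 h2] := bose_le bi.
  by rewrite ger0_norm// (le_trans l1)// (le_trans h1).
by apply: sums_cvg; apply/cvg_ex; exists s.
Qed.

(** Trapezoidal error of [bose_log] on [b (i + 1), b (i + 2)], divided by [b]; the integral is a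
    difference of dilogarithms. *)
Definition trapezoid b (i : nat) : R :=
  b^-1 * (b * (bose_log (b * i.+1%:R) + bose_log (b * i.+2%:R)) / 2 -
   (dilog (b * i.+1%:R) - dilog (b * i.+2%:R))).

Lemma trapezoid_le b i : 0 < b -> `|trapezoid b i| <= (i.+1%:R ^+ 2)^-1.
Proof.
move=> b0; have bi : 0 < b * i.+1%:R by rewrite mulr_gt0.
have /andP[h1 h2] := trapezoid_bounds bi (ltW b0).
have E : b * i.+1%:R + b = b * i.+2%:R by rewrite -(natr1 i.+1); ring.
rewrite E in h1 h2; rewrite /trapezoid ger0_norm ?mulr_ge0 ?invr_ge0 ?(ltW b0)//.
apply: (@le_trans _ _ (b^-1 * (b ^+ 3 / (2 * (b * i.+1%:R) ^+ 2)))).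
  by rewrite ler_wpM2l// invr_ge0 ltW.
have -> : b^-1 * (b ^+ 3 / (2 * (b * i.+1%:R) ^+ 2)) = 2^-1 * (i.+1%:R ^+ 2)^-1.
  have i0 : i.+1%:R != 0 :> R by [].
  by move: (i.+1%:R : R) i0 => w w0; field; rewrite w0 gt_eqF.
by rewrite ler_piMl ?invr_ge0 ?exprn_ge0//; lra.
Qed.

(** Near 0 [bose_log] is - ln up to O (x). The trapezoidal error of - ln does not change when the
    variable is rescaled, which makes [stirling_term] the limit as [b] tends to 0. *)
Lemma trapezoid_expand b i : 0 < b ->
  `|trapezoid b i - stirling_term R i| <= 2 * i.+2%:R * b.
Proof.
move=> b0; have bi : 0 < b * i.+1%:R by rewrite mulr_gt0.
have bi2 : 0 < b * i.+2%:R by rewrite mulr_gt0.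
have E : b * i.+2%:R = b * i.+1%:R + b by rewrite -(natr1 i.+1); ring.
have le2 : b * i.+1%:R <= b * i.+2%:R by rewrite E; lra.
have /andP[a10 a11] := bose_log_bounds bi; have /andP[a20 a21] := bose_log_bounds bi2.
have d := dilog_reg_dist bi le2.
have l1 : ln (b * i.+1%:R) = ln b + ln i.+1%:R by rewrite lnM ?posrE.
have l2 : ln (b * i.+2%:R) = ln b + ln i.+2%:R by rewrite lnM ?posrE.
have -> : trapezoid b i - stirling_term R i =
  ((bose_log (b * i.+1%:R) + ln (b * i.+1%:R)) + (bose_log (b * i.+2%:R) + ln (b * i.+2%:R))) / 2
   + (dilog_reg (b * i.+2%:R) - dilog_reg (b * i.+1%:R)) / b.
  rewrite /trapezoid /stirling_term /dilog_reg l1 l2 -(natr1 i.+1).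
  move: (ln b) (ln _) (ln _) (dilog _) (dilog _) (bose_log _) (bose_log _) => u1 u2 u3 u4 u5 u6 u7.
  by field; rewrite gt_eqF.
move: d; have -> : b * i.+2%:R - b * i.+1%:R = b by rewrite E; ring.
move=> d.
have d' : `|(dilog_reg (b * i.+2%:R) - dilog_reg (b * i.+1%:R)) / b| <= b * i.+2%:R.
  by rewrite normrM (@ger0_norm _ b^-1) ?invr_ge0 ?(ltW b0)// ler_pdivrMr.
apply: le_trans (ler_normD _ _) _.
rewrite [leRHS](_ : _ = b * i.+2%:R + b * i.+2%:R); last by ring.
apply: lerD => //; rewrite ger0_norm; lra.
Qed.

(** The integrals telescope to [dilog b], and the trapezoidal rule counts the first endpoint with
    half weight. *)
Lemma sums_trapezoid b : 0 < b ->
  sums (trapezoid b) (eta_log b - 2^-1 * bose_log b - b^-1 * dilog b).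
Proof.
move=> b0; have se := sums_eta_log b0.
have bi i : 0 < b * i.+1%:R by rewrite mulr_gt0.
have cF : (fun i => bose_log (b * i.+1%:R)) @ \oo --> 0.
  by apply: cvg_series_cvg_0; apply/cvg_ex; exists (eta_log b).
have cG : (fun i => dilog (b * i.+1%:R)) @ \oo --> 0.
  apply: (cvg0_le _ cF) => i; have /andP[d0 d1] := dilog_le (bi i).
  by rewrite ger0_norm.
have sF := sums_telescope cF; have sG := sums_telescope cG.
rewrite mulr1 in sF sG.
apply: eq_sums (sumsB (sumsB se (sumsZ 2^-1 sF)) (sumsZ b^-1 sG)) => i.
by rewrite /trapezoid; field; rewrite gt_eqF.
Qed.

(** [tannery] carries the sum of the trapezoidal errors to Stirling's constant. The boundary terms
    [bose_log b / 2] and [dilog b / b] are then expanded at 0: the latter brings pi^2 / (6 b) and a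
    constant - 1 that cancels the 1 of [sums_stirling]. *)
Lemma eta_log_asymp (b : nat -> R) : (forall k, 0 < b k) -> b @ \oo --> 0 ->
  (fun k => eta_log (b k) -
     (pi ^+ 2 / 6 / b k + 2^-1 * ln (b k) - 2^-1 * ln (2 * pi))) @ \oo --> 0.
Proof.
move=> b0 cb.
have c1 : (fun k => eta_log (b k) - 2^-1 * bose_log (b k) - (b k)^-1 * dilog (b k))
    @ \oo --> 1 - 2^-1 * ln (2 * pi).
  apply: (tannery (fun k i => trapezoid_le i (b0 k)) (@basel R) _
    (fun k => sums_trapezoid (b0 k)) (@sums_stirling R)) => i.
  apply: cvg_dist0; apply: (cvg0_le (fun k => trapezoid_expand i (b0 k))).
  by rewrite -(mulr0 (2 * i.+2%:R)); apply: cvgMr.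
(* Error made in replacing both boundary terms by their expansions; each contribution is at most
   [b k]. *)
have c2 : (fun k => 2^-1 * (bose_log (b k) + ln (b k)) +
    (dilog_reg (b k) - pi ^+ 2 / 6) / b k) @ \oo --> 0.
  apply: (@cvg0_le _ _ (fun k => 2 * b k)); last by rewrite -(mulr0 2); apply: cvgMr.
  move=> k; have /andP[a1 a2] := bose_log_bounds (b0 k).
  have d : `|(dilog_reg (b k) - pi ^+ 2 / 6) / b k| <= b k.
    rewrite normrM (@ger0_norm _ (b k)^-1) ?invr_ge0 ?(ltW (b0 k))// ler_pdivrMr//.
    by rewrite -expr2; exact: dilog_expand.
  apply: le_trans (ler_normD _ _) _; rewrite ger0_norm; last lra.
  by have := b0 k; lra.
have H : (fun k => eta_log (b k) - 2^-1 * bose_log (b k) - (b k)^-1 * dilog (b k)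
    - (1 - 2^-1 * ln (2 * pi)) + (2^-1 * (bose_log (b k) + ln (b k)) +
    (dilog_reg (b k) - pi ^+ 2 / 6) / b k)) @ \oo -->
    1 - 2^-1 * ln (2 * pi) - (1 - 2^-1 * ln (2 * pi)) + 0.
  by apply: cvgD => //; apply: cvgB => //; exact: cvg_cst.
rewrite subrr addr0 in H; apply: eq_cvgn H => k.
rewrite /dilog_reg; have := b0 k.
move: (b k) (pi ^+ 2 / 6) (ln (2 * pi)) (ln (b k)) (eta_log _) (dilog _) (bose_log _).
by move=> u1 u2 u3 u4 u5 u6 u7 u10; field; rewrite gt_eqF.
Qed.

End EtaAsymptotics.

(** * The contribution of a single part *)

Section TaylorBounds.
Variable R : realType.
Implicit Types (x y : R).

Lemma subr_cos_ge0 x : 0 <= 1 - cos x :> R.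
Proof. by rewrite subr_ge0 cos_le1. Qed.

Lemma subr_sin_bounds x : 0 <= x -> 0 <= x - sin x <= x ^+ 2 / 2.
Proof.
move=> x0; have d1 (z : R) : is_derive z 1 (fun y : R => y - sin y) (1 - cos z).
  by apply: is_derive_eq.
have d2 (z : R) : is_derive z 1 (fun y : R => y - 1 + cos y) (1 - sin z).
  by apply: is_derive_eq; rewrite /GRing.scale/=; ring.
have d3 (z : R) : is_derive z 1 (fun y : R => y ^+ 2 / 2 - (y - sin y)) (z - (1 - cos z)).
  by apply: is_derive_eq; rewrite /GRing.scale/= ?expr1; field.
have h2 (z : R) : 0 <= z -> 1 - cos z <= z.
  move=> z0; have := derive_ge0_le z0 (fun y _ => d2 y).
  rewrite cos0 sub0r addNr => h.
  suff : 0 <= z - 1 + cos z by lra.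
  by apply: h => y _; rewrite subr_ge0 sin_le1.
apply/andP; split.
  have := derive_ge0_le x0 (fun y _ => d1 y); rewrite sin0 subr0; apply => y _.
  exact: subr_cos_ge0.
have := derive_ge0_le x0 (fun y _ => d3 y).
rewrite sin0 expr0n/= mul0r !subr0 subr_ge0; apply => y /andP[y0 _].
by rewrite subr_ge0 h2.
Qed.

Lemma subr_cos_bounds x : 0 <= x -> 0 <= x ^+ 2 / 2 - (1 - cos x) <= x ^+ 3 / 6.
Proof.
move=> x0.
have d1 (z : R) : is_derive z 1 (fun y : R => y ^+ 2 / 2 - (1 - cos y)) (z - sin z).
  by apply: is_derive_eq; rewrite /GRing.scale/= ?expr1; field.
have d2 (z : R) : is_derive z 1 (fun y : R => y ^+ 3 / 6 - (y ^+ 2 / 2 - (1 - cos y)))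
    (z ^+ 2 / 2 - (z - sin z)).
  by apply: is_derive_eq; rewrite /GRing.scale/= ?expr1; field.
apply/andP; split.
  have := derive_ge0_le x0 (fun y _ => d1 y).
  rewrite cos0 expr0n/= mul0r subrr subr0; apply => y /andP[y0 _].
  by case/andP: (subr_sin_bounds y0).
have := derive_ge0_le x0 (fun y _ => d2 y).
rewrite cos0 !expr0n/= !mul0r !subrr subr_ge0; apply => y /andP[y0 _].
by rewrite subr_ge0; case/andP: (subr_sin_bounds y0).
Qed.

Lemma cos_norm x : cos `|x| = cos x.
Proof. by case: (ger0P x) => _; rewrite ?cosN. Qed.

Lemma subr_cos_norm_bounds x : 0 <= x ^+ 2 / 2 - (1 - cos x) <= `|x| ^+ 3 / 6.
Proof. by have := subr_cos_bounds (normr_ge0 x); rewrite cos_norm real_normK ?num_real. Qed.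

Lemma subr_sin_norm_bound x : `|sin x - x| <= `|x| ^+ 3 / 6.
Proof.
wlog x0 : x / 0 <= x.
  move=> H; have [/H//|/ltW x0] := leP 0 x.
  have := H (- x); rewrite sinN -opprD !normrN oppr_ge0; exact.
have d1 (z : R) : is_derive z 1 (fun y : R => y ^+ 3 / 6 - (y - sin y))
    (z ^+ 2 / 2 - (1 - cos z)).
  by apply: is_derive_eq; rewrite /GRing.scale/= ?expr1; field.
rewrite distrC ger0_norm; last by case/andP: (subr_sin_bounds x0).
rewrite ger0_norm//; have := derive_ge0_le x0 (fun y _ => d1 y).
rewrite sin0 expr0n/= mul0r !subrr subr_ge0; apply => y /andP[y0 _].
by case/andP: (subr_cos_bounds y0).
Qed.

Lemma atan_norm_bound x : `|atan x - x| <= `|x| ^+ 3 / 3.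
Proof.
wlog x0 : x / 0 <= x.
  move=> H; have [/H//|/ltW x0] := leP 0 x.
  have := H (- x); rewrite atanN -opprD !normrN oppr_ge0; exact.
have d1 (z : R) : is_derive z 1 (fun y : R => y - atan y) (1 - (1 + z ^+ 2)^-1).
  by apply: is_derive_eq.
have d2 (z : R) : is_derive z 1 (fun y : R => y ^+ 3 / 3 - (y - atan y))
    (z ^+ 2 - (1 - (1 + z ^+ 2)^-1)).
  by apply: is_derive_eq; rewrite /GRing.scale/= ?expr1; field; rewrite gt_eqF// ltr_pwDl// sqr_ge0.
have i1 (z : R) : 0 < 1 + z ^+ 2 by rewrite ltr_pwDl// sqr_ge0.
have E (z : R) : 1 - (1 + z ^+ 2)^-1 = z ^+ 2 / (1 + z ^+ 2) by field; rewrite gt_eqF.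
have h1 : 0 <= x - atan x.
  have := derive_ge0_le x0 (fun y _ => d1 y); rewrite atan0 subr0; apply => y _.
  by rewrite E divr_ge0 ?sqr_ge0 ?(ltW (i1 _)).
rewrite distrC (ger0_norm h1) ger0_norm//.
have := derive_ge0_le x0 (fun y _ => d2 y).
rewrite atan0 expr0n/= mul0r !subrr subr_ge0; apply => y _.
rewrite E subr_ge0 ler_pdivrMr// ler_peMr ?sqr_ge0//.
by rewrite lerDl sqr_ge0.
Qed.

End TaylorBounds.

(** * Modulus and argument of one geometric factor *)

Section PartBounds.
Variable R : realType.
Implicit Types (x y rho th : R).

Lemma dist2E rho th : dist2 rho th = (1 - rho) ^+ 2 + 2 * (rho * (1 - cos th)).
Proof. by rewrite /dist2 exprMn sin2cos2; ring. Qed.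

Lemma dist20 rho : dist2 rho 0 = (1 - rho) ^+ 2.
Proof. by rewrite dist2E cos0 subrr !mulr0 addr0. Qed.

Definition lmod_drop rho th : R := lmod rho 0 - lmod rho th.

Lemma lmod_dropE rho th : 0 <= rho < 1 ->
  lmod_drop rho th = 2^-1 * ln (1 + 2 * (rho * (1 - cos th)) / (1 - rho) ^+ 2).
Proof.
move=> r01; have d0 := dist2_gt0 0 r01; have d1 := dist2_gt0 th r01.
have /andP[r0 r1] := r01; have r1' : 1 - rho != 0 by rewrite gt_eqF// subr_gt0.
have -> : 1 + 2 * (rho * (1 - cos th)) / (1 - rho) ^+ 2 = dist2 rho th / dist2 rho 0.
  by rewrite dist20 dist2E; field.
by rewrite ln_div ?posrE// /lmod_drop /lmod; lra.
Qed.

(** Writing the argument of ln as the inverse of 1 - v and using - ln (1 - v) >= v, with u = rho (1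
    - cos th) the denominator (1 - rho)^2 + 2 u of v is at most (1 + rho)^2 <= 4. *)
Lemma lmod_drop_ge rho th : 0 <= rho < 1 -> rho * (1 - cos th) / 4 <= lmod_drop rho th.
Proof.
move=> r01; have /andP[r0 r1] := r01; rewrite lmod_dropE//.
have r1' : 0 < 1 - rho by rewrite subr_gt0.
have u0 : 0 <= rho * (1 - cos th) by rewrite mulr_ge0// subr_cos_ge0.
have u2 : rho * (1 - cos th) <= 2 * rho by have := cos_geN1 th; nra.
move: (rho * (1 - cos th)) u0 u2 => u u0 u2.
have q0 : 0 < (1 - rho) ^+ 2 by rewrite exprn_gt0.
have E : 1 + 2 * u / (1 - rho) ^+ 2 = (1 + - (2 * u / ((1 - rho) ^+ 2 + 2 * u)))^-1.
  by field; rewrite !gt_eqF//; nra.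
have h : 2 * u / ((1 - rho) ^+ 2 + 2 * u) < 1 by rewrite ltr_pdivrMr; lra.
rewrite E lnV ?posrE; last lra.
have := @le_ln1Dx R (- (2 * u / ((1 - rho) ^+ 2 + 2 * u))).
rewrite ltrN2 => /(_ h).
have : u / 2 <= 2 * u / ((1 - rho) ^+ 2 + 2 * u).
  rewrite ler_pdivlMr; last lra.
  have D : (1 - rho) ^+ 2 + 2 * u <= 4 by nra.
  by have -> : 2 * u = u / 2 * 4 by [lra]; rewrite ler_wpM2l//; lra.
lra.
Qed.

Lemma ln1D_bounds x : 0 <= x -> 0 <= x - ln (1 + x) <= x ^+ 2 / 2.
Proof.
move=> x0; have x1 : 0 < 1 + x by lra.
have d1 (z : R) : 0 <= z <= x -> is_derive z 1 (fun y : R => y ^+ 2 / 2 - (y - ln (1 + y)))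
    (z ^+ 2 / (1 + z)).
  move=> /andP[z0 _]; have dl : is_derive z 1 (fun y : R => ln (1 + y)) ((1 + z)^-1 * 1).
    apply: (@is_derive_ln_comp _ (fun y => 1 + y)); last by rewrite ltr_pwDl.
    by apply: is_derive_eq; lra.
  by apply: is_derive_eq; rewrite /GRing.scale/= ?expr1; field; rewrite gt_eqF// ltr_pwDl.
apply/andP; split; first by have := @le_ln1Dx R x; lra.
have := derive_ge0_le x0 d1.
rewrite addr0 ln1 expr0n/= mul0r !subrr subr_ge0; apply => y /andP[y0 _].
by rewrite divr_ge0 ?sqr_ge0//; lra.
Qed.

(** The natural variable is v = |th| / (1 - rho). For v <= 1 the quadratic error of ln (1 + w) is at
    most rho v^3 because w <= rho v^2; for v > 1 the size of w itself already is. *)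
Lemma lmod_drop_expand rho th : 0 <= rho < 1 ->
  `|lmod_drop rho th - rho / (1 - rho) ^+ 2 * th ^+ 2 / 2| <=
    2 * (rho / (1 - rho) ^+ 3 * `|th| ^+ 3).
Proof.
move=> r01; have /andP[r0 r1] := r01; rewrite lmod_dropE//.
have r1' : 0 < 1 - rho by rewrite subr_gt0.
set w := 2 * (rho * (1 - cos th)) / (1 - rho) ^+ 2.
pose v : R := `|th| / (1 - rho).
have v0 : 0 <= v by rewrite divr_ge0// ltW.
have c0 := subr_cos_ge0 th.
have w0 : 0 <= w by rewrite divr_ge0 ?exprn_ge0 ?(ltW r1')// !mulr_ge0.
have q0 : 0 <= rho / (1 - rho) ^+ 2 by rewrite divr_ge0 ?exprn_ge0 ?(ltW r1').
have /andP[h1 h2] := subr_cos_norm_bounds th.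
have v2 : v ^+ 2 = th ^+ 2 / (1 - rho) ^+ 2 by rewrite /v exprMn real_normK ?num_real// exprVn.
have v3 : rho / (1 - rho) ^+ 3 * `|th| ^+ 3 = rho * v ^+ 3.
  by rewrite /v exprMn exprVn; ring.
have wv : w <= rho * v ^+ 2.
  rewrite v2 /w; have -> : 2 * (rho * (1 - cos th)) / (1 - rho) ^+ 2 =
    rho / (1 - rho) ^+ 2 * (2 * (1 - cos th)) by ring.
  have -> : rho * (th ^+ 2 / (1 - rho) ^+ 2) = rho / (1 - rho) ^+ 2 * th ^+ 2 by ring.
  by rewrite ler_wpM2l//; lra.
have e1 : `|ln (1 + w) - w| <= rho * v ^+ 3.
  have /andP[l1 l2] := ln1D_bounds w0.
  have l3 : 0 <= ln (1 + w) by rewrite ln_ge0//; lra.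
  rewrite distrC ger0_norm//; have [v1|v1] := leP v 1.
    apply: le_trans l2 _; apply: (@le_trans _ _ ((rho * v ^+ 2) ^+ 2 / 2)).
      by rewrite ler_wpM2r// lerXn2r ?nnegrE// (le_trans w0).
    have -> : (rho * v ^+ 2) ^+ 2 / 2 = rho * v ^+ 3 * (rho * v / 2) by ring.
    have rv : rho * v <= 1 by apply: mulr_ile1 => //; exact: ltW.
    rewrite ler_piMr//; last lra.
    by apply: mulr_ge0 => //; exact: exprn_ge0.
  apply: (@le_trans _ _ w); first lra.
  apply: le_trans wv _; rewrite (exprS v 2) ler_wpM2l// ler_peMl ?exprn_ge0//.
  exact: ltW.
have e2 : `|w - rho / (1 - rho) ^+ 2 * th ^+ 2| <= 3^-1 * (rho * v ^+ 3).
  have -> : w - rho / (1 - rho) ^+ 2 * th ^+ 2 =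
    - (rho / (1 - rho) ^+ 2 * (2 * (th ^+ 2 / 2 - (1 - cos th)))) by rewrite /w; field; rewrite gt_eqF.
  rewrite normrN ger0_norm; last by apply: mulr_ge0 => //; apply: mulr_ge0.
  apply: (@le_trans _ _ (rho / (1 - rho) ^+ 2 * (`|th| ^+ 3 / 3))).
    by rewrite ler_wpM2l//; lra.
  have -> : 3^-1 * (rho * v ^+ 3) = rho / (1 - rho) ^+ 2 * (`|th| ^+ 3 / 3) / (1 - rho).
    by rewrite /v; field; rewrite gt_eqF.
  rewrite ler_pdivlMr// ler_piMr//; last lra.
  by apply: mulr_ge0 => //; rewrite divr_ge0 ?exprn_ge0.
rewrite v3; have := ler_normD (2^-1 * (ln (1 + w) - w)) (2^-1 * (w - rho / (1 - rho) ^+ 2 * th ^+ 2)).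
rewrite !normrM (@ger0_norm _ 2^-1)//.
have -> : 2^-1 * (ln (1 + w) - w) + 2^-1 * (w - rho / (1 - rho) ^+ 2 * th ^+ 2) =
  2^-1 * ln (1 + w) - rho / (1 - rho) ^+ 2 * th ^+ 2 / 2 by ring.
have p0 : 0 <= rho * v ^+ 3 by rewrite mulr_ge0 ?exprn_ge0.
lra.
Qed.

(** Two cubic errors: that of atan at z, and that of z against its linear part, which splits into
    sin th - th and the variation of the denominator. *)
Lemma arg_expand rho th : 0 <= rho < 1 ->
  `|arg rho th - rho / (1 - rho) * th| <= 2 * (rho / (1 - rho) ^+ 3 * `|th| ^+ 3).
Proof.
move=> r01; have /andP[r0 r1] := r01; have c1 := subr_cos_gt0 th r01.
have r1' : 0 < 1 - rho by rewrite subr_gt0.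
have cr : 1 - rho <= 1 - rho * cos th by have := cos_le1 th; nra.
have c0 := subr_cos_ge0 th.
have i0 : 0 <= (1 - rho)^-1 by rewrite invr_ge0 ltW.
have i1 : 1 <= (1 - rho)^-1 by rewrite invf_ge1//; lra.
have ic0 : 0 <= (1 - rho * cos th)^-1 by rewrite invr_ge0 ltW.
have ic : (1 - rho * cos th)^-1 <= (1 - rho)^-1 by rewrite lef_pV2 ?posrE.
set z := rho * sin th / (1 - rho * cos th).
have p0 : 0 <= rho / (1 - rho) ^+ 3 * `|th| ^+ 3 by rewrite mulr_ge0 ?divr_ge0 ?exprn_ge0 ?(ltW r1').
have sth : `|sin th| <= `|th|.
  wlog t0 : th {c1 cr c0 ic0 ic z p0} / 0 <= th.
    move=> H; have [/H//|/ltW t0] := leP 0 th.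
    by have := H (- th); rewrite sinN !normrN oppr_ge0; exact.
  rewrite (ger0_norm t0) ler_norml; have /andP[] := subr_sin_bounds t0 => h1 _.
  have [tp|tp] := leP th pi; first by have : 0 <= sin th by [apply: sin_ge0_pi; rewrite t0]; lra.
  by have := pi_ge2 R; have := sin_geN1 th; lra.
have zn : `|z| <= rho * `|th| * (1 - rho)^-1.
  rewrite /z !normrM (ger0_norm r0) (ger0_norm ic0) ler_pM ?mulr_ge0//.
  by rewrite ler_wpM2l.
have e1 : `|atan z - z| <= 3^-1 * (rho / (1 - rho) ^+ 3 * `|th| ^+ 3).
  apply: le_trans (atan_norm_bound z) _; rewrite mulrC ler_wpM2l//.
  apply: (@le_trans _ _ ((rho * `|th| * (1 - rho)^-1) ^+ 3)).
    by rewrite lerXn2r ?nnegrE// !mulr_ge0.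
  have -> : (rho * `|th| * (1 - rho)^-1) ^+ 3 =
    rho / (1 - rho) ^+ 3 * `|th| ^+ 3 * rho ^+ 2 by rewrite !exprMn exprVn; ring.
  by rewrite ler_piMr// exprn_ile1// ltW.
have e2 : `|z - rho / (1 - rho) * th| <= (6^-1 + 2^-1) * (rho / (1 - rho) ^+ 3 * `|th| ^+ 3).
  have -> : z - rho / (1 - rho) * th = rho * (1 - rho * cos th)^-1 * (sin th - th) +
     - (rho ^+ 2 * (1 - cos th) * (1 - rho * cos th)^-1 * (1 - rho)^-1 * th).
    by rewrite /z; field; rewrite !gt_eqF.
  apply: le_trans (ler_normD _ _) _; rewrite mulrDl; apply: lerD.
    rewrite normrM (ger0_norm (mulr_ge0 r0 ic0)).
    apply: (@le_trans _ _ (rho * (1 - rho)^-1 * (`|th| ^+ 3 / 6))).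
      by rewrite ler_pM ?mulr_ge0// ?ler_wpM2l// subr_sin_norm_bound.
    have -> : 6^-1 * (rho / (1 - rho) ^+ 3 * `|th| ^+ 3) =
      rho * (1 - rho)^-1 * (`|th| ^+ 3 / 6) * ((1 - rho)^-1 ^+ 2).
      by field; rewrite gt_eqF.
    by rewrite ler_peMr ?mulr_ge0 ?exprn_ge0// exprn_ege1.
  rewrite normrN normrM ger0_norm ?mulr_ge0 ?exprn_ge0//.
  have h : 1 - cos th <= `|th| ^+ 2 / 2.
    by have /andP[] := subr_cos_norm_bounds th; rewrite real_normK ?num_real//; lra.
  apply: (@le_trans _ _ (rho ^+ 2 * (`|th| ^+ 2 / 2) * (1 - rho)^-1 * (1 - rho)^-1 * `|th|)).
    rewrite ler_wpM2r// ler_wpM2r// ler_pM ?mulr_ge0 ?exprn_ge0//.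
    by rewrite ler_wpM2l ?exprn_ge0.
  have -> : rho ^+ 2 * (`|th| ^+ 2 / 2) * (1 - rho)^-1 * (1 - rho)^-1 * `|th| =
     2^-1 * (rho / (1 - rho) ^+ 3 * `|th| ^+ 3) * (rho * (1 - rho)).
    by field; rewrite gt_eqF.
  by rewrite ler_piMr ?mulr_ge0//; nra.
rewrite /arg -/z; have := ler_normD (atan z - z) (z - rho / (1 - rho) * th).
have -> : atan z - z + (z - rho / (1 - rho) * th) = atan z - rho / (1 - rho) * th by ring.
lra.
Qed.

End PartBounds.

(** * Lower bound for sums of 1 - cos over a progression *)

Section MinorArc.
Variable R : realType.
Implicit Types (x y s t : R).

Lemma subr_cosE x : 1 - cos x = 2 * sin (x / 2) ^+ 2.
Proof.
have {1}-> : x = x / 2 + x / 2 by lra.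
by rewrite cosD -!expr2; have := cos2Dsin2 (x / 2); lra.
Qed.

(** Since 1 - cos z = 2 sin (z / 2)^2, this is the subtraction formula for the sine followed by (p -
    q)^2 <= 2 p^2 + 2 q^2. *)
Lemma subr_cosB x y : 1 - cos (x - y) <= 2 * (1 - cos x) + 2 * (1 - cos y).
Proof.
rewrite !subr_cosE mulrBl sinB.
have := cos2Dsin2 (x / 2); have := cos2Dsin2 (y / 2).
move: (sin (x / 2)) (sin (y / 2)) (cos (x / 2)) (cos (y / 2)) => a b c d h1 h2.
have : (a * d - c * b) ^+ 2 <= 2 * (a * d) ^+ 2 + 2 * (c * b) ^+ 2.
  by have := sqr_ge0 (a * d + c * b); lra.
have : (a * d) ^+ 2 <= a ^+ 2 by rewrite exprMn ler_piMr ?sqr_ge0//; have := sqr_ge0 b; lra.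
have : (c * b) ^+ 2 <= b ^+ 2 by rewrite exprMn ler_piMl ?sqr_ge0//; have := sqr_ge0 a; lra.
lra.
Qed.

Lemma subr_cos_double x : 1 - cos (2 * x) <= 4 * (1 - cos x).
Proof.
have -> : 2 * x = x + x by lra.
rewrite cosD -!expr2; have := cos2Dsin2 x; have := cos_le1 x; have := cos_geN1 x.
by nra.
Qed.

Lemma subr_cos_ge x : `|x| <= pi -> x ^+ 2 / 8 <= 1 - cos x.
Proof.
move=> xp; rewrite -cos_norm -(@real_normK _ x) ?num_real//.
move: (normr_ge0 x) xp; move: `|x| => y y0 yp.
have h : y / 2 / 2 <= sin (y / 2) by apply: sin_ge_half; lra.
rewrite subr_cosE; have : (y / 2 / 2) ^+ 2 <= sin (y / 2) ^+ 2.
  by rewrite lerXn2r ?nnegrE//; lra.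
lra.
Qed.

Lemma le_sum_subrange (F : nat -> R) m n N : (forall i, 0 <= F i) -> (n <= N)%N ->
  \sum_(m <= i < n) F i <= \sum_(0 <= i < N) F i.
Proof.
move=> F0 nN; have [mn|nm] := leqP m n; last first.
  by rewrite big_geq ?(ltnW nm)// sumr_ge0.
rewrite (@big_cat_nat _ _ _ m 0 N)//= ?(leq_trans mn nN)//.
rewrite (@big_cat_nat _ _ _ n m N)//= addrCA lerDl.
by rewrite addr_ge0// sumr_ge0.
Qed.

(* Both bounds pair terms by [subr_cosB]: [s] is [2 (s + t b) - (s + 2 t b)], and
   [t h] is [(s + t (b + h)) - (s + t b)], with [h] chosen so that [t h] is not small. *)
Lemma minor_arc (H : nat) s t : (0 < H)%N -> `|s| <= pi -> `|t| <= pi ->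
  H%:R * (s ^+ 2 + Num.min 1 ((H%:R * t) ^+ 2)) / 160 <=
    \sum_(0 <= j < H.*2) (1 - cos (s + t * j.+1%:R)).
Proof.
move=> H0 sp tp; pose F j := 1 - cos (s + t * j.+1%:R).
rewrite -/(F _); set S := \sum_(_ <= _ < _) _.
have F0 j : 0 <= F j by exact: subr_cos_ge0.
have spl (c d : R) (f g : nat -> R) : \sum_(0 <= j < H) (c * f j + d * g j) =
    c * \sum_(0 <= j < H) f j + d * \sum_(0 <= j < H) g j.
  by rewrite big_split/= !mulr_sumr.
have HH : (H <= H.*2)%N by rewrite -addnn leq_addr.
have S1 : \sum_(0 <= j < H) F j <= S by exact: le_sum_subrange.
have S2 : \sum_(0 <= j < H) F j.*2.+1 <= S.
  by rewrite /S sum_even_odd; apply: ler_sum => j _; rewrite lerDr.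
(* 10 = 8 + 2: the doubled angle costs a factor 4 on top of the 2 of [subr_cosB], and the index 2 j
   + 1 stays below 2 H. *)
have h1 : H%:R * (1 - cos s) <= 10 * S.
  have : \sum_(0 <= j < H) (1 - cos s) <= \sum_(0 <= j < H) (8 * F j + 2 * F j.*2.+1).
    apply: ler_sum => j _.
    have -> : s = 2 * (s + t * j.+1%:R) - (s + t * j.*2.+2%:R).
      by rewrite -doubleS -mul2n natrM; ring.
    apply: le_trans (subr_cosB _ _) _.
    by have := subr_cos_double (s + t * j.+1%:R); rewrite /F; lra.
  rewrite spl sumr_const_nat subn0 -mulr_natl.
  lra.
have h2 h : (0 < h <= H)%N -> H%:R * (1 - cos (t * h%:R)) <= 4 * S.
  move=> /andP[h0 hH].
  have S3 : \sum_(0 <= j < H) F (j + h)%N <= S.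
    have -> : \sum_(0 <= j < H) F (j + h)%N = \sum_(h <= j < H + h) F j.
      by rewrite -{2}(add0n h) big_addn addnK.
    by apply: le_sum_subrange => //; rewrite -addnn leq_add2l.
  have : \sum_(0 <= j < H) (1 - cos (t * h%:R)) <= \sum_(0 <= j < H) (2 * F (j + h)%N + 2 * F j).
    apply: ler_sum => j _.
    have -> : t * h%:R = (s + t * (j + h).+1%:R) - (s + t * j.+1%:R).
      by rewrite -addSn natrD; ring.
    exact: subr_cosB.
  rewrite spl sumr_const_nat subn0 -mulr_natl.
  lra.
have h3 : H%:R * Num.min 1 ((H%:R * t) ^+ 2) <= 32 * S.
  have [Htp|Htp] := leP (`|H%:R * t|) pi.
    have c1 := subr_cos_ge Htp.
    have := h2 H; rewrite H0 leqnn => /(_ isT) c2.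
    have : H%:R * ((H%:R * t) ^+ 2 / 8) <= H%:R * (1 - cos (t * H%:R)).
      by rewrite (mulrC t) ler_wpM2l.
    have : H%:R * Num.min 1 ((H%:R * t) ^+ 2) <= H%:R * (H%:R * t) ^+ 2.
      by rewrite ler_wpM2l// ge_min lexx orbT.
    lra.
  have p0 := pi_gt0 R.
  (* The least such h has |h t| <= pi: for h = 1 by the bound on t, otherwise because |t| <= |(h -
     1) t| < pi / 2. Then cos (t h) <= 0 and the pairing contributes at least 1 per term. *)
  have ex : exists h, pi / 2 <= `|h%:R * t|.
    by exists H; apply: ltW; apply: le_lt_trans Htp; lra.
  have [hh hh1 hmin] := ex_minnP ex.
  have h0 : (0 < hh)%N.
    by rewrite lt0n; apply/eqP => E; move: hh1; rewrite E mul0r normr0; lra.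
  have hH : (hh <= H)%N by apply: hmin; apply: ltW; apply: le_lt_trans Htp; lra.
  have hhp : `|hh%:R * t| <= pi.
    case: hh h0 hH hh1 hmin => // h _ hH hh1 hmin.
    have [h00|hp] := posnP h; first by rewrite h00 mul1r.
    have lt1 : `|h%:R * t| < pi / 2.
      by rewrite ltNge; apply/negP => /hmin; rewrite ltnn.
    have lt2 : `|t| <= `|h%:R * t|.
      by rewrite normrM ler_peMl// normr_nat ler1n.
    rewrite -natr1 mulrDl mul1r; apply: le_trans (ler_normD _ _) _; lra.
  have := h2 hh; rewrite h0 hH => /(_ isT) c2.
  have c3 : 1 <= 1 - cos (t * hh%:R).
    rewrite -cos_norm mulrC; set y := `|_| in hh1 hhp *.
    have : 0 <= cos (pi - y) by apply: cos_ge0_pihalf; lra.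
    have -> : cos (pi - y) = - cos y by rewrite cosB cospi sinpi; ring.
    lra.
  have : H%:R * 1 <= H%:R * (1 - cos (t * hh%:R)) by rewrite ler_wpM2l.
  have : H%:R * Num.min 1 ((H%:R * t) ^+ 2) <= H%:R * 1.
    by rewrite ler_wpM2l// ge_min lexx.
  have S0 : 0 <= S by rewrite sumr_ge0.
  lra.
have := ler_wpM2l (ler0n R H) (subr_cos_ge sp).
have S0 : 0 <= S by rewrite sumr_ge0.
rewrite [H%:R * (_ + _)]mulrDr; lra.
Qed.

End MinorArc.

(** * The saddle point method *)

Section Saddle.
Variables (R : realType) (xs : nat -> seq (nat * nat)).
Variables (al be sg ta L B : nat -> R) (m n : nat -> nat) (c : R).
Local Notation T := (measurableTypeR R * measurableTypeR R)%type.
Let y k (x : nat * nat) := al k * x.1%:R + be k * x.2%:R.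
Let rho k x := wtp (al k) (be k) x.
Let th k x (p : T) := phase (sg k) (ta k) x p.

Hypotheses (c0 : 0 < c) (al0 : forall k, 0 < al k) (be0 : forall k, 0 < be k).
Hypotheses (sg0 : forall k, 0 < sg k) (ta0 : forall k, 0 < ta k) (L0 : forall k, 0 <= L k).
Hypotheses (xs_uniq : forall k, uniq (xs k)) (xs_nz : forall k x, x \in xs k -> Zsq_nz x).
Hypotheses (sg_oo : sg @ \oo --> +oo) (ta_oo : ta @ \oo --> +oo).
Hypothesis B_le : forall k, `|B k| <= 1 - c.
Hypothesis drop_lb : forall k p, box (pi * sg k) (pi * ta k) p ->
  c * Num.min (L k) (p.1 ^+ 2 + p.2 ^+ 2) <= \sum_(x <- xs k) lmod_drop (rho k x) (th k x p).
Hypothesis mean1 : (fun k => (\sum_(x <- xs k) x.1%:R * bose0 (y k x) - (m k)%:R) / sg k) @ \oo --> 0.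
Hypothesis mean2 : (fun k => (\sum_(x <- xs k) x.2%:R * bose0 (y k x) - (n k)%:R) / ta k) @ \oo --> 0.
Hypothesis var11 : (fun k => (\sum_(x <- xs k) x.1%:R ^+ 2 * bose1 (y k x)) / sg k ^+ 2) @ \oo --> (1 : R).
Hypothesis var12 : (fun k => (\sum_(x <- xs k) x.1%:R * x.2%:R * bose1 (y k x)) / (sg k * ta k) - B k)
  @ \oo --> (0 : R).
Hypothesis var22 : (fun k => (\sum_(x <- xs k) x.2%:R ^+ 2 * bose1 (y k x)) / ta k ^+ 2) @ \oo --> (1 : R).
Hypothesis third : (fun k => \sum_(x <- xs k) rho k x / (1 - rho k x) ^+ 3 *
  (x.1%:R / sg k + x.2%:R / ta k) ^+ 3) @ \oo --> (0 : R).
Hypothesis tail : (fun k => expR (- (c * L k)) * (sg k * ta k)) @ \oo --> 0.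

Let y_gt0 k x : Zsq_nz x -> 0 < y k x.
Proof.
case: x => [[|a] [|b]] //= _; rewrite /y/=.
- by rewrite mulr0 add0r mulr_gt0.
- by rewrite mulr0 addr0 mulr_gt0.
- by rewrite addr_gt0// mulr_gt0.
Qed.

Let rho_lt1 k x : Zsq_nz x -> wtp (al k) (be k) x < 1.
Proof. by move=> /(y_gt0 k); exact: expRN_lt1. Qed.

Let rho01 k x : Zsq_nz x -> 0 <= rho k x < 1.
Proof. by move=> x0; rewrite rho_lt1// ltW// expR_gt0. Qed.

Let lmod0 k x : Zsq_nz x -> lmod (rho k x) 0 = bose_log (y k x).
Proof.
move=> x0; have /andP[_ r1] := rho01 k x0.
by rewrite /lmod dist20 lnXn ?subr_gt0// /bose_log /rho /wtp /wt -/(y k x) -mulr_natl; lra.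
Qed.

Let E k p := \sum_(x <- xs k) lmod_drop (rho k x) (th k x p).
Let Ph k p := AR (sg k) (ta k) (al k) (be k) (xs k) p - wave (sg k) (ta k) (m k)%:R (n k)%:R p.
Let LM0 k := \sum_(x <- xs k) bose_log (y k x).

Let EE k p : E k p = LM0 k - LM (sg k) (ta k) (al k) (be k) (xs k) p.
Proof.
rewrite /E /LM0 /LM -sumrB !big_seq; apply: eq_bigr => x /xs_nz x0.
by rewrite -lmod0.
Qed.

Let th_le k x p : `|th k x p| <= (`|p.1| + `|p.2|) * (x.1%:R / sg k + x.2%:R / ta k).
Proof.
rewrite /th /phase /wave.
have s0 : 0 <= x.1%:R / sg k by rewrite divr_ge0// ltW.
have t0 : 0 <= x.2%:R / ta k by rewrite divr_ge0// ltW.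
have -> : x.1%:R * p.1 / sg k + x.2%:R * p.2 / ta k =
  p.1 * (x.1%:R / sg k) + p.2 * (x.2%:R / ta k) by ring.
apply: le_trans (ler_normD _ _) _; rewrite (normrM p.1) (normrM p.2) (ger0_norm s0) (ger0_norm t0).
have := mulr_ge0 (normr_ge0 p.1) t0; have := mulr_ge0 (normr_ge0 p.2) s0.
lra.
Qed.

Let third_le k p : \sum_(x <- xs k) rho k x / (1 - rho k x) ^+ 3 * `|th k x p| ^+ 3 <=
  (`|p.1| + `|p.2|) ^+ 3 * \sum_(x <- xs k) rho k x / (1 - rho k x) ^+ 3 *
  (x.1%:R / sg k + x.2%:R / ta k) ^+ 3.
Proof.
rewrite mulr_sumr !big_seq; apply: ler_sum => x /xs_nz x0.
have /andP[r0 r1] := rho01 k x0.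
have s0 : 0 <= x.1%:R / sg k by rewrite divr_ge0// ltW.
have t0 : 0 <= x.2%:R / ta k by rewrite divr_ge0// ltW.
rewrite [leRHS]mulrCA -exprMn; apply: ler_wpM2l.
  by rewrite divr_ge0 ?exprn_ge0// subr_ge0 ltW.
by rewrite lerXn2r ?nnegrE ?mulr_ge0 ?addr_ge0// th_le.
Qed.

Let E_cvg p : (fun k => E k p - quad 1 (B k) 1 p / 2) @ \oo --> 0.
Proof.
pose M k := \sum_(x <- xs k) bose1 (y k x) * th k x p ^+ 2 / 2.
have ME k : M k = (p.1 ^+ 2 * ((\sum_(x <- xs k) x.1%:R ^+ 2 * bose1 (y k x)) / sg k ^+ 2) +
   2 * p.1 * p.2 * ((\sum_(x <- xs k) x.1%:R * x.2%:R * bose1 (y k x)) / (sg k * ta k)) +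
   p.2 ^+ 2 * ((\sum_(x <- xs k) x.2%:R ^+ 2 * bose1 (y k x)) / ta k ^+ 2)) / 2.
  rewrite /M !mulr_suml !mulr_sumr -!big_split/= mulr_suml; apply: eq_bigr => x _.
  have := sg0 k; have := ta0 k; rewrite /th /phase /wave.
  move: (bose1 _) (sg k) (ta k) (p.1 : R) (p.2 : R) (x.1%:R : R) (x.2%:R : R).
  by move=> b s t p1 p2 x1 x2 t00 s00; field; rewrite !gt_eqF.
have h1 : (fun k => E k p - M k) @ \oo --> 0.
  apply: (@cvg0_le _ _ (fun k => 2 * ((`|p.1| + `|p.2|) ^+ 3 * \sum_(x <- xs k)
     rho k x / (1 - rho k x) ^+ 3 * (x.1%:R / sg k + x.2%:R / ta k) ^+ 3))).
    move=> k; apply: (@le_trans _ _ (2 * (\sum_(x <- xs k) rho k x / (1 - rho k x) ^+ 3 * `|th k x p| ^+ 3))).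
      rewrite /E /M -sumrB mulr_sumr; apply: le_trans (ler_norm_sum _ _ _) _.
      rewrite !big_seq; apply: ler_sum => x /xs_nz x0.
      exact: lmod_drop_expand (rho01 k x0).
    by rewrite ler_wpM2l// third_le.
  rewrite -[X in _ --> X](mulr0 2); apply: cvgMr.
  rewrite -[X in _ --> X](mulr0 ((`|p.1| + `|p.2|) ^+ 3)).
  exact: cvgMr.
have h2 : (fun k => (p.1 ^+ 2 * ((\sum_(x <- xs k) x.1%:R ^+ 2 * bose1 (y k x)) / sg k ^+ 2 - 1) +
   2 * p.1 * p.2 * ((\sum_(x <- xs k) x.1%:R * x.2%:R * bose1 (y k x)) / (sg k * ta k) - B k) +
   p.2 ^+ 2 * ((\sum_(x <- xs k) x.2%:R ^+ 2 * bose1 (y k x)) / ta k ^+ 2 - 1)) / 2) @ \oo -->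
   (p.1 ^+ 2 * (1 - 1) + 2 * p.1 * p.2 * 0 + p.2 ^+ 2 * (1 - 1)) / 2.
  apply: cvgMl; apply: cvgD; [apply: cvgD|]; apply: cvgMr => //.
    by apply: cvgB => //; exact: cvg_cst.
  by apply: cvgB => //; exact: cvg_cst.
have h3 := cvgnD h1 h2; rewrite !subrr !mulr0 !addr0 mul0r add0r in h3.
by apply: eq_cvgn h3 => k; rewrite /= ME /quad; ring.
Qed.

Let Ph_cvg p : (fun k => Ph k p) @ \oo --> 0.
Proof.
pose M k := \sum_(x <- xs k) bose0 (y k x) * th k x p.
have ME k : M k - wave (sg k) (ta k) (m k)%:R (n k)%:R p =
   p.1 * ((\sum_(x <- xs k) x.1%:R * bose0 (y k x) - (m k)%:R) / sg k) +
   p.2 * ((\sum_(x <- xs k) x.2%:R * bose0 (y k x) - (n k)%:R) / ta k).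
  have -> : M k = p.1 * ((\sum_(x <- xs k) x.1%:R * bose0 (y k x)) / sg k) +
     p.2 * ((\sum_(x <- xs k) x.2%:R * bose0 (y k x)) / ta k).
    rewrite /M !mulr_suml !mulr_sumr -!big_split/=; apply: eq_bigr => x _.
    by rewrite /th /phase /wave; ring.
  by rewrite /wave; ring.
have h1 : (fun k => AR (sg k) (ta k) (al k) (be k) (xs k) p - M k) @ \oo --> 0.
  apply: (@cvg0_le _ _ (fun k => 2 * ((`|p.1| + `|p.2|) ^+ 3 * \sum_(x <- xs k)
     rho k x / (1 - rho k x) ^+ 3 * (x.1%:R / sg k + x.2%:R / ta k) ^+ 3))).
    move=> k; apply: (@le_trans _ _ (2 * (\sum_(x <- xs k) rho k x / (1 - rho k x) ^+ 3 * `|th k x p| ^+ 3))).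
      rewrite /AR /M -sumrB mulr_sumr; apply: le_trans (ler_norm_sum _ _ _) _.
      rewrite !big_seq; apply: ler_sum => x /xs_nz x0.
      exact: arg_expand (rho01 k x0).
    by rewrite ler_wpM2l// third_le.
  rewrite -[X in _ --> X](mulr0 2); apply: cvgMr.
  rewrite -[X in _ --> X](mulr0 ((`|p.1| + `|p.2|) ^+ 3)).
  exact: cvgMr.
have h2 := cvgnD (cvgnZ (c := p.1) mean1) (cvgnZ (c := p.2) mean2).
have h3 := cvgnD h1 h2; rewrite !mulr0 !addr0 in h3.
by apply: eq_cvgn h3 => k; rewrite /= -ME /Ph; ring.
Qed.

(** The integrand is normalised by its value at 0, so the logarithm of its modulus is [- E]. The
    third-moment hypothesis makes [E] asymptotically quadratic, with correlation [B], and the mean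
    hypotheses make the phase vanish; [local_limit_integral] then evaluates the integral that
    [coefficient_integral] expresses through [npart]. *)
Lemma saddle_point :
  (fun k => (npart [set` xs k] (m k, n k))%:R * expR (- (al k * (m k)%:R + be k * (n k)%:R)) *
    expR (- \sum_(x <- xs k) bose_log (y k x)) * (2 * pi * (sg k * ta k) * Num.sqrt (1 - B k ^+ 2)))
  @ \oo --> (1 : R).
Proof.
have p0 := pi_gt0 R.
have B1 k : B k ^+ 2 < 1.
  rewrite -(@real_normK _ (B k)) ?num_real// expr_lt1 ?normr_ge0//.
  by apply: le_lt_trans (B_le k) _; rewrite ltrBlDr ltrDl.
have I k : ibox (pi * sg k) (pi * ta k) (fun p => expR (- E k p) * cos (Ph k p)) =
  expR (- LM0 k) * (4 * pi ^+ 2 * sg k * ta k *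
    ((npart [set` xs k] (m k, n k))%:R * expR (- (al k * (m k)%:R + be k * (n k)%:R)))).
  have ci := coefficient_integral (sg0 k) (ta0 k) (ltW (al0 k)) (ltW (be0 k)) (@rho_lt1 k)
    (m k)%:Z (n k)%:Z (xs_uniq k) (@xs_nz k).
  rewrite /npartZ/= /wt in ci; rewrite -ci.
  have bg := bm_gen (sg k) (ta k) (@rho_lt1 k) (m k)%:Z%:~R (n k)%:Z%:~R (@xs_nz k).
  (* Scaling by e^(- LM0), obtained from additivity with the same function twice: I + (e^(- LM0) -
     1) I. *)
  have := iboxDZ (expR (- LM0 k) - 1) (mulr_ge0 (ltW p0) (ltW (sg0 k))) (mulr_ge0 (ltW p0) (ltW (ta0 k))) bg bg.
  set I0 := ibox _ _ (gen _ _ _ _ _ _ _).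
  have -> : I0 + (expR (- LM0 k) - 1) * I0 = expR (- LM0 k) * I0 by ring.
  move=> <-; apply: eq_ibox => p _; rewrite EE /gen opprB expRD -!pmulrn.
  by rewrite /Ph; ring.
have sq0 k : 0 < Num.sqrt (1 - B k ^+ 2) by rewrite sqrtr_gt0 subr_gt0.
have sq1 k : Num.sqrt (1 - B k ^+ 2) <= 1.
  by rewrite -[leRHS]sqrtr1 ler_wsqrtr// gerBl sqr_ge0.
have psg k : 0 < pi * sg k by rewrite mulr_gt0.
have pta k : 0 < pi * ta k by rewrite mulr_gt0.
have pi_oo (u : nat -> R) : (forall k, 0 < u k) -> u @ \oo --> +oo ->
    (fun k => pi * u k) @ \oo --> +oo.
  move=> u0 uoo; apply/cvgryPge => A; move/cvgryPge : uoo => /(_ A).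
  apply: filterS => k /= /le_trans; apply; rewrite ler_peMl ?(ltW (u0 k))//.
  by have := pi_ge2 R; lra.
have H : (fun k => ibox (pi * sg k) (pi * ta k) (fun p => expR (- E k p) * cos (Ph k p)) -
    2 * pi / Num.sqrt (1 * 1 - B k ^+ 2)) @ \oo --> 0.
  apply: (local_limit_integral c0 (fun k => ltW (psg k)) (fun k => ltW (pta k)) L0
     _ _ _ _ drop_lb _ E_cvg Ph_cvg).
  - exact: pi_oo.
  - exact: pi_oo.
  - move=> k; suff : measurable_fun setT (E k) by [].
    rewrite (funext (EE k)); apply: measurable_funB => //.
    exact: measurable_LM.
  - move=> k; apply: measurable_funB; last exact: measurable_wave.
    by apply: measurable_AR; [exact: rho_lt1|exact: xs_nz].
  (* Since 2 |p.1 p.2| <= p.1^2 + p.2^2, the form with unit diagonal is at least (1 - |B|) times the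
     squared norm. *)
  - move=> k p; rewrite /quad mulr0 !mul0r addr0.
    have := B_le k; rewrite ler_norml => /andP[b1 b2].
    by have := sqr_ge0 (p.1 + p.2); have := sqr_ge0 (p.1 - p.2); nra.
  - have := cvgnZ (c := 4 * pi ^+ 2) tail; rewrite mulr0; apply: eq_cvgn => k.
    by rewrite /=; ring.
have H2 := cvg0_mul_bounded (v := fun k => Num.sqrt (1 - B k ^+ 2) / (2 * pi)) (K := 1) _ H.
have p2 : 0 < 2 * pi :> R by rewrite mulr_gt0.
have {H2}H2 : (fun k => (ibox (pi * sg k) (pi * ta k) (fun p => expR (- E k p) * cos (Ph k p)) -
    2 * pi / Num.sqrt (1 * 1 - B k ^+ 2)) * (Num.sqrt (1 - B k ^+ 2) / (2 * pi))) @ \oo --> 0.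
  apply: H2 => k; rewrite ger0_norm; last by rewrite divr_ge0 ?ltW.
  rewrite ler_pdivrMr// mul1r (le_trans (sq1 k))//; have := pi_ge2 R; lra.
apply: cvg_dist0; apply: eq_cvgn H2 => k.
rewrite I mulr1 -/(LM0 k); have sn := lt0r_neq0 (sq0 k); have pn := lt0r_neq0 p0.
move: (npart _ _)%:R (expR _) (expR _) (Num.sqrt _) sn (pi : R) pn (sg k) (ta k).
by move=> N e1 e2 q q0 w w0 s t; field; rewrite q0 w0.
Qed.

End Saddle.

(** * Moments of the weighted parts *)

Section PartLists.

Definition grid (M : nat) : seq (nat * nat) :=
  [seq (i.+1, j.+1) | i <- index_iota 0 M, j <- index_iota 0 M].

Definition axes (M : nat) : seq (nat * nat) :=
  [seq (i.+1, 0%N) | i <- index_iota 0 M] ++ [seq (0%N, j.+1) | j <- index_iota 0 M].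

(* [ax] tells whether the parts on the two axes are allowed, as in the second case of
   the theorem. *)
Definition parts (ax : bool) M := grid M ++ (if ax then axes M else [::]).

Lemma mem_grid M x : (x \in grid M) = (0 < x.1 <= M)%N && (0 < x.2 <= M)%N.
Proof.
apply/allpairsP/idP => [[[i j] /= [+ + ->]]|].
  by rewrite !mem_index_iota /= => -> ->.
case: x => [[|i] [|j]] //= /andP[iM jM]; first by [].
by exists (i, j); rewrite !mem_index_iota.
Qed.

Lemma mem_axes M x : (x \in axes M) =
  (0 < x.1 <= M)%N && (x.2 == 0%N) || (x.1 == 0%N) && (0 < x.2 <= M)%N.
Proof.
rewrite mem_cat; congr (_ || _).
  apply/mapP/idP => [[i + ->]|]; first by rewrite mem_index_iota /= => ->.
  case: x => [[|i] j] //= /andP[iM /eqP ->]; exists i => //.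
  by rewrite mem_index_iota.
apply/mapP/idP => [[i + ->]|]; first by rewrite mem_index_iota /= => ->.
case: x => [j [|i]] //= /andP[/eqP -> iM]; first by [].
by exists i => //; rewrite mem_index_iota.
Qed.

Lemma parts_nz ax M x : x \in parts ax M -> Zsq_nz x.
Proof.
rewrite mem_cat => /orP[|].
  by rewrite mem_grid; case: x => [[|i] [|j]].
by case: ax => //; rewrite mem_axes; case: x => [[|i] [|j]].
Qed.

Lemma uniq_parts ax M : uniq (parts ax M).
Proof.
have ug : uniq (grid M).
  apply: allpairs_uniq; rewrite ?iota_uniq//.
  by move=> [a b] [a' b'] _ _ /= [-> ->].
have ua : uniq (axes M).
  rewrite cat_uniq !map_inj_uniq ?iota_uniq ?andbT//=; last by move=> ? ? [].
    by apply/hasPn => x /mapP[i _ ->]; apply/mapP => -[].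
  by move=> ? ? [].
rewrite cat_uniq ug/=; apply/andP; split; last by case: ax.
apply/hasPn => x; case: ax => //; rewrite mem_axes/= mem_grid.
by case: x => [[|i] [|j]]; rewrite /= ?andbF.
Qed.

Lemma npart_parts (ax : bool) M n : (n.1 <= M)%N -> (n.2 <= M)%N ->
  npart (if ax then Zsq_nz else Nsq) n = npart [set` parts ax M] n.
Proof.
move=> n1M n2M; apply: npart_le => [x /=|x Xx x1 x2].
  case: ax => [/parts_nz//|]; rewrite mem_cat orbF mem_grid.
  by case/andP => /andP[x1 _] /andP[x2 _].
rewrite /= mem_cat mem_grid; have x1M := leq_trans x1 n1M; have x2M := leq_trans x2 n2M.
rewrite x1M x2M !andbT; case: ax Xx => [|[-> ->]//].
by rewrite mem_axes x1M x2M; case: x {x1 x2 x1M x2M} => [[|i] [|j]].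
Qed.

Lemma big_parts (R : realType) ax M (F : nat * nat -> R) : \sum_(x <- parts ax M) F x =
  \sum_(0 <= i < M) \sum_(0 <= j < M) F (i.+1, j.+1) +
  ax%:R * (\sum_(0 <= i < M) F (i.+1, 0%N) + \sum_(0 <= j < M) F (0%N, j.+1)).
Proof.
rewrite big_cat/= big_allpairs_dep/=; congr (_ + _).
case: ax; last by rewrite big_nil mul0r.
by rewrite mul1r big_cat !big_map.
Qed.

End PartLists.

(** * Moments of the parts in the open quadrant and on the first axis *)

Section MomentLimits.
Variable R : realType.
Implicit Types (a b x : R) (c : nat -> R) (G : R -> R).

Definition bose (k : nat) x : R :=
  match k with 0%N => bose0 x | 1%N => bose1 x | _ => bose2 x end.

(** The function with series r^(q - 1) e^(- x r), hence one index below [bose]. A moment of total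
    degree q sums monomials against it. *)
Definition bose_int (q : nat) x : R :=
  match q with 0%N => bose_log x | q'.+1 => bose q' x end.

(** The sum over r of r^(i - 2) [bose i (a r)], that is, (-1)^i times the i-th derivative of [Phi]
    for i <= 2. *)
Definition Phi_moment (i : nat) a : R :=
  match i with 0%N => Phi a | 1%N => P1 a | _ => P2 a end.

Lemma sums_bose i x : (i <= 2)%N -> 0 < x ->
  sums (fun r => r.+1%:R ^+ i * expR (- x * r.+1%:R)) (bose i x).
Proof.
case: i => [|[|[|//]]] _ x0 /=.
- by apply: eq_sums (sums_bose0 x0) => r; rewrite mul1r.
- by apply: eq_sums (sums_bose1 x0) => r; rewrite expr1.
- exact: sums_bose2.
Qed.

Lemma sums_bose_int q x : (q <= 2)%N -> 0 < x ->
  sums (fun r => r.+1%:R ^+ q / r.+1%:R * expR (- x * r.+1%:R)) (bose_int q x).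
Proof.
case: q => [|q] q2 x0 /=.
  by apply: eq_sums (sums_bose_log x0) => r; rewrite mul1r.
apply: eq_sums (sums_bose (ltnW q2) x0) => r.
by rewrite exprS [_ / _]mulrC mulKf.
Qed.

Lemma sums_Phi_moment i a : (i <= 2)%N -> 0 < a ->
  sums (fun r => r.+1%:R ^+ i / r.+1%:R ^+ 2 * bose i (a * r.+1%:R)) (Phi_moment i a).
Proof.
case: i => [|[|[|//]]] _ a0 /=.
- by apply: eq_sums (sums_Phi a0) => r; rewrite mul1r.
- by apply: eq_sums (sums_P1 a0) => r; rewrite expr1 expr2 invfM mulVKf.
- by apply: eq_sums (sums_P2 a0) => r; rewrite mulfV ?mul1r// expf_neq0.
Qed.

Lemma bose_pos i x : 0 < x -> 0 < bose i x.
Proof. by case: i => [|[|i]] x0; have [] := bose_gt0 x0. Qed.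

Lemma bose_le_bose2 i x : 0 < x -> bose i x <= bose2 x.
Proof.
by case: i => [|[|i]] x0 //=; have [_ h1 h2] := bose_le x0 => //; exact: le_trans h2.
Qed.

Lemma bose_partial_le i x M : (i <= 2)%N -> 0 < x ->
  0 <= \sum_(0 <= r < M) r.+1%:R ^+ i * expR (- x * r.+1%:R) <= bose i x.
Proof.
move=> i2 x0; have t0 r : 0 <= r.+1%:R ^+ i * expR (- x * r.+1%:R) :> R.
  by rewrite mulr_ge0 ?exprn_ge0 ?expR_ge0.
by rewrite sumr_ge0//= (le_partial_sums M (sums_bose i2 x0) t0).
Qed.

(** Expanding [G] in powers of e^(-x), the r-th term of the finite double sum is a product of two
    one-dimensional sums, each bounded by and converging to a Bose function. So [tannery] in r, with
    M as parameter, gives the sum over the whole quadrant. *)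
Lemma grid_moment c G i j a b S : (i <= 2)%N -> (j <= 2)%N -> 0 < a -> 0 < b ->
  (forall r, 0 <= c r) ->
  (forall x, 0 < x -> sums (fun r => c r * expR (- x * r.+1%:R)) (G x)) ->
  sums (fun r => c r * (bose i (a * r.+1%:R) * bose j (b * r.+1%:R))) S ->
  (fun M => \sum_(0 <= k < M) \sum_(0 <= l < M)
     k.+1%:R ^+ i * l.+1%:R ^+ j * G (a * k.+1%:R + b * l.+1%:R)) @ \oo --> S.
Proof.
move=> i2 j2 a0 b0 c0 GE SE.
pose sm (i : nat) x M := \sum_(0 <= k < M) k.+1%:R ^+ i * expR (- x * k.+1%:R) : R.
have ar r : 0 < a * r.+1%:R by rewrite mulr_gt0.
have br r : 0 < b * r.+1%:R by rewrite mulr_gt0.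
apply: (@tannery _ (fun M r => c r * (sm i (a * r.+1%:R) M * sm j (b * r.+1%:R) M)) _ _ _ _ _ _ SE _ _ SE).
- move=> M r; have /andP[x0 x1] := bose_partial_le M i2 (ar r).
  have /andP[y0 y1] := bose_partial_le M j2 (br r).
  rewrite ger0_norm ?mulr_ge0//; apply: ler_wpM2l => //; exact: ler_pM.
- move=> r; apply: cvgMr; apply: cvgM; have := sums_bose i2 (ar r); have := sums_bose j2 (br r).
    by move=> _; rewrite /sums (_ : series _ = sm i (a * r.+1%:R))//; apply/funext => n; rewrite seriesE.
  by rewrite /sums (_ : series _ = sm j (b * r.+1%:R))//; apply/funext => n; rewrite seriesE.
- move=> M.
  have yx k l : 0 < a * k.+1%:R + b * l.+1%:R by rewrite addr_gt0.
  have := sums_sum (r := index_iota 0 M) (fun k => sums_sum (r := index_iota 0 M)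
    (fun l => sumsZ (k.+1%:R ^+ i * l.+1%:R ^+ j) (GE _ (yx k l)))).
  apply: eq_sums => r; rewrite /sm mulr_suml mulr_sumr; apply: eq_bigr => k _.
  rewrite !mulr_sumr; apply: eq_bigr => l _.
  have -> : - (a * k.+1%:R + b * l.+1%:R) * r.+1%:R =
    - (a * r.+1%:R) * k.+1%:R + - (b * r.+1%:R) * l.+1%:R by ring.
  by rewrite expRD; ring.
Qed.

Lemma axis_moment c G i a S : (i <= 2)%N -> 0 < a ->
  (forall r, 0 <= c r) ->
  (forall x, 0 < x -> sums (fun r => c r * expR (- x * r.+1%:R)) (G x)) ->
  sums (fun r => c r * bose i (a * r.+1%:R)) S ->
  (fun M => \sum_(0 <= k < M) k.+1%:R ^+ i * G (a * k.+1%:R)) @ \oo --> S.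
Proof.
move=> i2 a0 c0 GE SE.
pose sm x M := \sum_(0 <= k < M) k.+1%:R ^+ i * expR (- x * k.+1%:R) : R.
have ar r : 0 < a * r.+1%:R by rewrite mulr_gt0.
apply: (@tannery _ (fun M r => c r * sm (a * r.+1%:R) M) _ _ _ _ _ _ SE _ _ SE).
- move=> M r; have /andP[x0 x1] := bose_partial_le M i2 (ar r).
  by rewrite ger0_norm ?mulr_ge0//; apply: ler_wpM2l.
- move=> r; apply: cvgMr; have := sums_bose i2 (ar r).
  by rewrite /sums (_ : series _ = sm (a * r.+1%:R))//; apply/funext => n; rewrite seriesE.
- move=> M.
  have := sums_sum (r := index_iota 0 M) (fun k => sumsZ (k.+1%:R ^+ i) (GE _ (ar k))).
  apply: eq_sums => r; rewrite /sm mulr_sumr; apply: eq_bigr => k _.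
  have -> : - (a * k.+1%:R) * r.+1%:R = - (a * r.+1%:R) * k.+1%:R by ring.
  by ring.
Qed.

Lemma sums_bose2_le (l : nat) a0 : 0 < a0 -> exists2 K : R, 0 < K &
  forall a C (u : nat -> R), a0 <= a -> 0 < C ->
    (forall r, `|u r| <= C * (r.+1%:R ^+ l * bose2 (a * r.+1%:R))) ->
  exists2 s, sums u s & `|s| <= C * (K * expR (- a)).
Proof.
move=> a00; have [K K0 HK] := sums_bose2_dominated l a00; exists K => // a C u aa C0 uC.
have [|s ss sK] := HK a (fun r => C^-1 * u r) aa.
  by move=> r; rewrite normrM gtr0_norm ?invr_gt0// mulrC ler_pdivrMr// mulrC.
exists (C * s); last by rewrite normrM gtr0_norm// ler_pM2l.
by apply: eq_sums (sumsZ C ss) => r; rewrite mulVKf ?gt_eqF.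
Qed.

Lemma bose_approx : exists2 K : R, 0 < K & forall j x, (j <= 2)%N -> 0 < x ->
  `|bose j x - j`!%:R / x ^+ j.+1| <= K / x ^+ j.
Proof.
have [K K0 HK] := bose2_expand R; have e0 := expR_gt0 (1 : R).
exists (1 + 2 * expR 1 + K); first by rewrite !addr_gt0 ?mulr_gt0.
move=> [|[|[|//]]] x _ x0 /=; have x20 : 0 < x ^+ 2 by rewrite exprn_gt0.
- rewrite fact0 mul1r expr1 expr0 invr1 mulr1.
  have /andP[h1 h2] := bose0_bounds x0; rewrite distrC ger0_norm//; lra.
- rewrite expr1 mul1r; have /andP[h1 h2] := bose1_bounds x0.
  have [_ b1 _] := bose_gt0 x0; rewrite distrC ger0_norm// ler_pdivlMr//.
  have [x1|x1] := leP x 1.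
    apply: (@le_trans _ _ (2 * expR 1 * x)); first by rewrite ler_wpM2r// ltW.
    have : 2 * expR 1 * x <= 2 * expR 1 by rewrite ler_piMr// ltW// mulr_gt0.
    lra.
  apply: (@le_trans _ _ ((x ^+ 2)^-1 * x)).
    by rewrite ler_wpM2r ?(ltW x0)// gerBl ltW.
  rewrite expr2 invfM mulfVK ?gt_eqF//.
  have : x^-1 <= 1 by rewrite invf_le1// ltW.
  have : 0 < 2 * expR 1 :> R by rewrite mulr_gt0.
  lra.
- have [h _] := HK _ x0; have x3 : 0 < x ^+ 3 by rewrite exprn_gt0.
  have -> : bose2 x - 2`!%:R / x ^+ 3 = (x ^+ 3 * bose2 x - 2) / x ^+ 3.
    by rewrite (_ : 2`! = 2)//; field; rewrite gt_eqF.
  rewrite normrM (@gtr0_norm _ (x ^+ 3)^-1) ?invr_gt0// ler_pdivrMr//.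
  apply: le_trans h _.
  have -> : (1 + 2 * expR 1 + K) / x ^+ 2 * x ^+ 3 = (1 + 2 * expR 1 + K) * x.
    by field; rewrite gt_eqF.
  by rewrite ler_pM2r//; lra.
Qed.

Lemma pow_div_le i (r : nat) x : 0 <= x ->
  r.+1%:R ^+ i / r.+1%:R * x <= r.+1%:R ^+ i * x.
Proof.
move=> x0; rewrite ler_wpM2r// ler_pdivrMr// ler_peMr ?exprn_ge0//.
by rewrite ler1n.
Qed.

(** In the series of [grid_moment], [bose j (b r)] is replaced by its pole j! / (b r)^(j + 1). The
    powers of r left over rebuild [Phi_moment i]; the error of [bose_approx] is one power of b
    smaller and keeps the factor e^(-a). *)
Lemma grid_moment_approx a0 : 0 < a0 -> exists2 K : R, 0 < K &
  forall i j a b, (i + j <= 2)%N -> a0 <= a -> 0 < b -> exists2 s,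
    (fun M => \sum_(0 <= k < M) \sum_(0 <= l < M)
      k.+1%:R ^+ i * l.+1%:R ^+ j * bose_int (i + j) (a * k.+1%:R + b * l.+1%:R)) @ \oo --> s
    & `|s - j`!%:R * Phi_moment i a / b ^+ j.+1| <= K * expR (- a) / b ^+ j.
Proof.
move=> a00; have [K1 K10 HK1] := sums_bose2_le 2 a00.
have [K2 K20 HK2] := bose_approx.
exists (K2 * K1) => [|i j a b ij aa b0]; first exact: mulr_gt0.
have i2 : (i <= 2)%N := leq_trans (leq_addr _ _) ij.
have j2 : (j <= 2)%N := leq_trans (leq_addl _ _) ij.
have ag0 : 0 < a := lt_le_trans a00 aa.
have ar r : 0 < a * r.+1%:R by rewrite mulr_gt0.
have br r : 0 < b * r.+1%:R by rewrite mulr_gt0.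
have bj0 : 0 < b ^+ j by rewrite exprn_gt0.
pose d r := r.+1%:R ^+ (i + j) / r.+1%:R *
  (bose i (a * r.+1%:R) * (bose j (b * r.+1%:R) - j`!%:R / (b * r.+1%:R) ^+ j.+1)).
have [|r|t st tK] := HK1 a (K2 / b ^+ j) d aa; first by rewrite divr_gt0.
  have bi := bose_pos i (ar r).
  rewrite /d normrM ger0_norm ?divr_ge0 ?exprn_ge0// normrM (gtr0_norm bi).
  apply: (@le_trans _ _ (r.+1%:R ^+ (i + j) / r.+1%:R *
     (bose i (a * r.+1%:R) * (K2 / (b * r.+1%:R) ^+ j)))).
    by rewrite ler_wpM2l ?divr_ge0 ?exprn_ge0// ler_wpM2l ?(ltW bi)// HK2.
  have -> : r.+1%:R ^+ (i + j) / r.+1%:R * (bose i (a * r.+1%:R) * (K2 / (b * r.+1%:R) ^+ j)) =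
     K2 / b ^+ j * (r.+1%:R ^+ i / r.+1%:R * bose i (a * r.+1%:R)).
    rewrite exprD exprMn; have r0 : r.+1%:R != 0 :> R by [].
    have b0' : b != 0 by rewrite gt_eqF.
    by move: (bose i _) => w; move: (r.+1%:R : R) r0 => z z0; field; rewrite z0 !expf_neq0.
  rewrite ler_pM2l ?divr_gt0//; apply: le_trans (pow_div_le _ _ (ltW bi)) _.
  apply: ler_pM; rewrite ?exprn_ge0 ?(ltW bi)//; last exact: bose_le_bose2.
  by apply: ler_weXn2l => //; rewrite ler1n.
exists (j`!%:R * Phi_moment i a / b ^+ j.+1 + t); last first.
  rewrite addrAC subrr add0r; apply: le_trans tK _.
  by rewrite [leRHS](_ : _ = K2 / b ^+ j * (K1 * expR (- a)))//; ring.
apply: (@grid_moment (fun r => r.+1%:R ^+ (i + j) / r.+1%:R)) => //.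
- by move=> x x0; exact: sums_bose_int.
have := sumsD (sumsZ (j`!%:R / b ^+ j.+1) (sums_Phi_moment i2 ag0)) st.
rewrite mulrAC; apply: eq_sums => r; rewrite /d exprD exprMn !exprS expr0.
have r0 : r.+1%:R != 0 :> R by [].
have b0' : b != 0 by rewrite gt_eqF.
move: (bose i _) (bose j _) => w w'; move: (r.+1%:R : R) r0 => z z0.
by field; rewrite z0 b0' !expf_neq0.
Qed.

(** This sum is exponentiated, so an error O(1) would be too large: the second term - 1 / 2 of
    [bose0_expand] is kept and produces - Psi / 2. *)
Lemma grid_moment00 a0 : 0 < a0 -> exists2 K : R, 0 < K &
  forall a b, a0 <= a -> 0 < b -> exists2 s,
    (fun M => \sum_(0 <= k < M) \sum_(0 <= l < M) bose_log (a * k.+1%:R + b * l.+1%:R))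
       @ \oo --> s
    & `|s - (Phi a / b - Psi a / 2)| <= K * b.
Proof.
move=> a00; have [K1 K10 HK1] := sums_bose2_le 0 a00.
have e0 := expR_gt0 (1 : R).
exists (expR 1 * K1) => [|a b aa b0]; first exact: mulr_gt0.
have ag0 : 0 < a := lt_le_trans a00 aa.
have ar r : 0 < a * r.+1%:R by rewrite mulr_gt0.
have br r : 0 < b * r.+1%:R by rewrite mulr_gt0.
pose d r := r.+1%:R^-1 *
  (bose0 (a * r.+1%:R) * (bose0 (b * r.+1%:R) - (b * r.+1%:R)^-1 + 2^-1)).
have [|r|t st tK] := HK1 a (expR 1 * b) d aa; first by rewrite mulr_gt0.
  have [bi _ _] := bose_gt0 (ar r).
  rewrite /d normrM ger0_norm ?invr_ge0// normrM (gtr0_norm bi) expr0 mul1r.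
  apply: (@le_trans _ _ (r.+1%:R^-1 * (bose0 (a * r.+1%:R) * (expR 1 * (b * r.+1%:R))))).
    by rewrite ler_wpM2l ?invr_ge0// ler_wpM2l ?(ltW bi)// bose0_expand.
  have -> : r.+1%:R^-1 * (bose0 (a * r.+1%:R) * (expR 1 * (b * r.+1%:R))) =
     expR 1 * b * bose0 (a * r.+1%:R).
    have r0 : r.+1%:R != 0 :> R by [].
    by move: (bose0 _) => w; move: (r.+1%:R : R) r0 => z z0; field.
  by rewrite ler_pM2l ?mulr_gt0//; exact: (bose_le_bose2 0).
exists (Phi a / b - Psi a / 2 + t); last first.
  rewrite addrAC subrr add0r; apply: le_trans tK _.
  have -> : expR 1 * b * (K1 * expR (- a)) = expR 1 * K1 * b * expR (- a) by ring.
  by rewrite ler_piMr ?mulr_ge0 ?ltW// expR_lt1 oppr_lt0.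
apply: (@eq_cvgn _ (fun M => \sum_(0 <= k < M) \sum_(0 <= l < M)
    k.+1%:R ^+ 0 * l.+1%:R ^+ 0 * bose_int 0 (a * k.+1%:R + b * l.+1%:R))).
  move=> M; apply: eq_bigr => k _; apply: eq_bigr => l _.
  by rewrite !expr0 !mul1r.
apply: (@grid_moment (fun r => r.+1%:R ^+ 0 / r.+1%:R)) => //.
  by move=> x x0; exact: sums_bose_int.
have := sumsD (sumsB (sumsZ b^-1 (sums_Phi ag0)) (sumsZ 2^-1 (sums_Psi ag0))) st.
rewrite [b^-1 * _]mulrC [2^-1 * _]mulrC; apply: eq_sums => r; rewrite /d /Phi_term /Psi_term /=.
have r0 : r.+1%:R != 0 :> R by [].
have b0' : b != 0 by rewrite gt_eqF.
move: (bose0 _) (bose0 _) => w w'; move: (r.+1%:R : R) r0 => z z0.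
by field; rewrite z0 b0'.
Qed.

(* The moments of the parts [(k, 0)] on the first axis. *)
Lemma axis_moment_le a0 : 0 < a0 -> exists2 K : R, 0 < K &
  forall i a, (i <= 2)%N -> a0 <= a -> exists2 s,
    (fun M => \sum_(0 <= k < M) k.+1%:R ^+ i * bose_int i (a * k.+1%:R)) @ \oo --> s
    & `|s| <= K * expR (- a) /\ (i = 0%N -> s = Psi a).
Proof.
move=> a00; have [K1 K10 HK1] := sums_bose2_le 2 a00.
exists K1 => // i a i2 aa; have ag0 : 0 < a := lt_le_trans a00 aa.
have ar r : 0 < a * r.+1%:R by rewrite mulr_gt0.
have [|s ss sK] := HK1 a 1 (fun r => r.+1%:R ^+ i / r.+1%:R * bose i (a * r.+1%:R)) aa ltr01.
  move=> r; have bi := bose_pos i (ar r).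
  rewrite ger0_norm ?mulr_ge0 ?invr_ge0 ?exprn_ge0 ?(ltW bi)// mul1r.
  apply: le_trans (pow_div_le _ _ (ltW bi)) _.
  apply: ler_pM; rewrite ?exprn_ge0 ?(ltW bi)//; last exact: bose_le_bose2.
  by apply: ler_weXn2l => //; rewrite ler1n.
exists s.
  apply: (@axis_moment (fun r => r.+1%:R ^+ i / r.+1%:R)) => //.
  by move=> x x0; exact: sums_bose_int.
split; first by rewrite mul1r in sK.
move=> i0; rewrite {}i0 in ss; apply: (sums_unique ss).
by apply: eq_sums (sums_Psi ag0) => r; rewrite /Psi_term expr0 mul1r.
Qed.

End MomentLimits.

(** * Moments of the parts on the second axis *)

Section SecondAxis.
Variable R : realType.
Implicit Types (a b x : R).

(** Each term is below the increment of (b (1 + b i))^-1, which telescopes to 1 / b. *)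
Lemma sums_inv_sqr_shift b : 0 < b -> b <= 1 ->
  exists2 s, sums (fun i => ((1 + b * i.+1%:R) ^+ 2)^-1) s & `|s| <= b^-1.
Proof.
move=> b0 b1; pose v i : R := (1 + b * i%:R)^-1.
have p0 i : 0 < 1 + b * i%:R by rewrite ltr_pwDl// mulr_ge0// ltW.
have cv : v @ \oo --> 0.
  apply: (@cvg0_le _ _ (fun i => b^-1 * i.+1%:R^-1)).
    move=> i; rewrite ger0_norm ?invr_ge0 ?(ltW (p0 i))// -invfM.
    rewrite lef_pV2 ?posrE ?mulr_gt0// -natr1; lra.
  rewrite -[X in _ --> X](mulr0 b^-1); apply: cvgMr; exact: cvg_harmonic.
have st := sumsZ b^-1 (sums_telescope cv).
have v0 : v 0%N = 1 by rewrite /v mulr0 addr0 invr1.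
rewrite v0 mulr1 in st; apply: sums_dominated st => i.
rewrite ger0_norm ?invr_ge0 ?exprn_ge0 ?(ltW (p0 _))//.
have -> : b^-1 * (v i - v i.+1) = (1 + b * i%:R)^-1 * (1 + b * i.+1%:R)^-1.
  have := p0 i; have := p0 i.+1; rewrite /v -(natr1 i) => h1 h2.
  by field; rewrite !gt_eqF//.
rewrite expr2 invfM ler_wpM2r ?invr_ge0 ?(ltW (p0 _))// lef_pV2 ?posrE//.
by rewrite -(natr1 i); lra.
Qed.

(** The difference x^-2 - [bose1 x] is at most 8 e / (1 + x)^2, the first half of [bose1_bounds]
    serving for x > 1. Summed over x = b r this is O(1 / b), while x^-2 gives Basel's sum. *)
Lemma second_axis_moment1 : exists2 C : R, 0 < C & forall b, 0 < b -> b <= 1 ->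
  exists2 s, (fun M => \sum_(0 <= l < M) l.+1%:R * bose0 (b * l.+1%:R)) @ \oo --> s
    & `|s - pi ^+ 2 / 6 / b ^+ 2| <= C / b.
Proof.
have e0 := expR_gt0 (1 : R); have E1 : 1 <= expR 1 :> R by rewrite -expR0 ler_expR.
exists (8 * expR 1) => [|b b0 b1]; first by rewrite mulr_gt0.
have br r : 0 < b * r.+1%:R by rewrite mulr_gt0.
have [s1 ss1 s1b] := sums_inv_sqr_shift b0 b1.
have [||t st tb] := @sums_dominated R (fun r => ((b * r.+1%:R) ^+ 2)^-1 - bose1 (b * r.+1%:R))
    (fun r => 8 * expR 1 * ((1 + b * r.+1%:R) ^+ 2)^-1) (8 * expR 1 * s1).
- move=> r; move: (b * r.+1%:R) (br r) => x x0.
  have /andP[h1 h2] := bose1_bounds x0; have [_ p1 _] := bose_gt0 x0.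
  rewrite ger0_norm// ler_pdivlMr ?exprn_gt0//; last lra.
  have [x1|x1] := leP x 1.
    apply: (@le_trans _ _ (2 * expR 1 * 4)); last lra.
    apply: ler_pM => //; first exact: sqr_ge0.
    by nra.
  apply: (@le_trans _ _ ((x ^+ 2)^-1 * (4 * x ^+ 2))).
    apply: ler_pM => //; first exact: sqr_ge0.
      by rewrite gerBl ltW.
    by nra.
  rewrite mulrCA mulVf ?gt_eqF ?exprn_gt0//; lra.
- exact: sumsZ.
have ss := sumsB (sumsZ (b ^+ 2)^-1 (@basel R)) st.
exists ((b ^+ 2)^-1 * (pi ^+ 2 / 6) - t); last first.
  rewrite [(b ^+ 2)^-1 * _]mulrC addrAC subrr add0r normrN.
  apply: le_trans tb _; rewrite ler_wpM2l//.
  exact: le_trans (ler_norm _) s1b.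
apply: (@eq_cvgn _ (fun M => \sum_(0 <= k < M) k.+1%:R ^+ 1 * bose_int 1 (b * k.+1%:R))).
  by move=> M; apply: eq_bigr => k _.
apply: (@axis_moment _ (fun r => r.+1%:R ^+ 1 / r.+1%:R)) => //.
  by move=> x x0; exact: sums_bose_int.
apply: eq_sums ss => r; have -> : (b ^+ 2)^-1 * (r.+1%:R ^+ 2)^-1 = ((b * r.+1%:R) ^+ 2)^-1.
  by rewrite exprMn [RHS]invfM.
by rewrite opprB addrCA subrr addr0 expr1 mulfV// mul1r.
Qed.

(** As b tends to 0, x^3 [bose2 x] at x = b r tends to 2 and stays bounded; Basel's series is the
    majorant and the limit is 2 pi^2 / 6. *)
Lemma second_axis_moment2 (b : nat -> R) : (forall k, 0 < b k) -> b @ \oo --> 0 ->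
  exists2 s : nat -> R,
    forall k, (fun M => \sum_(0 <= l < M) l.+1%:R ^+ 2 * bose1 (b k * l.+1%:R)) @ \oo --> s k
    & (fun k => b k ^+ 3 * s k) @ \oo --> pi ^+ 2 / 3.
Proof.
move=> b0 cb; have [K K0 HK] := bose2_expand R.
have br k r : 0 < b k * r.+1%:R by rewrite mulr_gt0.
have ex k : exists s, sums (fun r => r.+1%:R ^+ 2 / r.+1%:R * bose 2 (b k * r.+1%:R)) s.
  have [K1 K10 HK1] := sums_bose2_le 1 (b0 k).
  have [|s ss _] := HK1 (b k) 1 (fun r => r.+1%:R ^+ 2 / r.+1%:R * bose 2 (b k * r.+1%:R)) (lexx _) ltr01.
    move=> r; have [_ _ p2] := bose_gt0 (br k r).
    rewrite expr2 mulfK// expr1 mul1r ger0_norm//.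
    by apply: mulr_ge0 => //; exact: ltW.
  by exists s.
have [s Hs] := choice ex; exists s.
  move=> k; apply: (@axis_moment _ (fun r => r.+1%:R ^+ 2 / r.+1%:R) (bose_int 2)) => //.
  by move=> x x0; exact: sums_bose_int.
have E k r : b k ^+ 3 * (r.+1%:R ^+ 2 / r.+1%:R * bose 2 (b k * r.+1%:R)) =
    (r.+1%:R ^+ 2)^-1 * ((b k * r.+1%:R) ^+ 3 * bose2 (b k * r.+1%:R)).
  have r0 : r.+1%:R != 0 :> R by [].
  rewrite /=; move: (bose2 _) => w; move: (r.+1%:R : R) r0 => z z0.
  by field.
have := sumsZ 2 (@basel R).
have -> : 2 * (pi ^+ 2 / 6) = pi ^+ 2 / 3 :> R by lra.
apply: (@tannery _ (fun k r => b k ^+ 3 * (r.+1%:R ^+ 2 / r.+1%:R * bose 2 (b k * r.+1%:R)))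
  _ _ _ _ _ _ (sumsZ K (@basel R)) _ (fun k => sumsZ (b k ^+ 3) (Hs k))).
- move=> k r; have [_ h] := HK _ (br k r); have [_ _ p2] := bose_gt0 (br k r).
  have f0 : 0 <= (b k * r.+1%:R) ^+ 3 * bose2 (b k * r.+1%:R).
    by apply: mulr_ge0; [apply: exprn_ge0|]; exact: ltW.
  rewrite E ger0_norm; last by apply: mulr_ge0 => //; rewrite invr_ge0 exprn_ge0.
  by rewrite mulrC ler_wpM2r// invr_ge0 exprn_ge0.
- move=> r; apply: cvg_dist0.
  apply: (@cvg0_le _ _ (fun k => (r.+1%:R ^+ 2)^-1 * (K * r.+1%:R) * b k)).
    move=> k; have [h _] := HK _ (br k r).
    rewrite E [2 * _]mulrC -mulrBr normrM ger0_norm ?invr_ge0 ?exprn_ge0//.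
    rewrite -mulrA ler_wpM2l ?invr_ge0 ?exprn_ge0//; apply: le_trans h _.
    by rewrite [leRHS]mulrAC mulrA.
  by rewrite -[X in _ --> X](mulr0 ((r.+1%:R ^+ 2)^-1 * (K * r.+1%:R))); apply: cvgMr.
Qed.

End SecondAxis.

(** * The cubic error term *)

Section ThirdMoment.
Variable R : realType.
Implicit Types (a b x : R).

Lemma sum_expRN_le b M : 0 < b -> \sum_(0 <= l < M) expR (- b * l.+1%:R) <= b^-1.
Proof.
move=> b0; apply: le_trans (bose0_le_inv b0).
by apply: le_partial_sums (sums_bose0 b0) _ => i; exact: expR_ge0.
Qed.

Lemma sum_exp_moment_le a0 : 0 < a0 -> exists2 K : R, 0 < K & forall (i : nat) a M, (i <= 3)%N ->
  a0 <= a -> \sum_(0 <= k < M) k.+1%:R ^+ i * expR (- a * k.+1%:R) <= K * expR (- a).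
Proof.
move=> a00; have [K K0 HK] := sums_bose2_dominated 3 a00; exists K => // i a M i3 aa.
have ag0 : 0 < a := lt_le_trans a00 aa.
have ar r : 0 < a * r.+1%:R by rewrite mulr_gt0.
have t0 r : 0 <= r.+1%:R ^+ i * expR (- a * r.+1%:R) :> R by rewrite mulr_ge0 ?exprn_ge0 ?expR_ge0.
have [|s ss sK] := HK a (fun r => r.+1%:R ^+ i * expR (- a * r.+1%:R)) aa.
  move=> r; rewrite ger0_norm//; apply: ler_pM; rewrite ?exprn_ge0 ?expR_ge0//.
    by apply: ler_weXn2l => //; rewrite ler1n.
  rewrite mulNr; have [h0 h1 h2] := bose_le (ar r).
  by apply: le_trans h0 _; apply: le_trans h1 h2.
apply: le_trans (le_partial_sums M ss t0) _.
exact: le_trans (ler_norm _) sK.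
Qed.

Lemma cube_exp_le : exists2 K : R, 0 < K & forall x, 0 < x ->
  x ^+ 3 * (expR (- x) / (1 - expR (- x)) ^+ 3) <= K * expR (- (x / 2)).
Proof.
have h0 : 0 < 2^-1 :> R by [].
have [K K0 HK] := exprn_le_expR 3 h0.
exists (K * expR 2^-1) => [|x x0]; first by rewrite mulr_gt0 ?expR_gt0.
have q1 := subr_expRN_gt0 x0; have h := le_mul_subr_expRN x0.
apply: (@le_trans _ _ ((1 + x) ^+ 3 * expR (- x))).
  rewrite mulrA ler_pdivrMr ?exprn_gt0// [leRHS]mulrAC ler_wpM2r ?expR_ge0// -exprMn.
  by rewrite lerXn2r ?nnegrE ?(ltW x0)// mulr_ge0 ?(ltW q1)//; lra.
apply: (@le_trans _ _ (K * expR (2^-1 * (1 + x)) * expR (- x))).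
  by rewrite ler_wpM2r ?expR_ge0// HK//; lra.
rewrite -!mulrA ler_wpM2l ?(ltW K0)// -!expRD ler_expR; lra.
Qed.

Lemma sum_cube_exp_le : exists2 K : R, 0 < K & forall b M, 0 < b ->
  \sum_(0 <= l < M) l.+1%:R ^+ 3 * (expR (- (b * l.+1%:R)) / (1 - expR (- (b * l.+1%:R))) ^+ 3)
    <= K / b ^+ 4.
Proof.
have [K K0 HK] := cube_exp_le; exists (2 * K) => [|b M b0]; first by rewrite mulr_gt0.
have b2 : 0 < b / 2 by rewrite divr_gt0.
apply: (@le_trans _ _ (K / b ^+ 3 * \sum_(0 <= l < M) expR (- (b / 2) * l.+1%:R))).
  rewrite mulr_sumr; apply: ler_sum => l _; have bl : 0 < b * l.+1%:R by rewrite mulr_gt0.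
  have := HK _ bl; rewrite exprMn.
  have -> : - (b * l.+1%:R / 2) = - (b / 2) * l.+1%:R by ring.
  move: (expR _ / _) => F; move: (l.+1%:R ^+ 3) (expR _) => z w h.
  rewrite [leRHS]mulrAC ler_pdivlMr ?exprn_gt0//; apply: le_trans h.
  by rewrite le_eqVlt; apply/orP; left; apply/eqP; ring.
have -> : 2 * K / b ^+ 4 = K / b ^+ 3 * (b / 2)^-1 by field; rewrite gt_eqF.
by rewrite ler_pM2l ?divr_gt0 ?exprn_gt0// sum_expRN_le.
Qed.

Lemma cube_sum_le x (y : R) : 0 <= x -> 0 <= y -> (x + y) ^+ 3 <= 4 * (x ^+ 3 + y ^+ 3).
Proof.
move=> x0 y0; rewrite -subr_ge0.
have -> : 4 * (x ^+ 3 + y ^+ 3) - (x + y) ^+ 3 = 3 * ((x + y) * (x - y) ^+ 2) by ring.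
by apply: mulr_ge0 => //; apply: mulr_ge0; [exact: addr_ge0|exact: sqr_ge0].
Qed.

(** Away from the second axis rho <= e^(- a0), so (1 - rho)^-3 is bounded and only exponential
    moments remain. On the second axis rho may approach 1, and x^3 / (1 - e^(-x))^3 <= (1 + x)^3
    with x = b l takes over. *)
Lemma third_moment_le a0 : 0 < a0 -> exists2 K : R, 0 < K &
  forall (ax : bool) M (a b sg ta : R), a0 <= a -> 0 < b -> 0 < sg -> 0 < ta ->
  \sum_(x <- parts ax M) wtp a b x / (1 - wtp a b x) ^+ 3 * (x.1%:R / sg + x.2%:R / ta) ^+ 3
  <= K * (expR (- a) / b / sg ^+ 3 + expR (- a) / b ^+ 4 / ta ^+ 3 +
          ax%:R * (expR (- a) / sg ^+ 3 + (b ^+ 4 * ta ^+ 3)^-1)).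
Proof.
move=> a00; have [K1 K10 HK1] := sum_exp_moment_le a00.
have [K2 K20 HK2] := sum_cube_exp_le.
have q0 := subr_expRN_gt0 a00; set q := 1 - expR (- a0) in q0.
pose C := (q ^+ 3)^-1; have C0 : 0 < C by rewrite invr_gt0 exprn_gt0.
have C1 : 1 <= C.
  by rewrite invf_ge1 ?exprn_gt0// exprn_ile1 ?(ltW q0)// gerBl expR_ge0.
exists (4 * C * (1 + K1) * (1 + K2)).
  by apply: mulr_gt0; [apply: mulr_gt0; [exact: mulr_gt0|]|]; rewrite addr_gt0.
move=> ax M a b sg ta aa b0 sg0 ta0; have ag0 : 0 < a := lt_le_trans a00 aa.
have wE (k l : nat) : wtp a b (k, l) = expR (- a * k%:R) * expR (- b * l%:R).
  by rewrite -expRD /wtp /wt; congr expR => /=; ring.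
have w1 k l : wtp a b (k.+1, l) / (1 - wtp a b (k.+1, l)) ^+ 3 <= C * wtp a b (k.+1, l).
  have h : wtp a b (k.+1, l) <= expR (- a0).
    rewrite /wtp /wt ler_expR lerN2/=; have : 0 <= b * l%:R by rewrite mulr_ge0 ?(ltW b0).
    by have : 0 <= a * k%:R by [rewrite mulr_ge0 ?(ltW ag0)]; rewrite -(natr1 k); lra.
  have h2 : q <= 1 - wtp a b (k.+1, l) by rewrite /q; lra.
  have h3 := lt_le_trans q0 h2.
  rewrite mulrC ler_wpM2r ?expR_ge0// lef_pV2 ?posrE ?exprn_gt0//.
  by rewrite lerXn2r ?nnegrE ?(ltW q0) ?(ltW h3).
have e0 := expR_gt0 (- a).
pose sm (i : nat) x := \sum_(0 <= k < M) k.+1%:R ^+ i * expR (- x * k.+1%:R) : R.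
have sm0 i x : 0 <= sm i x by rewrite sumr_ge0// => r _; rewrite mulr_ge0 ?exprn_ge0 ?expR_ge0.
have sa i : (i <= 3)%N -> sm i a <= K1 * expR (- a) by move=> i3; exact: HK1.
have sb0 : sm 0%N b <= b^-1.
  apply: le_trans (sum_expRN_le M b0); apply: ler_sum => k _.
  by rewrite expr0 mul1r.
have sb3 : sm 3 b <= K2 / b ^+ 4.
  apply: le_trans (HK2 b M b0); apply: ler_sum => k _.
  have bk : 0 < b * k.+1%:R by rewrite mulr_gt0.
  have q1 := subr_expRN_gt0 bk.
  rewrite ler_wpM2l ?exprn_ge0// mulNr ler_peMr ?expR_ge0// invf_ge1 ?exprn_gt0//.
  by rewrite exprn_ile1 ?(ltW q1)// gerBl expR_ge0.
have X0 : 0 <= sg ^- 3 by rewrite invr_ge0 exprn_ge0 ?ltW.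
have Y0 : 0 <= ta ^- 3 by rewrite invr_ge0 exprn_ge0 ?ltW.
rewrite big_parts [leRHS]mulrDr; apply: lerD.
  apply: (@le_trans _ _ (4 * C * (sm 3 a * sm 0%N b / sg ^+ 3 + sm 0%N a * sm 3 b / ta ^+ 3))).
    rewrite /sm !mulr_suml mulrDr !mulr_sumr -big_split/=; apply: ler_sum => k _.
    rewrite !mulr_sumr !mulr_suml !mulr_sumr -big_split/=; apply: ler_sum => l _.
    have s0 : 0 <= k.+1%:R / sg by rewrite divr_ge0 ?ltW.
    have t0 : 0 <= l.+1%:R / ta by rewrite divr_ge0 ?ltW.
    apply: (@le_trans _ _ (C * wtp a b (k.+1, l.+1) * (4 * ((k.+1%:R / sg) ^+ 3 + (l.+1%:R / ta) ^+ 3)))).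
      apply: ler_pM; rewrite ?exprn_ge0 ?addr_ge0 ?cube_sum_le//.
      rewrite divr_ge0 ?expR_ge0// exprn_ge0// subr_ge0 /wtp /wt expR_le1 oppr_le0.
      by apply: addr_ge0; apply: mulr_ge0 => //; exact: ltW.
    rewrite wE !exprMn !exprVn !expr0 !mul1r le_eqVlt; apply/orP; left; apply/eqP.
    by ring.
  have -> : 4 * C * (1 + K1) * (1 + K2) * (expR (- a) / b / sg ^+ 3 + expR (- a) / b ^+ 4 / ta ^+ 3) =
    4 * C * ((1 + K1) * (1 + K2) * expR (- a) / b / sg ^+ 3 + (1 + K1) * (1 + K2) * expR (- a) / b ^+ 4 / ta ^+ 3).
    by ring.
  have b40 : 0 < (b ^+ 4)^-1 by rewrite invr_gt0 exprn_gt0.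
  have ib0 : 0 < b^-1 by rewrite invr_gt0.
  rewrite ler_wpM2l ?mulr_ge0 ?(ltW C0)//; apply: lerD; rewrite ler_wpM2r//.
    apply: (@le_trans _ _ (K1 * expR (- a) / b)); first by apply: ler_pM => //; exact: sa.
    rewrite ler_wpM2r ?(ltW ib0)// ler_wpM2r ?(ltW e0)//; nra.
  apply: (@le_trans _ _ (K1 * expR (- a) * (K2 / b ^+ 4))); first by apply: ler_pM => //; exact: sa.
  rewrite mulrA ler_wpM2r ?(ltW b40)// mulrAC ler_wpM2r ?(ltW e0)//; nra.
rewrite mulrCA; apply: ler_wpM2l; first exact: ler0n.
rewrite mulrDr; apply: lerD.
  apply: (@le_trans _ _ (C * sm 3 a / sg ^+ 3)).
    rewrite /sm mulr_sumr mulr_suml; apply: ler_sum => k _.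
    rewrite /= mul0r addr0 exprMn exprVn.
    have -> : C * (k.+1%:R ^+ 3 * expR (- a * k.+1%:R)) / sg ^+ 3 =
       C * wtp a b (k.+1, 0%N) * (k.+1%:R ^+ 3 / sg ^+ 3) by rewrite wE mulr0 expR0; ring.
    by apply: ler_wpM2r; [rewrite mulr_ge0 ?exprn_ge0|exact: w1].
  rewrite mulrA ler_wpM2r//; have s3 := sa 3%N isT.
  apply: (@le_trans _ _ (C * (K1 * expR (- a)))); first by rewrite ler_wpM2l ?(ltW C0).
  rewrite mulrA ler_wpM2r ?(ltW e0)//.
  have : C * K1 <= C * ((1 + K1) * (1 + K2)) by rewrite ler_pM2l//; nra.
  have : 0 <= C * ((1 + K1) * (1 + K2)) by rewrite !mulr_ge0 ?addr_ge0 ?(ltW C0) ?(ltW K10) ?(ltW K20).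
  lra.
apply: (@le_trans _ _ ((\sum_(0 <= l < M) l.+1%:R ^+ 3 *
    (expR (- (b * l.+1%:R)) / (1 - expR (- (b * l.+1%:R))) ^+ 3)) / ta ^+ 3)).
  rewrite mulr_suml; apply: ler_sum => l _.
  rewrite /= mul0r add0r exprMn exprVn wE mulr0 expR0 mul1r mulNr le_eqVlt; apply/orP; left; apply/eqP.
  by ring.
rewrite [(b ^+ 4 * _)^-1]invfM [leRHS]mulrA ler_wpM2r//; apply: le_trans (HK2 b M b0) _.
rewrite ler_wpM2r ?invr_ge0 ?exprn_ge0 ?(ltW b0)//.
have : 1 * K2 <= C * (1 + K2) by apply: ler_pM => //; lra.
have : 0 <= C * (1 + K2) by rewrite mulr_ge0 ?addr_ge0 ?(ltW C0) ?(ltW K20).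
by nra.
Qed.

End ThirdMoment.

(** * Decay of the modulus on the whole domain of integration *)

Section DropLowerBound.
Variable R : realType.
Implicit Types (a b s t : R).

(** [minor_arc] with H the integer part of 1 / b: for j + 1 <= 2 H the weight is at least e^-2. The
    constant 1280 is 160 * 2 * 4, with 160 from [minor_arc], 2 from H >= 1 / (2 b), and 4 from
    passing from H t to t / b. *)
Lemma sum_cos_lb b s t M : 0 < b -> b <= 1 -> `|s| <= pi -> `|t| <= pi -> 2 / b <= M%:R ->
  expR (- 2) / 1280 / b * (s ^+ 2 + Num.min 1 ((t / b) ^+ 2)) <=
  \sum_(0 <= j < M) expR (- b * j.+1%:R) * (1 - cos (s + t * j.+1%:R)).
Proof.
move=> b0 b1 sp tp bM; have ib0 : 0 < b^-1 by rewrite invr_gt0.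
have ib1 : 1 <= b^-1 by rewrite invf_ge1.
pose H := Num.truncn b^-1.
have /andP[H1 H2] : H%:R <= b^-1 < H.+1%:R by exact: truncn_itv (ltW ib0).
have H0 : (0 < H)%N by rewrite truncn_gt0.
have H0' : 1 <= H%:R :> R by rewrite ler1n.
have H3 : b^-1 / 2 <= H%:R by move: H2; rewrite -natr1; lra.
have HM : (H.*2 <= M)%N.
  by rewrite -(ler_nat R) -mul2n natrM; apply: le_trans bM; lra.
have bH : b * H%:R <= 1 by rewrite mulrC -ler_pdivlMr// mul1r.
have f0 j : 0 <= expR (- b * j.+1%:R) * (1 - cos (s + t * j.+1%:R)).
  by rewrite mulr_ge0 ?expR_ge0 ?subr_cos_ge0.
apply: le_trans (le_sum_subrange 0 f0 HM).
apply: (@le_trans _ _ (expR (- 2) * \sum_(0 <= j < H.*2) (1 - cos (s + t * j.+1%:R)))); last first.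
  rewrite mulr_sumr; apply: ler_sum_nat => j /andP[_ jH].
  rewrite ler_wpM2r ?subr_cos_ge0// ler_expR mulNr lerN2.
  have : b * j.+1%:R <= b * (H.*2)%:R by rewrite ler_wpM2l ?(ltW b0)// ler_nat.
  by rewrite -mul2n natrM; lra.
have := minor_arc H0 sp tp.
set S := \sum_(_ <= _ < _) _ => h.
have e0 := expR_gt0 (- 2 : R).
apply: le_trans (ler_wpM2l (ltW e0) h).
have m1 : Num.min 1 ((t / b) ^+ 2) / 4 <= Num.min 1 ((H%:R * t) ^+ 2).
  rewrite le_min; apply/andP; split.
    have : Num.min 1 ((t / b) ^+ 2) <= 1 by rewrite ge_min lexx.
    lra.
  apply: (@le_trans _ _ ((t / b) ^+ 2 / 4)); first by rewrite ler_wpM2r// ge_min lexx orbT.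
  have -> : (t / b) ^+ 2 / 4 = (b^-1 / 2) ^+ 2 * t ^+ 2 by field; rewrite gt_eqF.
  rewrite [leRHS]exprMn ler_wpM2r ?sqr_ge0// lerXn2r ?nnegrE//; lra.
have m0 : 0 <= Num.min 1 ((t / b) ^+ 2) by rewrite le_min ler01 sqr_ge0.
have s0 := sqr_ge0 s.
have h4 : b^-1 / 2 * ((s ^+ 2 + Num.min 1 ((t / b) ^+ 2)) / 4) <=
  H%:R * (s ^+ 2 + Num.min 1 ((H%:R * t) ^+ 2)).
  by apply: ler_pM => //; lra.
have -> : expR (- 2) / 1280 / b * (s ^+ 2 + Num.min 1 ((t / b) ^+ 2)) =
  expR (- 2) * (b^-1 / 2 * ((s ^+ 2 + Num.min 1 ((t / b) ^+ 2)) / 4) / 160).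
  by move: (Num.min _ _) => m; field; rewrite gt_eqF.
by rewrite ler_wpM2l ?(ltW e0)// ler_wpM2r.
Qed.

(** One row of parts already gives the decay in both variables. The second axis, when present, adds
    decay in the second variable without the factor e^(-a), matching the larger variance there. *)
Lemma lmod_drop_sum_lb : exists2 c : R, 0 < c & forall (ax : bool) M (a b sg ta : R) p,
  0 < a -> 0 < b -> b <= 1 -> 0 < sg -> 0 < ta -> 2 / b <= M%:R ->
  `|p.1| <= pi * sg -> `|p.2| <= pi * ta ->
  c / b * (expR (- a) * (p.1 / sg) ^+ 2 +
     (expR (- a) + ax%:R) * Num.min 1 ((p.2 / (ta * b)) ^+ 2)) <=
  \sum_(x <- parts ax M) lmod_drop (wtp a b x) (phase sg ta x p).
Proof.
have e2 := expR_gt0 (- 2 : R).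
exists (expR (- 2) / 1280 / 4).
  by apply: divr_gt0; [apply: divr_gt0; [exact: e2|rewrite ltr0n]|rewrite ltr0n].
move=> ax M a b sg ta p a0 b0 b1 sg0 ta0 bM p1 p2.
pose s := p.1 / sg; pose t := p.2 / ta.
have sp : `|s| <= pi by rewrite /s normrM (@gtr0_norm _ sg^-1) ?invr_gt0// ler_pdivrMr.
have tp : `|t| <= pi by rewrite /t normrM (@gtr0_norm _ ta^-1) ?invr_gt0// ler_pdivrMr.
have tb : p.2 / (ta * b) = t / b by rewrite /t invfM mulrA.
have wE (k l : nat) : wtp a b (k, l) = expR (- a * k%:R) * expR (- b * l%:R).
  by rewrite -expRD /wtp /wt; congr expR => /=; ring.
have w01 x : Zsq_nz x -> 0 <= wtp a b x < 1.
  move=> x0; rewrite expR_ge0/= expR_lt1 oppr_lt0.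
  by case: x x0 => [[|k] [|l]] //= _; rewrite ?mulr0 ?add0r ?addr0 ?addr_gt0 ?mulr_gt0.
have phE (k l : nat) : phase sg ta (k, l) p = s * k%:R + t * l%:R.
  by rewrite /phase /wave /s /t /=; ring.
have drop0 x : Zsq_nz x -> 0 <= lmod_drop (wtp a b x) (phase sg ta x p).
  move=> x0; apply: le_trans (lmod_drop_ge _ (w01 _ x0)).
  by rewrite mulr_ge0// mulr_ge0 ?subr_cos_ge0 ?expR_ge0.
rewrite tb; set m := Num.min 1 _.
have m0 : 0 <= m by rewrite le_min ler01 sqr_ge0.
have zero_le_pi : `|0 : R| <= pi by rewrite normr0 pi_ge0.
rewrite big_parts.
have M0 : (0 < M)%N.
  rewrite -(ltr_nat R); apply: lt_le_trans bM; exact: divr_gt0.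
have h1 : expR (- a) * (expR (- 2) / 1280 / b * (s ^+ 2 + m)) / 4 <=
   \sum_(0 <= i < M) \sum_(0 <= j < M)
      lmod_drop (wtp a b (i.+1, j.+1)) (phase sg ta (i.+1, j.+1) p).
  (* Only the parts (1, j) are kept; the other drops are nonnegative. *)
  rewrite big_ltn//; apply: (@le_trans _ _ (\sum_(0 <= j < M)
      lmod_drop (wtp a b (1%N, j.+1)) (phase sg ta (1%N, j.+1) p))); last first.
    by rewrite lerDl; do 2!apply: sumr_ge0 => ? _; exact: drop0.
  have h := sum_cos_lb b0 b1 sp tp bM.
  apply: le_trans (ler_wpM2r _ (ler_wpM2l (expR_ge0 (- a)) h)) _ => //.
  rewrite mulr_sumr mulr_suml; apply: ler_sum => j _.
  have := lmod_drop_ge (phase sg ta (1%N, j.+1) p) (w01 (1%N, j.+1) isT).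
  apply: le_trans; rewrite wE phE le_eqVlt; apply/orP; left; apply/eqP.
  by rewrite !mulr1; ring.
have h2 : expR (- 2) / 1280 / b * m / 4 <= \sum_(0 <= j < M)
      lmod_drop (wtp a b (0%N, j.+1)) (phase sg ta (0%N, j.+1) p).
  have := sum_cos_lb b0 b1 zero_le_pi tp bM; rewrite expr0n add0r => h.
  apply: le_trans (ler_wpM2r _ h) _ => //.
  rewrite mulr_suml; apply: ler_sum => j _.
  have := lmod_drop_ge (phase sg ta (0%N, j.+1) p) (w01 (0%N, j.+1) isT).
  apply: le_trans; rewrite wE phE le_eqVlt; apply/orP; left; apply/eqP.
  by rewrite !mulr0 expR0; ring.
have h3 : 0 <= \sum_(0 <= i < M) lmod_drop (wtp a b (i.+1, 0%N)) (phase sg ta (i.+1, 0%N) p).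
  by apply: sumr_ge0 => i _; exact: drop0.
have -> : expR (- 2) / 1280 / 4 / b * (expR (- a) * s ^+ 2 + (expR (- a) + ax%:R) * m) =
   expR (- a) * (expR (- 2) / 1280 / b * (s ^+ 2 + m)) / 4 +
   ax%:R * (expR (- 2) / 1280 / b * m / 4) by ring.
apply: lerD => //; rewrite ler_wpM2l ?ler0n//; lra.
Qed.

End DropLowerBound.

(** * Moments over all parts, uniform in both cases *)

Section PartMoments.
Variable R : realType.
Implicit Types (a b : R) (ax : bool).

Lemma parts_cvg ax (F : nat * nat -> R) (s s1 s2 : R) :
  (fun M => \sum_(0 <= k < M) \sum_(0 <= l < M) F (k.+1, l.+1)) @ \oo --> s ->
  (fun M => \sum_(0 <= k < M) F (k.+1, 0%N)) @ \oo --> s1 ->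
  (fun M => \sum_(0 <= l < M) F (0%N, l.+1)) @ \oo --> s2 ->
  (fun M => \sum_(x <- parts ax M) F x) @ \oo --> s + ax%:R * (s1 + s2).
Proof.
move=> h h1 h2; have := cvgnD h (cvgnZ (c := ax%:R) (cvgnD h1 h2)).
by apply: eq_cvgn => M; rewrite big_parts.
Qed.

Lemma sum0_cvg (F : nat -> R) : (forall k, F k = 0) ->
  (fun M => \sum_(0 <= k < M) F k) @ \oo --> 0.
Proof.
by move=> F0; apply: eq_cvgn (cvg_cst 0) => M; rewrite big1.
Qed.

Lemma bool01 ax : 0 <= (ax%:R : R) <= 1.
Proof. by case: ax; rewrite ler01 lexx. Qed.

Lemma parts_log_moment a0 : 0 < a0 -> exists2 K : R, 0 < K & forall ax a b, a0 <= a -> 0 < b ->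
  exists2 s, (fun M => \sum_(x <- parts ax M) bose_log (a * x.1%:R + b * x.2%:R)) @ \oo --> s
    & `|s - (Phi a / b - Psi a / 2 + ax%:R * (Psi a + eta_log b))| <= K * b.
Proof.
move=> a00; have [K K0 HK] := grid_moment00 a00; have [K' _ HK'] := axis_moment_le a00.
exists K => // ax a b aa b0; have [s cs sK] := HK a b aa b0.
have [s1 cs1 [_ s1P]] := HK' 0%N a isT aa.
have se : (fun M => \sum_(0 <= l < M) bose_log (b * l.+1%:R)) @ \oo --> eta_log b.
  by apply: eq_cvgn (sums_eta_log b0) => M; rewrite seriesE.
exists (s + ax%:R * (s1 + eta_log b)).
  apply: parts_cvg => //.
    apply: eq_cvgn cs1 => M; apply: eq_bigr => k _.
    by rewrite expr0 mul1r mulr0 addr0.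
  by apply: eq_cvgn se => M; apply: eq_bigr => k _; rewrite /= mulr0 add0r.
by rewrite s1P// opprD addrACA subrr addr0.
Qed.

Lemma parts_mean1 a0 : 0 < a0 -> exists2 K : R, 0 < K & forall ax a b, a0 <= a -> 0 < b ->
  exists2 s, (fun M => \sum_(x <- parts ax M) x.1%:R * bose0 (a * x.1%:R + b * x.2%:R)) @ \oo --> s
    & `|s - P1 a / b| <= K * expR (- a).
Proof.
move=> a00; have [K K0 HK] := grid_moment_approx a00; have [K' K'0 HK'] := axis_moment_le a00.
exists (K + K') => [|ax a b aa b0]; first exact: addr_gt0.
have [s cs sK] := HK 1%N 0%N a b isT aa b0.
have [s1 cs1 [s1K _]] := HK' 1%N a isT aa.
exists (s + ax%:R * (s1 + 0)).
  apply: parts_cvg.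
  - apply: eq_cvgn cs => M; apply: eq_bigr => k _; apply: eq_bigr => l _.
    by rewrite expr1 mulr1.
  - apply: eq_cvgn cs1 => M; apply: eq_bigr => k _.
    by rewrite expr1 mulr0 addr0.
  - by apply: sum0_cvg => k; rewrite mul0r.
rewrite fact0 mul1r expr1 expr0 divr1 in sK.
have /andP[x0 x1] := bool01 ax.
have h : `|ax%:R * s1| <= K' * expR (- a).
  by rewrite normrM (ger0_norm x0); apply: le_trans s1K; rewrite ler_piMl.
rewrite addr0 mulrDl addrAC; apply: le_trans (ler_normD _ _) _; exact: lerD.
Qed.

Lemma parts_mean2 a0 : 0 < a0 -> exists2 K : R, 0 < K & forall ax a b, a0 <= a -> 0 < b -> b <= 1 ->
  exists2 s, (fun M => \sum_(x <- parts ax M) x.2%:R * bose0 (a * x.1%:R + b * x.2%:R)) @ \oo --> s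
    & `|s - (Phi a + ax%:R * (pi ^+ 2 / 6)) / b ^+ 2| <= K / b.
Proof.
move=> a00; have [K K0 HK] := grid_moment_approx a00; have [K' K'0 HK'] := second_axis_moment1 R.
exists (K + K') => [|ax a b aa b0 b1]; first exact: addr_gt0.
have [s cs sK] := HK 0%N 1%N a b isT aa b0.
have [s1 cs1 s1K] := HK' b b0 b1.
exists (s + ax%:R * (0 + s1)).
  apply: parts_cvg.
  - apply: eq_cvgn cs => M; apply: eq_bigr => k _; apply: eq_bigr => l _.
    by rewrite expr0 expr1 mul1r.
  - by apply: sum0_cvg => k; rewrite mul0r.
  - by apply: eq_cvgn cs1 => M; apply: eq_bigr => k _; rewrite /= mulr0 add0r.
rewrite mul1r expr1 /= in sK.
have /andP[x0 x1] := bool01 ax.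
have ib : 0 < b^-1 by rewrite invr_gt0.
have h : `|ax%:R * (s1 - pi ^+ 2 / 6 / b ^+ 2)| <= K' / b.
  by rewrite normrM (ger0_norm x0); apply: le_trans s1K; rewrite ler_piMl.
have h2 : `|s - Phi a / b ^+ 2| <= K / b.
  apply: le_trans sK _; rewrite ler_pM2r// ler_piMr ?(ltW K0)//.
  by rewrite expR_le1 oppr_le0 (le_trans (ltW a00)).
have -> : s + ax%:R * (0 + s1) - (Phi a + ax%:R * (pi ^+ 2 / 6)) / b ^+ 2 =
  s - Phi a / b ^+ 2 + ax%:R * (s1 - pi ^+ 2 / 6 / b ^+ 2) by ring.
rewrite mulrDl; apply: le_trans (ler_normD _ _) _; exact: lerD.
Qed.

Lemma parts_var11 a0 : 0 < a0 -> exists2 K : R, 0 < K & forall ax a b, a0 <= a -> 0 < b ->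
  exists2 s, (fun M => \sum_(x <- parts ax M) x.1%:R ^+ 2 * bose1 (a * x.1%:R + b * x.2%:R)) @ \oo --> s
    & `|s - P2 a / b| <= K * expR (- a).
Proof.
move=> a00; have [K K0 HK] := grid_moment_approx a00; have [K' K'0 HK'] := axis_moment_le a00.
exists (K + K') => [|ax a b aa b0]; first exact: addr_gt0.
have [s cs sK] := HK 2%N 0%N a b isT aa b0.
have [s1 cs1 [s1K _]] := HK' 2%N a isT aa.
exists (s + ax%:R * (s1 + 0)).
  apply: parts_cvg.
  - apply: eq_cvgn cs => M; apply: eq_bigr => k _; apply: eq_bigr => l _.
    by rewrite expr0 mulr1.
  - by apply: eq_cvgn cs1 => M; apply: eq_bigr => k _; rewrite mulr0 addr0.
  - by apply: sum0_cvg => k; rewrite expr0n mul0r.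
rewrite fact0 mul1r expr1 expr0 divr1 in sK.
have /andP[x0 x1] := bool01 ax.
have h : `|ax%:R * s1| <= K' * expR (- a).
  by rewrite normrM (ger0_norm x0); apply: le_trans s1K; rewrite ler_piMl.
rewrite addr0 mulrDl addrAC; apply: le_trans (ler_normD _ _) _; exact: lerD.
Qed.

(** The product of the coordinates vanishes on both axes, so only the quadrant contributes. *)
Lemma parts_var12 a0 : 0 < a0 -> exists2 K : R, 0 < K & forall ax a b, a0 <= a -> 0 < b ->
  exists2 s, (fun M => \sum_(x <- parts ax M) x.1%:R * x.2%:R * bose1 (a * x.1%:R + b * x.2%:R)) @ \oo --> s
    & `|s - P1 a / b ^+ 2| <= K * expR (- a) / b.
Proof.
move=> a00; have [K K0 HK] := grid_moment_approx a00.
exists K => // ax a b aa b0; have [s cs sK] := HK 1%N 1%N a b isT aa b0.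
exists (s + ax%:R * (0 + 0)); last by rewrite addr0 mulr0 addr0; rewrite mul1r expr1 in sK.
apply: parts_cvg.
- apply: eq_cvgn cs => M; apply: eq_bigr => k _; apply: eq_bigr => l _.
  by rewrite !expr1.
- by apply: sum0_cvg => k; rewrite mulr0 mul0r.
- by apply: sum0_cvg => k; rewrite !mul0r.
Qed.

(** The second-axis share [t] is kept apart from the quadrant: it is controlled only through the
    limit of b^3 t, for a whole sequence, while the quadrant error is explicit. *)
Lemma parts_var22 a0 : 0 < a0 -> exists2 K : R, 0 < K & forall ax (a b : nat -> R),
  (forall k, a0 <= a k) -> (forall k, 0 < b k) -> b @ \oo --> 0 ->
  exists s t : nat -> R, [/\
    forall k, (fun M => \sum_(x <- parts ax M) x.2%:R ^+ 2 * bose1 (a k * x.1%:R + b k * x.2%:R)) @ \oo --> s k,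
    forall k, `|s k - (2 * Phi (a k) / b k ^+ 3 + ax%:R * t k)| <= K * expR (- a k) / b k ^+ 2
    & (fun k => b k ^+ 3 * t k) @ \oo --> pi ^+ 2 / 3].
Proof.
move=> a00; have [K K0 HK] := grid_moment_approx a00.
exists K => // ax a b aa b0 cb; have [t ct tl] := second_axis_moment2 b0 cb.
have [s Hs] := choice (fun k => let: ex_intro2 s cs sK := HK 0%N 2%N (a k) (b k) isT (aa k) (b0 k) in
  ex_intro (fun s => _ /\ _) s (conj cs sK)).
exists (fun k => s k + ax%:R * (0 + t k)), t; split => // k; have [cs sK] := Hs k.
  apply: parts_cvg.
  - apply: eq_cvgn cs => M; apply: eq_bigr => i _; apply: eq_bigr => l _.
    by rewrite expr0 mul1r.
  - by apply: sum0_cvg => i; rewrite expr0n mul0r.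
  - by apply: eq_cvgn (ct k) => M; apply: eq_bigr => i _; rewrite /= mulr0 add0r.
by rewrite add0r opprD addrACA subrr addr0.
Qed.

End PartMoments.

(** * Asymptotics of the number of partitions *)

Section SaddleParameters.
Variables (R : realType) (ax : bool) (a b : nat -> R) (m n : nat -> nat) (a0 : R).
Let V k := Phi (a k) + ax%:R * (pi ^+ 2 / 6).
Let e k := expR (- a k).

Hypotheses (a00 : 0 < a0) (aa : forall k, a0 <= a k).
Hypotheses (b0 : forall k, 0 < b k) (b1 : forall k, b k <= 1).
Hypothesis m0 : forall k, (0 < m k)%N.
Hypothesis mE : forall k, (m k)%:R = P1 (a k) / b k.
Hypothesis nE : forall k, (n k)%:R = V k / b k ^+ 2.
Hypothesis m_inv : (fun k => ((m k)%:R : R)^-1) @ \oo --> 0.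
Hypothesis n_small : forall c : R, 0 < c ->
  (fun k => expR (- (c * (m k)%:R)) * (n k)%:R) @ \oo --> (0 : R).

Let ag0 k : 0 < a k := lt_le_trans a00 (aa k).
Let e0 k : 0 < e k := expR_gt0 _.
Let e1 k : e k <= 1.
Proof. by rewrite expR_le1 oppr_le0 ltW. Qed.

Let ax01 : 0 <= (ax%:R : R) <= 1 := bool01 R ax.
Let pi6 : 2^-1 <= (pi ^+ 2 / 6 : R).
Proof. by have := pi_ge2 R; nra. Qed.

Let V_ge k : e k <= V k.
Proof.
have [h _ _] := P_ge_exp (ag0 k); have /andP[h1 _] := ax01.
by rewrite /V; apply: le_trans h _; rewrite lerDl mulr_ge0//; have := pi6; lra.
Qed.

Let V0 k : 0 < V k := lt_le_trans (e0 k) (V_ge k).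

Let s k := Num.sqrt (P2 (a k) / b k).
Let t k := Num.sqrt (2 * V k / b k).

Let P20 k : 0 < P2 (a k). Proof. by have [] := P_gt0 (ag0 k). Qed.
Let s_gt0 k : 0 < s k. Proof. by rewrite sqrtr_gt0 divr_gt0. Qed.
Let t_gt0 k : 0 < t k. Proof. by rewrite sqrtr_gt0 divr_gt0 ?mulr_gt0. Qed.
Let s2 k : s k ^+ 2 = P2 (a k) / b k.
Proof. by rewrite sqr_sqrtr// divr_ge0 ?ltW. Qed.
Let t2 k : t k ^+ 2 = 2 * V k / b k.
Proof. by rewrite sqr_sqrtr// divr_ge0 ?mulr_ge0 ?ltW. Qed.

Let w_le_s2 k : e k / b k <= s k ^+ 2.
Proof. by have [_ _ h] := P_ge_exp (ag0 k); rewrite s2 ler_pM2r ?invr_gt0. Qed.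

Let w_le_t2 k : e k / b k <= t k ^+ 2.
Proof.
rewrite t2 ler_pM2r ?invr_gt0//; apply: le_trans (V_ge k) _.
by have := V0 k; lra.
Qed.

Variable K : R.
Hypothesis K0 : 0 < K.
Hypothesis PK : forall k, [/\ Phi (a k) <= K * e k, Psi (a k) <= K * e k,
  P1 (a k) <= K * e k & P2 (a k) <= K * e k].

Let m_le k : (m k)%:R <= K * (e k / b k).
Proof. by have [_ _ h _] := PK k; rewrite mE mulrA ler_pM2r ?invr_gt0. Qed.

Let mr0 k : 0 < (m k)%:R :> R. Proof. by rewrite ltr0n. Qed.

(** Common bound for the inverse standard deviations: both [s^2] and [t^2] are at least e / b, and m
    <= K e / b. *)
Let q k := Num.sqrt (K / (m k)%:R).

Let q_cvg : q @ \oo --> 0.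
Proof.
have h : (fun k => K / (m k)%:R) @ \oo --> K * 0 by apply: cvgnZ.
rewrite mulr0 in h; rewrite -[X in _ --> X]sqrtr0.
by apply: continuous_cvg h; exact: sqrt_continuous.
Qed.

Let inv_le_q x k : 0 < x -> e k / b k <= x ^+ 2 -> x^-1 <= q k.
Proof.
move=> x0 wx; have x2 : 0 < x ^+ 2 by rewrite exprn_gt0.
have -> : x^-1 = Num.sqrt ((x ^+ 2)^-1).
  by rewrite sqrtrV ?(ltW x2)// sqrtr_sqr gtr0_norm.
apply: ler_wsqrtr; rewrite -[K / _]invrK lef_pV2 ?posrE ?invr_gt0 ?divr_gt0//.
rewrite invfM invrK mulrC ler_pdivrMr// mulrC.
by apply: le_trans (m_le k) _; rewrite ler_pM2l.
Qed.

Let s_q k : (s k)^-1 <= q k. Proof. exact: inv_le_q. Qed.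
Let t_q k : (t k)^-1 <= q k. Proof. exact: inv_le_q. Qed.

Let b_cvg : b @ \oo --> 0.
Proof.
have h : (fun k => K / (m k)%:R) @ \oo --> K * 0 by apply: cvgnZ.
rewrite mulr0 in h; apply: (cvg0_le _ h) => k.
rewrite gtr0_norm// ler_pdivlMr// mulrC mE -mulrA mulVf ?gt_eqF// mulr1.
have [_ _ h1 _] := PK k; apply: le_trans h1 _.
by rewrite ler_piMr ?(ltW K0).
Qed.

(** Its square is 2 V / b^3, the leading variance of the second coordinate; [s] plays this role for
    the first one. *)
Let ta k := t k / b k.
Let ta_gt0 k : 0 < ta k. Proof. by rewrite divr_gt0. Qed.

Let cvg_pinfty (u : nat -> R) : (forall k, 0 < u k) -> (forall k, (u k)^-1 <= q k) ->
  u @ \oo --> +oo.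
Proof.
move=> u0 uq; apply/gtr0_cvgV0; first exact: nearW.
apply: (cvg0_le _ q_cvg) => k; by rewrite ger0_norm ?uq// invr_ge0 ltW.
Qed.

Let s_oo : s @ \oo --> +oo. Proof. exact: cvg_pinfty. Qed.
Let ta_oo : ta @ \oo --> +oo.
Proof.
apply: cvg_pinfty => k; first exact: ta_gt0.
rewrite /ta invfM invrK; apply: le_trans (t_q k).
by rewrite ler_piMr ?b1// invr_ge0 ltW.
Qed.

Let D k := Num.sqrt (2 * V k * P2 (a k)).
Let D_gt0 k : 0 < D k. Proof. by rewrite sqrtr_gt0 mulr_gt0 ?mulr_gt0. Qed.
Let D2 k : D k ^+ 2 = 2 * V k * P2 (a k).
Proof. by rewrite sqr_sqrtr// mulr_ge0 ?mulr_ge0 ?ltW. Qed.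

Let stE k : s k * ta k = D k / b k ^+ 2.
Proof.
have -> : s k * ta k = s k * t k / b k by rewrite mulrA.
have -> : s k * t k = D k / b k.
  apply: (@pexpIrn _ 2) => //; rewrite ?nnegrE ?mulr_ge0 ?ltW ?invr_gt0//.
  by rewrite exprMn s2 t2 expr_div_n D2; field; rewrite gt_eqF.
by rewrite expr2 invfM mulrA.
Qed.

(** Correlation of the two coordinates: covariance P1 / b^2 over [s * ta], as recorded in
    [B_def]. *)
Let B k := P1 (a k) / D k.

Let B_gt0 k : 0 < B k.
Proof. by have [_ p1 _] := P_gt0 (ag0 k); rewrite divr_gt0. Qed.

Let B_le k : B k <= 1 - (8 * K)^-1.
Proof.
have [_ p1 _] := P_gt0 (ag0 k).
(* At this vector the two diagonal terms of the form balance, leaving a lower bound for D^2 - P1 D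
   of order e V. Dividing by D^2 = 2 V P2 with P2 <= K e gives a gap independent of [a]. *)
have h := P_quad_lb (Num.sqrt (2 * V k)) (- Num.sqrt (P2 (a k))) (ag0 k).
have sV : Num.sqrt (2 * V k) ^+ 2 = 2 * V k by rewrite sqr_sqrtr// mulr_ge0// ltW.
have sP : Num.sqrt (P2 (a k)) ^+ 2 = P2 (a k) by rewrite sqr_sqrtr// ltW.
have sD : Num.sqrt (2 * V k) * Num.sqrt (P2 (a k)) = D k.
  by rewrite -sqrtrM// mulr_ge0// ltW.
rewrite !sqrrN sV sP in h.
have PV : 2 * Phi (a k) * P2 (a k) <= 2 * V k * P2 (a k).
  rewrite ler_wpM2r ?(ltW (P20 k))// ler_wpM2l// /V lerDl.
  by have := pi6; have /andP[h1 _] := ax01 => h2; rewrite mulr_ge0//; lra.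
have {}h : e k / 4 * (2 * V k + P2 (a k)) <= 2 * D k ^+ 2 - 2 * P1 (a k) * D k.
  rewrite D2 -sD; apply: le_trans h _; rewrite -subr_ge0.
  move: (Num.sqrt (2 * V k)) (Num.sqrt (P2 (a k))) => X Y.
  by have := PV; move: (P2 _) (V k) (Phi _) (P1 _) => p2 v ph p1' h; lra.
have [_ _ _ hK] := PK k.
rewrite /B ler_pdivrMr ?D_gt0// mulrBl mul1r.
have h2 : (8 * K)^-1 * D k ^+ 2 <= e k * V k / 4.
  rewrite D2 mulrC ler_pdivrMr ?mulr_gt0//.
  have -> : e k * V k / 4 * (8 * K) = 2 * V k * (K * e k) by field.
  by rewrite ler_pM2l ?mulr_gt0.
have h3 : 0 <= e k * P2 (a k) by rewrite mulr_ge0 ?ltW.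
have h4 : ((8 * K)^-1 * D k) * D k <= (D k - P1 (a k)) * D k by lra.
by rewrite ler_pM2r ?D_gt0 // in h4; lra.
Qed.

Let B_def k : P1 (a k) / b k ^+ 2 / (s k * ta k) = B k.
Proof.
rewrite stE /B; have := D_gt0 k; have := b0 k; move: (D k) (b k) (P1 _) => d x p x0 d0.
by field; rewrite !gt_eqF.
Qed.

Variables (c7 : R).
Hypothesis c70 : 0 < c7.
Hypothesis drop7 : forall k M p, 2 / b k <= M%:R ->
  `|p.1| <= pi * s k -> `|p.2| <= pi * ta k ->
  c7 / b k * (e k * (p.1 / s k) ^+ 2 +
     (e k + ax%:R) * Num.min 1 ((p.2 / (ta k * b k)) ^+ 2)) <=
  \sum_(x <- parts ax M) lmod_drop (wtp (a k) (b k) x) (phase (s k) (ta k) x p).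

Let K' := K + pi ^+ 2 / 6.
Let K'0 : 0 < K'. Proof. by rewrite addr_gt0//; have := pi6; lra. Qed.
Let c := Num.min (8 * K)^-1 (c7 / (2 * K')).
Let c_gt0 : 0 < c.
Proof. by rewrite lt_min invr_gt0 divr_gt0 ?mulr_gt0. Qed.

Let B_norm k : `|B k| <= 1 - c.
Proof.
rewrite gtr0_norm; last exact: B_gt0.
apply: le_trans (B_le k) _; rewrite lerD2l lerN2 ge_min lexx //.
Qed.

(** In units of the standard deviations the coefficients e / P2 and (e + ax) / V are bounded below,
    and the cap 1 of the minimum, multiplied by e / b, is at least m / K. So [m] plays the role of
    the threshold [L]. *)
Let drop_lb k M p : 2 / b k <= M%:R -> box (pi * s k) (pi * ta k) p ->
  c * Num.min (m k)%:R (p.1 ^+ 2 + p.2 ^+ 2) <=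
  \sum_(x <- parts ax M) lmod_drop (wtp (a k) (b k) x) (phase (s k) (ta k) x p).
Proof.
move=> bM [/=]; rewrite !in_itv/= -!ler_norml => p1 p2.
apply: le_trans (drop7 bM p1 p2).
have tb : ta k * b k = t k by rewrite /ta mulfVK// gt_eqF.
have [hPhi _ _ hP2] := PK k; have /andP[ax0 ax1] := ax01.
have ib : 0 < (b k)^-1 by rewrite invr_gt0.
rewrite tb; set mi := Num.min 1 _.
have h1 : p.1 ^+ 2 / K <= e k / b k * (p.1 / s k) ^+ 2.
  rewrite exprMn exprVn s2 invf_div mulrCA ler_wpM2l ?sqr_ge0//.
  have -> : e k / b k * (b k / P2 (a k)) = e k / P2 (a k) by field; rewrite !gt_eqF.
  by rewrite ler_pdivlMr// mulrC ler_pdivrMr// mulrC.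
have h2 : Num.min (m k)%:R (p.2 ^+ 2) / (2 * K') <= (e k + ax%:R) / b k * mi.
  rewrite /mi; have E0 : 0 <= (e k + ax%:R) / b k by rewrite divr_ge0 ?addr_ge0 ?(ltW (e0 k)) ?(ltW (b0 k)).
  rewrite minr_pMr// le_min mulr1; apply/andP; split.
    apply: (@le_trans _ _ ((m k)%:R / K)).
      apply: ler_pM; rewrite ?invr_ge0 ?mulr_ge0 ?(ltW K'0)//.
      - by rewrite le_min ler0n sqr_ge0.
      - by rewrite ge_min lexx.
      - rewrite lef_pV2 ?posrE ?mulr_gt0// /K'; have := pi6; have := K0; lra.
    rewrite ler_pdivrMr//; apply: le_trans (m_le k) _.
    rewrite mulrC ler_pM2r// ler_pM2r//; lra.
  apply: (@le_trans _ _ (p.2 ^+ 2 / (2 * K'))).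
    by rewrite ler_wpM2r ?invr_ge0 ?mulr_ge0 ?(ltW K'0)// ge_min lexx orbT.
  rewrite exprMn exprVn t2 invf_div.
  have -> : (e k + ax%:R) / b k * (p.2 ^+ 2 * (b k / (2 * V k))) =
    p.2 ^+ 2 * ((e k + ax%:R) / (2 * V k)) by field; rewrite !gt_eqF.
  rewrite ler_wpM2l ?sqr_ge0// ler_pdivlMr ?mulr_gt0// mulrC ler_pdivrMr ?mulr_gt0//.
  have : V k <= K' * (e k + ax%:R).
    rewrite /V /K' mulrDl [K * _]mulrDr.
    have : 0 <= K * ax%:R by rewrite mulr_ge0 ?(ltW K0).
    have : 0 <= pi ^+ 2 / 6 * e k by apply: mulr_ge0; [have := pi6; lra|exact: ltW].
    lra.
  lra.
have h3 : Num.min (m k)%:R (p.1 ^+ 2 + p.2 ^+ 2) / (2 * K') <=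
    p.1 ^+ 2 / K + Num.min (m k)%:R (p.2 ^+ 2) / (2 * K').
  have i1 : p.1 ^+ 2 / (2 * K') <= p.1 ^+ 2 / K.
    rewrite ler_wpM2l ?sqr_ge0// lef_pV2 ?posrE ?mulr_gt0// /K'.
    by have := pi6; have := K0; lra.
  have i2 : Num.min (m k)%:R (p.1 ^+ 2 + p.2 ^+ 2) <= p.1 ^+ 2 + Num.min (m k)%:R (p.2 ^+ 2).
    have := sqr_ge0 p.1; have := sqr_ge0 p.2; move=> z1 z2.
    by rewrite addr_minr le_min !ge_min lexx orbT lerDr z2.
  have : Num.min (m k)%:R (p.1 ^+ 2 + p.2 ^+ 2) / (2 * K') <=
    (p.1 ^+ 2 + Num.min (m k)%:R (p.2 ^+ 2)) / (2 * K').
    by rewrite ler_wpM2r ?invr_ge0 ?mulr_ge0 ?(ltW K'0).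
  by move=> h; apply: le_trans h _; rewrite [leLHS]mulrDl lerD2r.
have mn0 : 0 <= Num.min (m k)%:R (p.1 ^+ 2 + p.2 ^+ 2).
  by rewrite le_min ler0n addr_ge0 ?sqr_ge0.
apply: (@le_trans _ _ (c7 / (2 * K') * Num.min (m k)%:R (p.1 ^+ 2 + p.2 ^+ 2))).
  by rewrite ler_wpM2r// ge_min lexx orbT.
have -> : c7 / b k * (e k * (p.1 / s k) ^+ 2 + (e k + ax%:R) * mi) =
  c7 * (e k / b k * (p.1 / s k) ^+ 2 + (e k + ax%:R) / b k * mi) by ring.
rewrite -[c7 / _ * _]mulrA ler_pM2l// mulrC.
by apply: le_trans h3 _; exact: lerD.
Qed.

(** Because P2 <= K e <= K V, the area scale s ta = D / b^2 is at most (K + 1) V / b^2 = (K + 1) n,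
    so the assumption that exp (- c m) n tends to 0 suffices. *)
Let tail : (fun k => expR (- (c * (m k)%:R)) * (s k * ta k)) @ \oo --> 0.
Proof.
have h := cvgnZ (c := K + 1) (n_small c_gt0); rewrite mulr0 in h.
apply: (cvg0_le _ h) => k.
rewrite ger0_norm; last by rewrite mulr_ge0 ?expR_ge0// mulr_ge0 ?ltW.
rewrite [leRHS]mulrCA ler_wpM2l ?expR_ge0// stE nE [leRHS]mulrA ler_wpM2r ?invr_ge0 ?exprn_ge0 ?(ltW (b0 k))//.
have K1 : 0 < (K + 1) * V k by rewrite mulr_gt0// addr_gt0.
rewrite -(@ler_pXn2r _ 2) ?nnegrE ?(ltW (D_gt0 k)) ?(ltW K1)// D2 exprMn.
have [_ _ _ hP] := PK k.
have h1 : P2 (a k) <= K * V k by apply: le_trans hP _; rewrite ler_pM2l.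
apply: (@le_trans _ _ (2 * V k * (K * V k))).
  by rewrite ler_pM2l ?mulr_gt0.
have -> : (K + 1) ^+ 2 * V k ^+ 2 = 2 * V k * (K * V k) + (K ^+ 2 + 1) * V k ^+ 2 by ring.
by rewrite lerDl mulr_ge0 ?sqr_ge0// addr_ge0 ?sqr_ge0.
Qed.

Let y k (x : nat * nat) := a k * x.1%:R + b k * x.2%:R.
(** Logarithm of the generating product up to o(1). The quadrant gives - Psi / 2 and the first axis
    + Psi, which is why the exponent of [Psi] has opposite signs in the two formulas. *)
Let lam k := Phi (a k) / b k - Psi (a k) / 2 +
  ax%:R * (Psi (a k) + (pi ^+ 2 / 6 / b k + 2^-1 * ln (b k) - 2^-1 * ln (2 * pi))).

Let near_limit (u : nat -> R) (l d : R) : 0 < d -> u @ \oo --> l ->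
  \forall M \near \oo, `|u M - l| <= d.
Proof.
by move=> d0 /cvgrPdist_le /(_ _ d0); apply: filterS => M; rewrite distrC.
Qed.

Let cvg_mul_q (C : R) : (fun k => C * q k) @ \oo --> 0.
Proof. by rewrite -[X in _ --> X](mulr0 C); exact: cvgnZ. Qed.

Let cvg_mul_qq (C : R) : (fun k => C * (q k * q k)) @ \oo --> 0.
Proof.
rewrite -[X in _ --> X](mulr0 C); apply: cvgnZ; rewrite -[X in _ --> X](mul0r 0).
exact: (cvgM q_cvg q_cvg).
Qed.

Let si0 k : 0 <= (s k)^-1. Proof. by rewrite invr_ge0 ltW. Qed.
Let ti0 k : 0 <= (t k)^-1. Proof. by rewrite invr_ge0 ltW. Qed.

Lemma saddle_core :
  (fun k => (npart (if ax then Zsq_nz else Nsq) (m k, n k))%:R *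
    expR (- (a k * (m k)%:R + b k * (n k)%:R)) * expR (- lam k) *
    (2 * pi * (Num.sqrt (2 * V k * P2 (a k) - P1 (a k) ^+ 2) / b k ^+ 2))) @ \oo --> (1 : R).
Proof.
have [C0 C00 H0] := @parts_log_moment R a0 a00.
have [C1 C10 H1] := @parts_mean1 R a0 a00.
have [C2 C20 H2] := @parts_mean2 R a0 a00.
have [C11 C110 H11] := @parts_var11 R a0 a00.
have [C12 C120 H12] := @parts_var12 R a0 a00.
have [C22 C220 H22] := @parts_var22 R a0 a00.
have [C3 C30 H3] := @third_moment_le R a0 a00.
have [s22 [t22 [cv22 b22 l22]]] := H22 ax a b aa b0 b_cvg.
(* For each k a single cut M: beyond n1, n2 and 2 / b, and far enough that every finite moment is
   within a fixed tolerance of its infinite sum. *)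
have exM k : exists M, [/\ [/\ (m k <= M)%N, (n k <= M)%N & 2 / b k <= M%:R],
   `|\sum_(x <- parts ax M) bose_log (y k x) -
      (Phi (a k) / b k - Psi (a k) / 2 + ax%:R * (Psi (a k) + eta_log (b k)))| <= (C0 + 1) * b k,
   `|\sum_(x <- parts ax M) x.1%:R * bose0 (y k x) - (m k)%:R| <= C1 + 1,
   `|\sum_(x <- parts ax M) x.2%:R * bose0 (y k x) - (n k)%:R| <= (C2 + 1) / b k &
   [/\ `|\sum_(x <- parts ax M) x.1%:R ^+ 2 * bose1 (y k x) - P2 (a k) / b k| <= C11 + 1,
   `|\sum_(x <- parts ax M) x.1%:R * x.2%:R * bose1 (y k x) - P1 (a k) / b k ^+ 2| <= (C12 + 1) / b k &
   `|\sum_(x <- parts ax M) x.2%:R ^+ 2 * bose1 (y k x) -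
      (2 * Phi (a k) / b k ^+ 3 + ax%:R * t22 k)| <= (C22 + 1) / b k ^+ 2]].
  have bk := b0 k; have ib : 1 <= (b k)^-1 by rewrite invf_ge1.
  have ib2 : 1 <= (b k ^+ 2)^-1 by rewrite invf_ge1 ?exprn_gt0// exprn_ile1 ?(ltW bk) ?b1.
  have comb (x x' l d C : R) : `|x - x'| <= d -> `|x' - l| <= C -> `|x - l| <= C + d.
    move=> h1 h2; have -> : x - l = (x' - l) + (x - x') by ring.
    by apply: le_trans (ler_normD _ _) _; exact: lerD.
  have [v0 cv0 e0'] := H0 ax (a k) (b k) (aa k) bk.
  have [v1 cv1 e1'] := H1 ax (a k) (b k) (aa k) bk.
  have [v2 cv2 e2'] := H2 ax (a k) (b k) (aa k) bk (b1 k).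
  have [v11 cv11 e11'] := H11 ax (a k) (b k) (aa k) bk.
  have [v12 cv12 e12'] := H12 ax (a k) (b k) (aa k) bk.
  have [N _ HN] : \forall M \near \oo, [/\ [/\ (m k <= M)%N, (n k <= M)%N & 2 / b k <= M%:R],
   `|\sum_(x <- parts ax M) bose_log (y k x) - v0| <= b k,
   `|\sum_(x <- parts ax M) x.1%:R * bose0 (y k x) - v1| <= 1,
   `|\sum_(x <- parts ax M) x.2%:R * bose0 (y k x) - v2| <= 1 &
   [/\ `|\sum_(x <- parts ax M) x.1%:R ^+ 2 * bose1 (y k x) - v11| <= 1,
   `|\sum_(x <- parts ax M) x.1%:R * x.2%:R * bose1 (y k x) - v12| <= 1 &
   `|\sum_(x <- parts ax M) x.2%:R ^+ 2 * bose1 (y k x) - s22 k| <= 1]].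
    have q1 := nbhs_infty_ge (m k); have q2 := nbhs_infty_ge (n k).
    have q3 := nbhs_infty_ger (2 / b k).
    have q4 := near_limit bk cv0; have q5 := near_limit ltr01 cv1.
    have q6 := near_limit ltr01 cv2; have q7 := near_limit ltr01 cv11.
    have q8 := near_limit ltr01 cv12; have q9 := near_limit ltr01 (cv22 k).
    near=> M; split; [split|..|split]; near: M => //.
  have [[k1 k2 k3] k4 k5 k6 [k7 k8 k9]] := HN N (leqnn N).
  have ee : e k <= 1 := e1 k.
  exists N; split => //.
  - by rewrite mulrDl mul1r; exact: comb k4 e0'.
  - rewrite mE; apply: le_trans (comb _ _ _ _ _ k5 e1') _.
    by rewrite lerD2r ler_piMr ?(ltW C10).
  - rewrite nE; apply: le_trans (comb _ _ _ _ _ k6 e2') _.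
    by rewrite mulrDl mul1r lerD2l.
  split.
  - by apply: le_trans (comb _ _ _ _ _ k7 e11') _; rewrite lerD2r ler_piMr ?(ltW C110).
  - apply: le_trans (comb _ _ _ _ _ k8 e12') _; rewrite mulrDl mul1r; apply: lerD => //.
    by rewrite ler_pM2r ?invr_gt0// ler_piMr ?(ltW C120).
  - apply: le_trans (comb _ _ _ _ _ k9 (b22 k)) _; rewrite mulrDl mul1r; apply: lerD => //.
    by rewrite ler_pM2r ?invr_gt0 ?exprn_gt0// ler_piMr ?(ltW C220).
have [M HM] := choice exM.
have mulq (X C : R) k : `|X| <= C -> `|X / s k| <= C * q k.
  by move=> XC; rewrite normrM (ger0_norm (si0 k)) ler_pM.
have mulqq (X C x z : R) k : `|X| <= C -> 0 <= x -> 0 <= z -> x <= q k -> z <= q k ->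
    `|X * (x * z)| <= C * (q k * q k).
  move=> XC x0 z0 xq zq; rewrite normrM (ger0_norm (mulr_ge0 x0 z0)).
  by apply: ler_pM; rewrite ?mulr_ge0//; exact: ler_pM.
have nb k : b k != 0 by rewrite gt_eqF.
have nt k : t k != 0 by rewrite gt_eqF.
have ns k : s k != 0 by rewrite gt_eqF.
have mean1 : (fun k => (\sum_(x <- parts ax (M k)) x.1%:R * bose0 (y k x) - (m k)%:R) / s k) @ \oo --> 0.
  by apply: (cvg0_le _ (cvg_mul_q (C1 + 1))) => k; have [_ _ h _ _] := HM k; exact: mulq.
have mean2 : (fun k => (\sum_(x <- parts ax (M k)) x.2%:R * bose0 (y k x) - (n k)%:R) / ta k) @ \oo --> 0.
  apply: (cvg0_le _ (cvg_mul_q (C2 + 1))) => k; have [_ _ _ h _] := HM k.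
  rewrite normrM (@ger0_norm _ (ta k)^-1) ?invr_ge0 ?(ltW (ta_gt0 k))//.
  apply: (@le_trans _ _ ((C2 + 1) / b k * (ta k)^-1)).
    by rewrite ler_wpM2r// invr_ge0 ltW.
  have -> : (C2 + 1) / b k * (ta k)^-1 = (C2 + 1) * (t k)^-1 by rewrite /ta; field; rewrite nb nt.
  by rewrite ler_wpM2l// addr_ge0// ltW.
have var11 : (fun k => (\sum_(x <- parts ax (M k)) x.1%:R ^+ 2 * bose1 (y k x)) / s k ^+ 2) @ \oo --> (1 : R).
  apply: cvg_dist0; apply: (cvg0_le _ (cvg_mul_qq (C11 + 1))) => k; have [_ _ _ _ [h _ _]] := HM k.
  have -> : (\sum_(x <- parts ax (M k)) x.1%:R ^+ 2 * bose1 (y k x)) / s k ^+ 2 - 1 =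
     (\sum_(x <- parts ax (M k)) x.1%:R ^+ 2 * bose1 (y k x) - P2 (a k) / b k) * ((s k)^-1 * (s k)^-1).
    by rewrite -s2; field.
  exact: mulqq.
have var12 : (fun k => (\sum_(x <- parts ax (M k)) x.1%:R * x.2%:R * bose1 (y k x)) / (s k * ta k) - B k)
    @ \oo --> (0 : R).
  apply: (cvg0_le _ (cvg_mul_qq (C12 + 1))) => k; have [_ _ _ _ [_ h _]] := HM k.
  rewrite -B_def -mulrBl.
  set X := _ - _ in h *; have -> : X / (s k * ta k) = (X * b k) * ((s k)^-1 * (t k)^-1).
    by rewrite /ta; field; rewrite nb ns nt.
  by apply: mulqq => //; rewrite normrM (gtr0_norm (b0 k)) -ler_pdivlMr.
have var22 : (fun k => (\sum_(x <- parts ax (M k)) x.2%:R ^+ 2 * bose1 (y k x)) / ta k ^+ 2) @ \oo --> (1 : R).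
  apply: cvg_dist0.
  pose X k := \sum_(x <- parts ax (M k)) x.2%:R ^+ 2 * bose1 (y k x) -
      (2 * Phi (a k) / b k ^+ 3 + ax%:R * t22 k).
  have h1 : (fun k => X k * b k ^+ 2 * ((t k)^-1 * (t k)^-1)) @ \oo --> 0.
    apply: (cvg0_le _ (cvg_mul_qq (C22 + 1))) => k; have [_ _ _ _ [_ _ h]] := HM k.
    apply: mulqq => //; rewrite normrM (@gtr0_norm _ (b k ^+ 2)) ?exprn_gt0//.
    by rewrite -ler_pdivlMr ?exprn_gt0.
  (* When the axes are present V is at least pi^2 / 6, so dividing by 2 V keeps the error null even
     if [Phi] tends to 0; otherwise the term is 0. *)
  have h2 : (fun k => (b k ^+ 3 * t22 k - pi ^+ 2 / 3) * (ax%:R / (2 * V k))) @ \oo --> 0.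
    apply: (@cvg0_mul_bounded _ _ _ 1).
      move=> k; have v0 : 0 < 2 * V k by rewrite mulr_gt0.
      rewrite ger0_norm ?divr_ge0 ?(ltW v0)// ler_pdivrMr// mul1r /V.
      have [ph _ _] := P_gt0 (ag0 k).
      by have := pi6; have /andP[x0 x1] := ax01; nra.
    rewrite -[X in _ --> X](subrr (pi ^+ 2 / 3)); apply: cvgB => //; exact: cvg_cst.
  have := cvgnD h1 h2; rewrite addr0; apply: eq_cvgn => k.
  have E : ta k ^+ 2 = 2 * V k / b k ^+ 3 by rewrite /ta expr_div_n t2; field.
  have E2 : (t k)^-1 * (t k)^-1 = b k / (2 * V k).
    by rewrite -invfM -expr2 t2 invf_div.
  have v0 : V k != 0 by rewrite gt_eqF.
  have PV : Phi (a k) = V k - ax%:R * (pi ^+ 2 / 6) by rewrite /V addrK.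
  rewrite E E2 /X PV; move: v0 (nb k).
  move: (V k) (b k) (t22 k) (\sum_(_ <- _) _) (pi : R) => v b' t' S p v0 b0'.
  by field; rewrite v0 b0'.
have third : (fun k => \sum_(x <- parts ax (M k)) wtp (a k) (b k) x / (1 - wtp (a k) (b k) x) ^+ 3 *
    (x.1%:R / s k + x.2%:R / ta k) ^+ 3) @ \oo --> (0 : R).
  apply: (cvg0_le _ (cvg_mul_q (C3 * 4))) => k.
  have w0 x : Zsq_nz x -> 0 <= wtp (a k) (b k) x < 1.
    move=> x0; rewrite expR_ge0/= expR_lt1 oppr_lt0; have := ag0 k; have := b0 k.
    by case: x x0 => [[|i] [|j]] //= _ b0' a0'; rewrite ?mulr0 ?add0r ?addr0 ?addr_gt0 ?mulr_gt0.
  rewrite ger0_norm; last first.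
    rewrite big_seq; apply: sumr_ge0 => x /parts_nz /w0 /andP[x0 x1].
    apply: mulr_ge0; first by rewrite divr_ge0// exprn_ge0// subr_ge0 ltW.
    by apply: exprn_ge0; rewrite addr_ge0// divr_ge0// ltW.
  apply: le_trans (H3 ax (M k) (a k) (b k) (s k) (ta k) (aa k) (b0 k) (s_gt0 k) (ta_gt0 k)) _.
  rewrite -[leRHS]mulrA ler_pM2l//.
  have w1 : e k / b k / s k ^+ 3 <= q k.
    apply: le_trans (s_q k); rewrite ler_pdivrMr ?exprn_gt0//.
    have -> : (s k)^-1 * s k ^+ 3 = s k ^+ 2 by field.
    exact: w_le_s2.
  have w2 : e k / b k ^+ 4 / ta k ^+ 3 <= q k.
    apply: le_trans (t_q k).
    have -> : e k / b k ^+ 4 / ta k ^+ 3 = e k / b k / t k ^+ 3 by rewrite /ta; field; rewrite nt nb.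
    rewrite ler_pdivrMr ?exprn_gt0//.
    have -> : (t k)^-1 * t k ^+ 3 = t k ^+ 2 by field.
    exact: w_le_t2.
  have w3 : e k / s k ^+ 3 <= q k.
    apply: le_trans w1; rewrite ler_wpM2r ?invr_ge0 ?exprn_ge0 ?(ltW (s_gt0 k))//.
    by rewrite ler_pdivlMr// ler_piMr ?b1 ?(ltW (e0 k)).
  have w4 : ax%:R * (b k ^+ 4 * ta k ^+ 3)^-1 <= q k.
    have v0 : V k != 0 by rewrite gt_eqF.
    have -> : ax%:R * (b k ^+ 4 * ta k ^+ 3)^-1 = (ax%:R / (2 * V k)) * (t k)^-1.
      have -> : 2 * V k = t k ^+ 2 * b k by rewrite t2 mulfVK.
      by rewrite /ta; field; rewrite nt nb.
    apply: le_trans (t_q k); rewrite ler_piMl//.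
    have [ph _ _] := P_gt0 (ag0 k).
    rewrite ler_pdivrMr ?mulr_gt0// mul1r /V.
    by have := pi6; have /andP[x0 x1] := ax01; nra.
  have q0 : 0 <= q k by exact: le_trans (s_q k).
  have w5 : ax%:R * (e k / s k ^+ 3) <= q k.
    apply: le_trans w3; have /andP[x0 x1] := ax01.
    by rewrite ler_piMl// divr_ge0 ?exprn_ge0 ?(ltW (s_gt0 k)) ?(ltW (e0 k)).
  by rewrite -/(e k) mulrDr; lra.
have S0_cvg : (fun k => \sum_(x <- parts ax (M k)) bose_log (y k x) - lam k) @ \oo --> 0.
  have h1 : (fun k => \sum_(x <- parts ax (M k)) bose_log (y k x) -
      (Phi (a k) / b k - Psi (a k) / 2 + ax%:R * (Psi (a k) + eta_log (b k)))) @ \oo --> 0.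
    have h := cvgnZ (c := C0 + 1) b_cvg; rewrite mulr0 in h.
    by apply: (cvg0_le _ h) => k; have [] := HM k.
  have h2 := cvgnZ (c := ax%:R) (eta_log_asymp b0 b_cvg).
  have := cvgnD h1 h2; rewrite mulr0 addr0; apply: eq_cvgn => k.
  by rewrite /lam; ring.
have dlb k p : box (pi * s k) (pi * ta k) p -> c * Num.min (m k)%:R (p.1 ^+ 2 + p.2 ^+ 2) <=
    \sum_(x <- parts ax (M k)) lmod_drop (wtp (a k) (b k) x) (phase (s k) (ta k) x p).
  by move=> pb; have [[_ _ h] _ _ _ _] := HM k; exact: drop_lb.
have H := saddle_point c_gt0 ag0 b0 s_gt0 ta_gt0 (fun k => ler0n R (m k))
  (fun k => uniq_parts ax (M k)) (fun k x => @parts_nz ax (M k) x) s_oo ta_oo B_norm dlb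
  mean1 mean2 var11 var12 var22 third tail.
have X_cvg : (fun k => expR (\sum_(x <- parts ax (M k)) bose_log (y k x) - lam k)) @ \oo --> (1 : R).
  by rewrite -[X in _ --> X]expR0; apply: continuous_cvg S0_cvg; exact: continuous_expR.
have HX := cvgnM H X_cvg; rewrite mulr1 in HX; apply: eq_cvgn HX => k /=.
have [[k1 k2 _] _ _ _ _] := HM k.
rewrite (@npart_parts ax (M k) (m k, n k) k1 k2).
have E1 : expR (- lam k) = expR (- \sum_(x <- parts ax (M k)) bose_log (y k x)) *
    expR (\sum_(x <- parts ax (M k)) bose_log (y k x) - lam k).
  by rewrite -expRD addKr.
have E2 : Num.sqrt (2 * V k * P2 (a k) - P1 (a k) ^+ 2) / b k ^+ 2 =
    s k * ta k * Num.sqrt (1 - B k ^+ 2).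
  have Bn : 0 <= 1 - B k ^+ 2.
    rewrite subr_ge0 expr_le1// ?(ltW (B_gt0 k))//.
    by apply: le_trans (B_le k) _; rewrite gerBl invr_ge0 mulr_ge0// ltW.
  have -> : 2 * V k * P2 (a k) - P1 (a k) ^+ 2 = D k ^+ 2 * (1 - B k ^+ 2).
    by rewrite mulrBr mulr1 -exprMn /B [D k * _]mulrC mulfVK ?D2// gt_eqF.
  by rewrite sqrtrM ?sqr_ge0// sqrtr_sqr (gtr0_norm (D_gt0 k)) stE mulrAC.
rewrite E1 E2; move: (npart _ _)%:R (expR _) (expR _) (expR _) (Num.sqrt _) (pi : R) => *.
ring.
Unshelve. all: by end_near.
Qed.

End SaddleParameters.

(** * From the hypotheses on n1 and n2 to the two asymptotic formulas *)

Section Asymptotics.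
Variables (R : realType) (ax : bool) (n1 n2 : nat -> nat).
Hypotheses (n1_gt0 : forall k, (0 < n1 k)%N) (n2_gt0 : forall k, (0 < n2 k)%N).
Hypotheses (n1_oo : n1 k @[k --> \oo] --> \oo) (n2_oo : n2 k @[k --> \oo] --> \oo).
Hypothesis n1_bigO : (fun k => (n1 k)%:R : R) =O_\oo (fun k => Num.sqrt ((n2 k)%:R : R)).
Hypothesis n2_littleo : (fun k => ln ((n2 k)%:R : R)) =o_\oo (fun k => (n1 k)%:R : R).

Definition PhiE (a : R) : R := Phi a + ax%:R * (pi ^+ 2 / 6).

Let E0 : 0 <= ax%:R * (pi ^+ 2 / 6) :> R.
Proof. by rewrite mulr_ge0// divr_ge0 ?sqr_ge0. Qed.

Let n1r k : 0 < (n1 k)%:R :> R. Proof. by rewrite ltr0n. Qed.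
Let n2r k : 0 < (n2 k)%:R :> R. Proof. by rewrite ltr0n. Qed.
Let s2r k : 0 < Num.sqrt ((n2 k)%:R : R). Proof. by rewrite sqrtr_gt0. Qed.

Lemma PhiE_solution k :
  exists! a : R, 0 < a /\ theta_of PhiE a = (n1 k)%:R / Num.sqrt (n2 k)%:R.
Proof. by apply: theta_solution => //; rewrite divr_gt0. Qed.

Lemma PhiE_gt0 a : 0 < a -> 0 < PhiE a.
Proof. by move=> a0; have [h _ _] := P_gt0 a0; rewrite ltr_wpDr. Qed.

Let natr_oo (u : nat -> nat) : u k @[k --> \oo] --> \oo ->
  (fun k => (u k)%:R : R) @ \oo --> +oo.
Proof. by move=> uoo; apply: cvg_comp uoo _; exact: cvgr_idn. Qed.

Let n1_inv : (fun k => ((n1 k)%:R : R)^-1) @ \oo --> 0.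
Proof.
have h := natr_oo n1_oo.
by have [_] := @gtr0_cvgV0 R nat \oo _ (fun k => (n1 k)%:R) (nearW _ n1r); exact.
Qed.

(** From log n2 = o(n1), eventually n2 <= exp (c n1 / 2), which half of the exponential absorbs. *)
Let n2_small (c : R) : 0 < c ->
  (fun k => expR (- (c * (n1 k)%:R)) * (n2 k)%:R) @ \oo --> (0 : R).
Proof.
move=> c0; have c2 : 0 < c / 2 by rewrite divr_gt0.
have h := cvgnZ (c := (c / 2)^-1) n1_inv; rewrite mulr0 in h.
apply: near_cvg0_le h; move/eqoP : n2_littleo => /(_ _ c2).
apply: filterS => k; rewrite (ger0_norm (ler0n R (n1 k))) => /(le_trans (ler_norm _)) lk.
rewrite ger0_norm ?mulr_ge0 ?expR_ge0//.
rewrite -[(n2 k)%:R]lnK ?posrE// -expRD -invfM.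
apply: (@le_trans _ _ (expR (- (c / 2 * (n1 k)%:R)))).
  by rewrite ler_expR; lra.
have z0 : 0 < c / 2 * (n1 k)%:R by rewrite mulr_gt0.
rewrite expRN lef_pV2 ?posrE ?expR_gt0//.
by have := expR_ge1Dx (c / 2 * (n1 k)%:R); lra.
Qed.

Variable al : nat -> R.
Hypothesis al_gt0 : forall k, 0 < al k.
Hypothesis alE : forall k, theta_of PhiE (al k) = (n1 k)%:R / Num.sqrt (n2 k)%:R.

Let be k := Num.sqrt (PhiE (al k)) / Num.sqrt (n2 k)%:R.

Let be_gt0 k : 0 < be k. Proof. by rewrite divr_gt0// sqrtr_gt0 PhiE_gt0. Qed.

Let be2 k : be k ^+ 2 = PhiE (al k) / (n2 k)%:R.
Proof. by rewrite expr_div_n !sqr_sqrtr// ltW// PhiE_gt0. Qed.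

(** With this choice of [be] the equation for [al] reads exactly P1 / be = n1. *)
Let n1E k : (n1 k)%:R = P1 (al k) / be k.
Proof.
have h := alE k; rewrite theta_of_PhiD// in h.
have v0 : 0 < Num.sqrt (PhiE (al k)) by rewrite sqrtr_gt0 PhiE_gt0.
move: h; rewrite -/(PhiE (al k)) /be => h.
rewrite invf_div mulrA mulrAC h mulfVK// gt_eqF//.
Qed.

Let n2E k : (n2 k)%:R = PhiE (al k) / be k ^+ 2.
Proof. by rewrite be2 invf_div mulrC mulfVK// gt_eqF// PhiE_gt0. Qed.

Lemma npart_asymp :
  (fun k => (npart (if ax then Zsq_nz else Nsq) (n1 k, n2 k))%:R *
    expR (- (al k * (n1 k)%:R + be k * (n2 k)%:R)) *
    expR (- (Phi (al k) / be k - Psi (al k) / 2 +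
      ax%:R * (Psi (al k) + (pi ^+ 2 / 6 / be k + 2^-1 * ln (be k) - 2^-1 * ln (2 * pi))))) *
    (2 * pi * (Num.sqrt (2 * PhiE (al k) * P2 (al k) - P1 (al k) ^+ 2) / be k ^+ 2)))
  @ \oo --> (1 : R).
Proof.
have [C HC] : exists C : R, \forall k \near \oo, (n1 k)%:R <= C * Num.sqrt ((n2 k)%:R : R).
  have /eqOP [C [_ h]] := n1_bigO; exists (C + 1).
  have := h (C + 1) ltac:(by rewrite ltrDl).
  apply: filterS => k; rewrite (ger0_norm (ler0n R (n1 k))).
  by rewrite (ger0_norm (ltW (s2r k))).
have [a0 a00 Ha0] := theta_bounded_below E0 C.
have [K K0 HK] := P_le_exp a00.
have [c7 c70 Hc7] := lmod_drop_sum_lb R.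
pose W := K + pi ^+ 2 / 6.
(* The bounds on [al] and [be] hold only eventually, whereas [saddle_core] wants them for every
   index; the sequences are therefore shifted by N. *)
have [N _ HN] : \forall k \near \oo, a0 <= al k /\ be k <= 1.
  have h2 := natr_oo n2_oo; move/cvgryPge : h2 => /(_ W) h2.
  near=> k; have hk : (n1 k)%:R <= C * Num.sqrt ((n2 k)%:R : R) by near: k.
  have wk : W <= (n2 k)%:R by near: k.
  have ak : a0 <= al k.
    apply: Ha0 => //; have h := alE k; rewrite theta_of_PhiD// in h.
    by rewrite h ler_pdivrMr.
  split=> //; rewrite ler_pdivrMr// mul1r; apply: ler_wsqrtr.
  apply: le_trans wk; have [ph _ _ _] := HK _ ak; apply: lerD.
    apply: le_trans ph _; rewrite ler_piMr ?(ltW K0)// expR_le1 oppr_le0.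
    exact: ltW.
  by have /andP[x0 x1] := bool01 R ax; rewrite ler_piMl// divr_ge0 ?sqr_ge0.
rewrite -(cvg_shiftn N).
have shift0 (u : nat -> R) : u @ \oo --> 0 -> (fun k => u (k + N)%N) @ \oo --> 0.
  by move=> u0; rewrite (cvg_shiftn N u).
have hN k : a0 <= al (k + N)%N /\ be (k + N)%N <= 1 by apply: HN; rewrite /= leq_addl.
apply: (@saddle_core R ax (fun k => al (k + N)%N) (fun k => be (k + N)%N)
  (fun k => n1 (k + N)%N) (fun k => n2 (k + N)%N) a0 a00 _ _ _ _ _ _ _ _ K K0 _ c7 c70).
- by move=> k; case: (hN k).
- by move=> k.
- by move=> k; case: (hN k).
- by move=> k.
- by move=> k; exact: n1E.
- by move=> k; exact: n2E.
- exact: (shift0 _ n1_inv).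
- by move=> c cc; exact: (shift0 _ (n2_small cc)).
- by move=> k; apply: HK; case: (hN k).
- move=> k M p hM p1 p2; have [h1 h2] := hN k.
  apply: Hc7 => //; first by rewrite sqrtr_gt0 divr_gt0//; have [] := P_gt0 (al_gt0 (k + N)%N).
  by rewrite divr_gt0// sqrtr_gt0 divr_gt0// mulr_gt0// PhiE_gt0.
Unshelve. all: by end_near.
Qed.

(** Here be n2 = PhiE / be = sqrt (PhiE n2), whence the coefficient 2 of the square root. As be^2 =
    PhiE / n2, the half logarithm of [be] from the second axis becomes a quarter logarithm of PhiE /
    n2. *)
Lemma npart_asymp_theta :
  (fun k => (npart (if ax then Zsq_nz else Nsq) (n1 k, n2 k))%:R *
    expR (- ((al k * theta_of PhiE (al k) + 2 * Num.sqrt (PhiE (al k))) * Num.sqrt (n2 k)%:R)) *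
    expR (Psi (al k) / 2 -
      ax%:R * (Psi (al k) + 4^-1 * ln (PhiE (al k) / (n2 k)%:R) - 2^-1 * ln (2 * pi))) *
    (2 * pi * (Num.sqrt (delta_of PhiE (al k)) / (PhiE (al k) / (n2 k)%:R))))
  @ \oo --> (1 : R).
Proof.
apply: eq_cvgn npart_asymp => k; rewrite delta_of_PhiD// -/(PhiE (al k)) -be2.
congr (_ * _); rewrite -[LHS]mulrA -[RHS]mulrA -!expRD; congr (_ * expR _).
have v0 := PhiE_gt0 (al_gt0 k); have sv : 0 < Num.sqrt (PhiE (al k)) by rewrite sqrtr_gt0.
have -> : ln (be k ^+ 2) = 2 * ln (be k) by rewrite lnXn// mulr_natl.
have -> : (al k * theta_of PhiE (al k) + 2 * Num.sqrt (PhiE (al k))) * Num.sqrt (n2 k)%:R =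
    al k * (n1 k)%:R + be k * (n2 k)%:R + PhiE (al k) / be k.
  rewrite alE mulrDl -[al k * _ * _]mulrA mulfVK ?gt_eqF// -addrA; congr (_ + _).
  have nn : (n2 k)%:R = Num.sqrt (n2 k)%:R ^+ 2 :> R by rewrite sqr_sqrtr.
  have vv : PhiE (al k) = Num.sqrt (PhiE (al k)) ^+ 2 by rewrite sqr_sqrtr// ltW.
  rewrite [X in _ = be k * X + _]nn [X in _ = _ + X / _]vv /be; have := s2r k.
  move: (Num.sqrt _) (Num.sqrt _) sv => x z x0 z0.
  by field; rewrite !gt_eqF.
rewrite /PhiE; move: (be_gt0 k); move: (be k) (ln (2 * pi)) (pi ^+ 2 / 6) => x l c x0.
by move: (ln x) => y; field; rewrite gt_eqF.
Qed.

End Asymptotics.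

Theorem theorem2p1 (R : realType) (n1 n2 : nat -> nat)
  (n1_gt0 : forall k, (0 < n1 k)%N) (n2_gt0 : forall k, (0 < n2 k)%N)
  (n1_oo : n1 k @[k --> \oo] --> \oo) (n2_oo : n2 k @[k --> \oo] --> \oo)
  (n1_bigO : (fun k => (n1 k)%:R : R) =O_\oo
             (fun k => Num.sqrt ((n2 k)%:R : R)))
  (n2_littleo : (fun k => ln ((n2 k)%:R : R)) =o_\oo
                (fun k => (n1 k)%:R : R)) :
  ((forall k, exists! a : R,
      0 < a /\ Theta a = (n1 k)%:R / Num.sqrt (n2 k)%:R) /\
   (forall alpha : nat -> R,
      (forall k, 0 < alpha k /\
                 Theta (alpha k) = (n1 k)%:R / Num.sqrt (n2 k)%:R) ->
      asymp_equiv
        (fun k => (npart Nsq (n1 k, n2 k))%:R)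
        (fun k =>
           1 / (2 * pi) * (Phi (alpha k) / (n2 k)%:R) *
           (expR (- (1 / 2) * Psi (alpha k)) / Num.sqrt (Delta (alpha k))) *
           expR ((alpha k * Theta (alpha k) + 2 * Num.sqrt (Phi (alpha k))) *
                 Num.sqrt (n2 k)%:R)))) /\
  ((forall k, exists! a : R,
      0 < a /\ Thetabar a = (n1 k)%:R / Num.sqrt (n2 k)%:R) /\
   (forall alpha : nat -> R,
      (forall k, 0 < alpha k /\
                 Thetabar (alpha k) = (n1 k)%:R / Num.sqrt (n2 k)%:R) ->
      asymp_equiv
        (fun k => (npart Zsq_nz (n1 k, n2 k))%:R)
        (fun k =>
           1 / ((2 * pi) `^ (3 / 2)) *
           (Phibar (alpha k) / (n2 k)%:R) `^ (5 / 4) *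
           (expR (1 / 2 * Psi (alpha k)) / Num.sqrt (Deltabar (alpha k))) *
           expR ((alpha k * Thetabar (alpha k) +
                  2 * Num.sqrt (Phibar (alpha k))) *
                 Num.sqrt (n2 k)%:R)))).
Proof.
have PhiF : @Phi R = @PhiE R false by apply/funext => a; rewrite /PhiE mul0r addr0.
have PhiT : @Phibar R = @PhiE R true by apply/funext => a; rewrite /PhiE mul1r.
have pi0 : (pi : R) != 0 by rewrite gt_eqF// pi_gt0.
have nR k : 0 < (n2 k)%:R :> R by rewrite ltr0n.
have sol ax k := @PhiE_solution R ax n1 n2 n1_gt0 n2_gt0 k.
have delta0 ax a : 0 < a -> 0 < Num.sqrt (delta_of (@PhiE R ax) a).
  move=> a0; rewrite sqrtr_gt0 delta_of_PhiD//; apply: delta_gt0 => //.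
  by rewrite mulr_ge0// divr_ge0 ?sqr_ge0.
split; split.
- by move=> k; rewrite /Theta PhiF; exact: sol.
- move=> alpha H.
  have a0 k : 0 < alpha k by case: (H k).
  have aE k : theta_of (@PhiE R false) (alpha k) = (n1 k)%:R / Num.sqrt (n2 k)%:R.
    by rewrite -PhiF; case: (H k).
  have := npart_asymp_theta n1_gt0 n2_gt0 n1_oo n2_oo n1_bigO n2_littleo a0 aE.
  apply: eq_cvgn => k; rewrite /Theta /Delta PhiF.
  have d0 := delta0 false _ (a0 k); have v0 := PhiE_gt0 false (a0 k).
  rewrite mul0r subr0 expRN.
  have -> : expR (- (1 / 2) * Psi (alpha k)) = (expR (Psi (alpha k) / 2))^-1.
    by rewrite -expRN; congr expR; lra.
  set X := expR (_ * Num.sqrt _); have X0 : 0 < X := expR_gt0 _.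
  set Y := expR (Psi _ / 2); have Y0 : 0 < Y := expR_gt0 _.
  clearbody X Y; have n0 := nR k; move: d0 v0 n0.
  move: (Num.sqrt _) (PhiE _ _) ((n2 k)%:R : R) (npart _ _)%:R (pi : R) pi0.
  move=> d v n N p p0 d0 v0 n0.
  by field; rewrite p0 !gt_eqF.
- by move=> k; rewrite /Thetabar PhiT; exact: sol.
- move=> alpha H.
  have a0 k : 0 < alpha k by case: (H k).
  have aE k : theta_of (@PhiE R true) (alpha k) = (n1 k)%:R / Num.sqrt (n2 k)%:R.
    by rewrite -PhiT; case: (H k).
  have := npart_asymp_theta n1_gt0 n2_gt0 n1_oo n2_oo n1_bigO n2_littleo a0 aE.
  apply: eq_cvgn => k; rewrite /Thetabar /Deltabar PhiT.
  have d0 := delta0 true _ (a0 k); have v0 := PhiE_gt0 true (a0 k).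
  have x0 : 0 < PhiE true (alpha k) / (n2 k)%:R by rewrite divr_gt0.
  have p2 : 0 < 2 * pi :> R by rewrite mulr_gt0 ?pi_gt0.
  rewrite [true%:R * _]mul1r expRN.
  (* 5 / 4 = 1 + 1 / 4: the first power comes from the determinant of the covariance, the quarter
     from the second axis. Likewise 3 / 2 = 1 + 1 / 2 for 2 pi just below. *)
  have -> : (PhiE true (alpha k) / (n2 k)%:R) `^ (5 / 4) =
     PhiE true (alpha k) / (n2 k)%:R * expR (4^-1 * ln (PhiE true (alpha k) / (n2 k)%:R)).
    rewrite -{2}(lnK x0) -expRD /powR gt_eqF//; congr expR; lra.
  have -> : (2 * pi) `^ (3 / 2) = 2 * pi * expR (2^-1 * ln (2 * pi)) :> R.
    rewrite -{2}(lnK p2) -expRD /powR gt_eqF//; congr expR; lra.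
  have -> : expR (Psi (alpha k) / 2 - (Psi (alpha k) +
      4^-1 * ln (PhiE true (alpha k) / (n2 k)%:R) - 2^-1 * ln (2 * pi))) =
    (expR (1 / 2 * Psi (alpha k)))^-1 * (expR (4^-1 * ln (PhiE true (alpha k) / (n2 k)%:R)))^-1 *
    expR (2^-1 * ln (2 * pi)).
    by rewrite -!expRN -!expRD; congr expR; lra.
  set X := expR (_ * Num.sqrt _); have X0 : 0 < X := expR_gt0 _.
  set Y := expR (1 / 2 * _); have Y0 : 0 < Y := expR_gt0 _.
  set Z := expR (4^-1 * _); have Z0 : 0 < Z := expR_gt0 _.
  set W := expR (2^-1 * _); have W0 : 0 < W := expR_gt0 _.
  clearbody X Y Z W; move: d0 x0.
  move: (PhiE _ _ / _) (Num.sqrt _) (npart _ _)%:R (pi : R) pi0 => x d N p p0 d0 x0.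
  by field; rewrite p0 !gt_eqF.
Qed.
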